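(* Let $t>0$ and $\lambda>0$. For nonnegative integers $k,r$, for $w>0$ and for $x\in\mathbb R$, let $$R_{k,r,w}=\max\left\{\frac{kt}{w^2}-\frac1w,\ \frac1w-\frac{(r+1)t}{w^2}\right\},\qquad S_{k,r,w}=\min\left\{\frac{(k+1)t}{w^2}-\frac1w,\ \frac1w-\frac{rt}{w^2}\right\},$$ $$y_w=\frac{\lambda t}{2w},\qquad A_{k,r,w}(x)=\Big\{z\in[R_{k,r,w}+x,\ S_{k,r,w}+x]:\ \min_{\substack{-k\le j\le r\\ j\ne 0}}\{jz\}\ge y_w\Big\},$$ $$M_{k,r}^-=\max\left\{\frac{\lambda t}{2},\ \frac{(k+r)t}{2}\right\},\qquad M_{k,r}^+=\min\left\{1,\ \frac{(k+r+2)t}{2}\right\},\qquad h=\left\lfloor\frac2t\right\rfloor .$$ Here $\{jz\}$ denotes the fractional part of $jz$, and $j$ ranges over integers. Then the limiting gap distribution $G_t(\lambda)=\lim_{J\to\infty}G_{t,J}(\lambda)$ (defined in the context) exists and $$G_t(\lambda)=\frac12\sum_{\substack{0\le k,r\le h\\ M_{k,r}^-\le M_{k,r}^+}}\left(\int_{M_{k,r}^-}^{M_{k,r}^+}\int_0^1 w\,\mu\big(A_{k,r,w}(x)\big)\,dx\,dw\right),$$ where $\mu$ is the Lebesgue measure.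
   Context: Fix $t>0$. For a positive integer $J$ (large enough that $tJ^2>J$) let $P_{t,J}=(-tJ^2,0)$ and $O=(0,0)$, and let $\mathcal R_J=\mathbb Z^2\cap([-J,J]\times[0,J])$, a set of $N=N_J=(2J+1)(J+1)$ lattice points. For $P\in\mathcal R_J$ consider the angle $\angle(P P_{t,J} O)$ at the vertex $P_{t,J}$ between the rays from $P_{t,J}$ to $P$ and to $O$. List these $N$ angles, with multiplicity, in nondecreasing order: $0=\alpha_1\le\alpha_2\le\dots\le\alpha_N=\alpha_{\max}$. Put $\Delta_{av}=\alpha_{\max}/N_J$ and, for $\lambda>0$, $$G_{t,J}(\lambda)=\frac{1}{N_J}\#\{j:\ 1\le j\le N-1,\ \alpha_{j+1}-\alpha_j\ge\lambda\Delta_{av}\}.$$ The limiting gap distribution function is $G_t(\lambda)=\lim_{J\to\infty}G_{t,J}(\lambda)$. Convention: when $k=r=0$ the minimum defining $A_{k,r,w}(x)$ is over the empty set and is taken to be $+\infty$, so that $A_{0,0,w}(x)=[R_{0,0,w}+x,S_{0,0,w}+x]$. *)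

(* Defs.v *)
From HB Require Import structures.
From mathcomp Require Import all_boot all_order all_algebra.
From mathcomp Require Import all_classical all_reals all_analysis.

Set Implicit Arguments.
Unset Strict Implicit.
Unset Printing Implicit Defensive.

Import Order.TTheory GRing.Theory Num.Theory.
Import numFieldNormedType.Exports.

Local Open Scope classical_set_scope.
Local Open Scope ring_scope.

Section PlaneGeometry.
Variable R : realType.
Implicit Types P V Q : R * R.

Definition dotp P Q : R := P.1 * Q.1 + P.2 * Q.2.

Definition enorm P : R := Num.sqrt (dotp P P).

(* The angle PVQ, with vertex V, in [0, pi].  When P or Q equals V the quotient
   is 0 by the convention 0^-1 = 0, and the angle is the junk value pi / 2. *)
Definition angle P V Q : R :=
  acos (dotp (P - V) (Q - V) / (enorm (P - V) * enorm (Q - V))).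

End PlaneGeometry.

Section GapDistribution.
Variable R : realType.
Implicit Types (t lambda : R) (J : nat).

Definition origin : R * R := (0, 0).

Definition viewpoint t J : R * R := (- (t * J%:R ^+ 2), 0).

(* The points of Z^2 in [-J, J] x [0, J]; the abscissa is i - J, 0 <= i <= 2J. *)
Definition lattice_rect J : seq (R * R) :=
  [seq (i%:R - J%:R, b%:R) | i <- iota 0 (2 * J).+1, b <- iota 0 J.+1].

Definition npoints J : nat := ((2 * J + 1) * (J + 1))%N.

Definition sorted_angles t J : seq R :=
  sort <=%R [seq angle P (viewpoint t J) origin | P <- lattice_rect J].

(* The angles alpha_1 <= ... <= alpha_N are indexed from 1. *)
Definition alpha t J (j : nat) : R := nth 0 (sorted_angles t J) j.-1.

Definition alpha_max t J : R := alpha t J (npoints J).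

Definition average_gap t J : R := alpha_max t J / (npoints J)%:R.

Definition gap_distribution t lambda J : R :=
  (count (fun j => lambda * average_gap t J <= alpha t J j.+1 - alpha t J j)
         (iota 1 (npoints J).-1))%:R / (npoints J)%:R.

(* G_t(lambda); meaningful only when the sequence converges. *)
Definition limit_gap_distribution t lambda : R :=
  limn (gap_distribution t lambda).

End GapDistribution.

Section LimitFormula.
Variable R : realType.
Implicit Types (t lambda w x z : R) (k r : nat).

Definition frac x : R := x - (Num.floor x)%:~R.

Definition Rkr t k r w : R :=
  Num.max (k%:R * t / w ^+ 2 - 1 / w) (1 / w - r.+1%:R * t / w ^+ 2).

Definition Skr t k r w : R :=
  Num.min (k.+1%:R * t / w ^+ 2 - 1 / w) (1 / w - r%:R * t / w ^+ 2).

Definition yw t lambda w : R := lambda * t / (2 * w).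

(* The minimum of {j z} over the nonzero integers j = i - k in [-k, r], taken
   in the extended reals so that it is +oo when k = r = 0. *)
Definition min_frac k r z : \bar R :=
  \big[Order.min/+oo%E]_(i < (k + r).+1 | i%:Z - k%:Z != 0)
    (frac ((i%:Z - k%:Z)%:~R * z))%:E.

Definition Akr t lambda k r w x : set R :=
  [set z | z \in `[Rkr t k r w + x, Skr t k r w + x] /\
           ((yw t lambda w)%:E <= min_frac k r z)%E].

Definition Mminus t lambda k r : R :=
  Num.max (lambda * t / 2) ((k + r)%:R * t / 2).

Definition Mplus t k r : R := Num.min 1 ((k + r + 2)%:R * t / 2).

Definition hmax t : nat := Num.truncn (2 / t).

End LimitFormula.

(* Main.v *)
Require Import Defs.
From mathcomp Require Import all_boot all_order all_algebra.
From mathcomp Require Import all_classical all_reals all_analysis.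
From mathcomp Require Import ring lra zify.
Set Implicit Arguments.
Unset Strict Implicit.
Unset Printing Implicit Defensive.
Import Order.TTheory GRing.Theory Num.Theory.
Import numFieldNormedType.Exports.
Local Open Scope classical_set_scope.
Local Open Scope ring_scope.

(** The idea is to read each gap off the row of lattice points in which it begins.

    Put D = t J^2.  The point (a, b) is seen at the angle atan (b / (D + a)).  Another point
    (a', b') is compared with it through the offset
      d = a + (b' - b) z - a',   z = (D + a) / b = x + a / b,   x = D / b,
    the horizontal distance of (a', b') from the ray through (a, b).  The difference of the slopes
    is d times a factor close to b / D^2.  Hence the angle of (a', b') exceeds that of (a, b) by an
    amount between 0 and lambda times the average gap when 0 <= d < y, where y = lambda t J / (2 b),
    up to a relative error O(1/J) in y (angle_window).

    Let w = b / J.  If y > 1, that is w < lambda t / 2, the left neighbour (a - 1, b) is always too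
    close for a gap.  Otherwise only the rows b + j with j <> 0 matter.  There 0 <= d < 1 forces
    d = frac (j z), and a point with this offset exists when a + j z lies in [- J, J].  Up to a
    bounded error in a, this holds for the integers j of an interval [- k, r], and k and r are
    characterized by R_{k,r,w} <= a / b <= S_{k,r,w}.  So a gap begins at (a, b) when z belongs to
    A_{k,r,w}(x) for some k and r, necessarily at most h.  The comparisons involved are ambiguous for
    boundedly many a only, and all other points are robust (gap_in_model, in_model_isolated,
    count_nonrobust).  For a robust point, membership in A_{k,r,w}(x) is constant on the interval
    from z to z + 1 / b.  Therefore the row contains b mu(A_{k,r,w}(x)) such points up to O(1), and
    the number of gaps is the sum of these numbers over the rows b >= lambda t J / 2 and over k and r,
    up to O(J) (num_gaps_model).

    It remains to average Phi(w, x) = w mu(A_{k,r,w}(x)) over the pairs (b / J, t J^2 / b).  This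
    function is Lipschitz, and has period 1 in x.  Over consecutive rows, t J^2 / b moves almost like
    a rotation of the circle, with the step t J^2 / b^2.  By Dirichlet's theorem the step is very
    close to a reduced fraction p / q with q <= Q.  During q rows the rotation visits all classes
    modulo 1/q, so Phi is averaged over x up to O(1/q).  Rows for which q is small are rare, because
    the steps decrease in b and are well separated.  Cutting the rows greedily into such blocks gives
    the equidistribution theorem: the averages converge to the integral of Phi over w between
    lambda t / 2 and 1 and over x between 0 and 1.  As J^2 / N tends to 1/2, the limit exists.

    Finally R_{k,r,w} >= S_{k,r,w} unless (k + r) t / 2 < w < (k + r + 2) t / 2, which turns the range
    of w into the interval from M^- to M^+, and makes the pairs with M^- > M^+ contribute 0. *)

Local Notation frac := Defs.frac.

(** * Gaps of a finite list of reals *)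

(** An isolated entry of a list begins a gap of length at least d, and an entry that begins such a
    gap has no other value strictly above it within d.  Unlike the gaps, both properties can be
    read off the unsorted list; they differ only for repeated values. *)
Definition isolated {R : realType} (d : R) (s : seq R) (v : R) : bool :=
  (count (fun v' => (v <= v' < v + d)%R) s <= 1)%N.

Definition gap_above {R : realType} (d : R) (s : seq R) (v : R) : bool :=
  ~~ has (fun v' => v < v' < v + d) s.

Lemma count_nth {T : Type} (x0 : T) (P : pred T) (s : seq T) :
  count P s = count (fun j => P (nth x0 s j)) (iota 0 (size s)).
Proof. by rewrite -{1}(mkseq_nth x0 s) /mkseq count_map. Qed.

Lemma count_sub_in {T : eqType} (P Q : pred T) (s : seq T) :
  {in s, forall x, P x -> Q x} -> (count P s <= count Q s)%N.
Proof.
elim: s => [//|x s IH] h /=.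
apply: leq_add.
  by case Px: (P x) => //; rewrite h // inE eqxx.
by apply: IH => y ys; apply: h; rewrite inE ys orbT.
Qed.

Lemma sorted_nth_le {R : realType} (s : seq R) i j :
  sorted <=%R s -> (i <= j)%N -> (j < size s)%N -> nth 0 s i <= nth 0 s j.
Proof.
move=> ss ij js; apply: (sorted_leq_nth le_trans le_refl 0 ss) => //.
by rewrite inE (leq_ltn_trans ij).
Qed.

(** The largest entry may be isolated although no gap follows it, whence the successor. *)
Lemma count_isolated_le {R : realType} (d : R) (s : seq R) : 0 < d -> sorted <=%R s ->
  (count (isolated d s) s <=
   (count (fun j => (d <= nth 0%R s j.+1 - nth 0%R s j)%R) (iota 0 (size s).-1)).+1)%N.
Proof.
move=> d0 ss; rewrite (count_nth 0 (isolated d s)).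
case Es: (size s) => [//|n]; rewrite succnK.
rewrite -{1}(addn1 n) iotaD count_cat -[X in (_ <= X)%N]addn1.
apply: leq_add; last by rewrite /= addn0; case: isolated.
apply: count_sub_in => j; rewrite mem_iota add0n => /= jn iso.
rewrite leNgt; apply/negP => lt_d.
move: iso; rewrite /isolated leqNgt => /negP; apply.
rewrite (count_nth 0) -size_filter.
apply: (@uniq_leq_size _ [:: j; j.+1]); first by rewrite /= inE; lia.
have le1 : nth 0 s j <= nth 0 s j.+1 by apply: sorted_nth_le => //; rewrite Es.
move=> i; rewrite !inE mem_filter mem_iota Es => /orP[] /eqP ->.
- by apply/andP; split; [lra | lia].
- by apply/andP; split; [lra | lia].
Qed.

Lemma count_gap_above_ge {R : realType} (d : R) (s : seq R) : sorted <=%R s ->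
  (count (fun j => (d <= nth 0%R s j.+1 - nth 0%R s j)%R) (iota 0 (size s).-1)
   <= count (gap_above d s) s)%N.
Proof.
move=> ss; rewrite (count_nth 0 (gap_above d s)).
case Es: (size s) => [//|n]; rewrite succnK.
rewrite -(addn1 n) iotaD count_cat.
apply: (leq_trans _ (leq_addr _ _)).
apply: count_sub_in => j; rewrite mem_iota add0n => /= jn gap.
apply/hasPn => v /(nthP 0)[i]; rewrite Es => ilt <-.
apply/negP => /andP[h1 h2].
have [ij|ji] := leqP i j.
  have := @sorted_nth_le _ s i j ss ij; rewrite Es => /(_ ltac:(lia)); lra.
have := @sorted_nth_le _ s j.+1 i ss ji; rewrite Es => /(_ ltac:(lia)); lra.
Qed.

(** * Angles seen from the viewpoint *)

Lemma angle_atan {R : realType} (D a b : R) : 0 < D -> 0 < D + a -> 0 <= b ->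
  angle (a, b) (- D, 0) (0, 0) = atan (b / (D + a)).
Proof.
move=> D0 Da0 b0; rewrite /angle /dotp /enorm /dotp /=.
rewrite !(sub0r, oppr0, opprK, subr0, mulr0, addr0, add0r).
have -> : Num.sqrt (D * D) = D by rewrite -expr2 sqrtr_sqr gtr0_norm.
rewrite (addrC a D); set e := D + a in Da0 *.
have -> : e * D / (Num.sqrt (e * e + b * b) * D) = cos (atan (b / e)).
  rewrite cos_atan.
  have -> : e * e + b * b = e ^+ 2 * (1 + (b / e) ^+ 2) by field; lra.
  rewrite sqrtrM ?sqr_ge0// sqrtr_sqr gtr0_norm//.
  field; rewrite sqrtr_eq0 -ltNge !gt_eqF// andbT.
  have := sqr_ge0 (b / e); lra.
apply: cosK; rewrite in_itv /=.
have := atan_ltpi2 (b / e).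
have : atan 0 <= atan (b / e) by apply: le_atan; rewrite divr_ge0// ltW.
rewrite atan0 => h1 h2; have := pi_gt0 R; lra.
Qed.

(** By the mean value theorem, as the derivative of atan is between 1 / (1 + m^2) and 1 on [0, m]. *)
Lemma atan_sub_bounds {R : realType} (s s' m : R) : 0 <= s -> s <= s' -> s' <= m ->
  (s' - s) / (1 + m ^+ 2) <= atan s' - atan s <= s' - s.
Proof.
move=> s0; rewrite le_eqVlt => /orP[/eqP <-|ss'] sm; first by rewrite !subrr mul0r lexx.
have [c] : exists2 c, c \in `]s, s'[ & atan s' - atan s = (1 + c ^+ 2)^-1 * (s' - s).
  apply: MVT => //.
  by apply: continuous_subspaceT => x; apply: continuous_atan.
rewrite in_itv /= => /andP[sc cs'] ->.
have c1 : 1 <= 1 + c ^+ 2 by have := sqr_ge0 c; lra.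
have cm : 1 + c ^+ 2 <= 1 + m ^+ 2 by rewrite lerD2l ler_pXn2r ?nnegrE//; lra.
apply/andP; split.
  rewrite mulrC ler_pM2r; last lra.
  by rewrite lef_pV2// posrE; lra.
rewrite -[leRHS]mul1r ler_pM2r; last lra.
by rewrite invf_le1; lra.
Qed.

(** How far (a', b') is to the left of the line through the viewpoint (- D, 0) and (a, b), measured
    along the row of height b'. *)
Definition offset {R : realType} (D a b a' b' : R) : R := a + (b' - b) * ((D + a) / b) - a'.

(** The factor of the offset hardly varies over the rectangle: it is b / D^2 up to a relative error
    O(1/J).  So the offset measures differences of angles in a unit that depends on the row only. *)
Lemma slope_sub {R : realType} (D a b a' b' : R) : 0 < b -> 0 < D + a -> 0 < D + a' ->
  b' / (D + a') - b / (D + a) =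
  offset D a b a' b' * (b / ((D + a) * (D + a'))).
Proof. by move=> b0 A0 A'0; rewrite /offset; field; rewrite !gt_eqF. Qed.

Lemma angle_lt_offset {R : realType} (D a b a' b' : R) :
  0 < b -> 0 < D + a -> 0 < D + a' ->
  (atan (b / (D + a)) < atan (b' / (D + a'))) = (0 < offset D a b a' b').
Proof.
move=> b0 A0 A'0; set s := b / _; set s' := b' / _.
have c0 : 0 < b / ((D + a) * (D + a')) by rewrite divr_gt0// mulr_gt0.
have E : (s < s') = (0 < offset D a b a' b').
  by rewrite -subr_gt0 slope_sub// pmulr_lgt0.
rewrite -E; apply/idP/idP; last by apply: lt_atan.
by apply: contraTT; rewrite -!leNgt; apply: le_atan.
Qed.

Lemma angle_le_offset {R : realType} (D a b a' b' : R) :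
  0 < b -> 0 < D + a -> 0 < D + a' ->
  (atan (b / (D + a)) <= atan (b' / (D + a'))) = (0 <= offset D a b a' b').
Proof.
move=> b0 A0 A'0; set s := b / _; set s' := b' / _.
have c0 : 0 < b / ((D + a) * (D + a')) by rewrite divr_gt0// mulr_gt0.
have E : (s <= s') = (0 <= offset D a b a' b').
  by rewrite -subr_ge0 slope_sub// pmulr_lge0.
rewrite -E; apply/idP/idP; last by apply: le_atan.
by apply: contraTT; rewrite -!ltNge; apply: lt_atan.
Qed.

Lemma window_upper_num {R : realType} (v : R) : 0 < v -> v <= 1 / 2 ->
  (1 + 2 * v) * (1 + v) ^+ 2 <= (1 - v) * (1 + 18 * v).
Proof. move=> v0 v1; nra. Qed.

Lemma window_lower_num {R : realType} (v g : R) : 0 < v -> v <= 1 / 2 -> 0 < g ->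
  (1 - (18 * v + 2 * g)) * ((1 + 2 * v) * (1 + 2 * g)) <= 1 - v.
Proof.
move=> v0 v1 g0.
have P1 : 1 <= (1 + 2 * v) * (1 + 2 * g) by nra.
set P := (_ * _) in P1 *.
have [e0|e0] := lerP (1 - (18 * v + 2 * g)) 0; first by nra.
have h : (1 - 2 * v) * (1 - 2 * g) * P <= 1.
  have -> : (1 - 2 * v) * (1 - 2 * g) * P = (1 - 4 * v ^+ 2) * (1 - 4 * g ^+ 2).
    by rewrite /P; ring.
  have v2 : 0 <= 4 * v ^+ 2 <= 1 by apply/andP; split; nra.
  have g2 : 0 <= 4 * g ^+ 2 by nra.
  by move: v2 g2; set p := 4 * _; set q := 4 * _ => /andP[? ?] ?; nra.
have : 1 - (18 * v + 2 * g) <= (1 - 2 * v) * (1 - 2 * g) - 16 * v by nra.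
move=> h2; apply: (le_trans (ler_wpM2r _ h2)); first lra.
rewrite mulrBl; have : 16 * v * 1 <= 16 * v * P by rewrite ler_pM2l//; lra.
lra.
Qed.

(** In this lemma and the next, v is 1 / (t J), m the largest slope J / (D - J), N the number of
    lattice points and AA the product (D + a) (D + a'). *)
Lemma angle_window_upper_num {R : realType} (v J N m AA e : R) :
  0 < v -> v <= 1 / 2 -> 18 * v <= e -> 0 < J -> 2 * J ^+ 2 <= N ->
  m = v / (1 - v) -> m ^+ 2 <= 2 * v -> AA <= (J * (v^-1 + 1)) ^+ 2 ->
  (1 + m ^+ 2) * m * AA / N <= v^-1 * (1 + e) / 2.
Proof.
move=> v0 v1 ev J0 hN mv m2v hAA.
have v10 : 0 < 1 - v by lra.
have m0 : 0 < m by rewrite mv divr_gt0.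
have m1 : 0 < 1 + m ^+ 2 by have := sqr_ge0 m; lra.
have J2 : 0 < J ^+ 2 by apply: exprn_gt0.
have N0 : 0 < N by apply: lt_le_trans hN; rewrite mulr_gt0.
rewrite ler_pdivrMr//.
apply: (@le_trans _ _ (v^-1 * (1 + e) / 2 * (2 * J ^+ 2))); last first.
  by rewrite ler_pM2l// divr_gt0// mulr_gt0 ?invr_gt0//; lra.
apply: (@le_trans _ _ ((1 + m ^+ 2) * m * (J * (v^-1 + 1)) ^+ 2)).
  by rewrite ler_pM2l// mulr_gt0.
have -> : (1 + m ^+ 2) * m * (J * (v^-1 + 1)) ^+ 2 =
    J ^+ 2 / (1 - v) / v * ((1 + m ^+ 2) * (1 + v) ^+ 2).
  by rewrite mv; field; rewrite !gt_eqF.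
have -> : v^-1 * (1 + e) / 2 * (2 * J ^+ 2) = J ^+ 2 / (1 - v) / v * ((1 - v) * (1 + e)).
  by field; rewrite !gt_eqF.
rewrite ler_pM2l; last by rewrite !divr_gt0.
apply: (@le_trans _ _ ((1 + 2 * v) * (1 + v) ^+ 2)).
  by apply: ler_wpM2r; [apply: sqr_ge0|lra].
apply: (le_trans (window_upper_num v0 v1)).
by rewrite ler_pM2l//; lra.
Qed.

Lemma angle_window_lower_num {R : realType} (v J N m AA e : R) :
  0 < v -> v <= 1 / 2 -> 0 < J -> 18 * v + 2 / J <= e -> 0 < N -> N <= 2 * J ^+ 2 * (1 + 2 / J) ->
  m = v / (1 - v) -> m ^+ 2 <= 2 * v -> (J * (v^-1 - 1)) ^+ 2 <= AA ->
  v^-1 * (1 - e) / 2 <= m / (1 + m ^+ 2) / N * AA.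
Proof.
move=> v0 v1 J0 ev N0 hN mv m2v hAA.
have v10 : 0 < 1 - v by lra.
have m0 : 0 < m by rewrite mv divr_gt0.
have m1 : 0 < 1 + m ^+ 2 by have := sqr_ge0 m; lra.
have J2 : 0 < J ^+ 2 by apply: exprn_gt0.
have [e1|e1] := lerP 1 e.
  apply: (@le_trans _ _ 0).
    by rewrite pmulr_lle0// pmulr_rle0 ?invr_gt0//; lra.
  by apply: mulr_ge0; [rewrite !divr_ge0// ltW|apply: le_trans hAA; apply: sqr_ge0].
have -> : m / (1 + m ^+ 2) / N * AA = m * AA / ((1 + m ^+ 2) * N).
  by field; rewrite !gt_eqF.
rewrite ler_pdivlMr; last exact: mulr_gt0.
apply: (@le_trans _ _ (m * (J * (v^-1 - 1)) ^+ 2)); last by rewrite ler_pM2l.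
set g := J^-1; rewrite -/g in ev hN.
have g0 : 0 < g by rewrite invr_gt0.
have hP2 : (1 + m ^+ 2) * N <= 2 * J ^+ 2 * ((1 + 2 * v) * (1 + 2 * g)).
  have -> : 2 * J ^+ 2 * ((1 + 2 * v) * (1 + 2 * g)) =
    (1 + 2 * v) * (2 * J ^+ 2 * (1 + 2 * g)) by ring.
  by apply: ler_pM => //; lra.
apply: (@le_trans _ _ (v^-1 * (1 - e) / 2 * (2 * J ^+ 2 * ((1 + 2 * v) * (1 + 2 * g))))).
  by rewrite ler_pM2l// divr_gt0// mulr_gt0 ?invr_gt0//; lra.
have -> : v^-1 * (1 - e) / 2 * (2 * J ^+ 2 * ((1 + 2 * v) * (1 + 2 * g))) =
  J ^+ 2 / v * ((1 - e) * ((1 + 2 * v) * (1 + 2 * g))) by field; rewrite gt_eqF.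
have -> : m * (J * (v^-1 - 1)) ^+ 2 = J ^+ 2 / v * (1 - v).
  by rewrite mv; field; rewrite !gt_eqF.
rewrite ler_pM2l ?divr_gt0//; apply: le_trans (window_lower_num v0 v1 g0).
by apply: ler_wpM2r; [rewrite mulr_ge0; lra|lra].
Qed.

(** The largest angle is about 1 / (t J) and there are about 2 J^2 points, so that delta is about
    lambda / (2 t J^3); multiplied by D^2 / b, which converts slopes into offsets, this is y.
    Replacing atan by its argument, D + a by D and N by 2 J^2 costs a relative error O(1/J). *)
Lemma angle_window {R : realType} (t lambda J a b a' b' e : R) :
  0 < lambda -> 1 <= J -> 2 <= t * J ->
  - J <= a <= J -> 0 < b <= J -> - J <= a' <= J -> 0 <= b' <= J ->
  18 / (t * J) + 2 / J <= e ->
  let D := t * J ^+ 2 in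
  let delta := lambda * (atan (J / (D - J)) / ((2 * J + 1) * (J + 1))) in
  let y := lambda * t * J / (2 * b) in
  let th := atan (b / (D + a)) in let th' := atan (b' / (D + a')) in
  0 <= offset D a b a' b' ->
  (th' < th + delta -> offset D a b a' b' < y * (1 + e)) /\
  (th + delta <= th' -> y * (1 - e) <= offset D a b a' b').
Proof.
move=> l0 J1 T2 /andP[aJ1 aJ2] /andP[b0 bJ] /andP[a'J1 a'J2] /andP[b'0 b'J] he D delta y th th' d0.
set d := offset D a b a' b' in d0 *.
set N := (2 * J + 1) * (J + 1) in delta *.
set m := J / (D - J) in delta *.
have J0 : 0 < J by lra.
have T0 : 0 < t * J by lra.
have DE : D = t * J * J by rewrite /D; ring.
have DJ : J <= D - J.
  by rewrite DE; have : 2 * J <= t * J * J by [rewrite ler_pM2r]; lra.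
have DJ0 : 0 < D - J by lra.
pose v := (t * J)^-1.
have v0 : 0 < v by rewrite invr_gt0.
have TE : t * J = v^-1 by rewrite invrK.
have v1 : v <= 1 / 2 by rewrite /v -[_^-1]mul1r ler_pdivrMr//; lra.
have v10 : 0 < 1 - v by lra.
have mv : m = v / (1 - v).
  have -> : m = (t * J - 1)^-1.
    by rewrite /m DE; field; apply/andP; split; rewrite gt_eqF//; lra.
  by rewrite TE; field; rewrite !gt_eqF// subr_gt0 invf_gt1//; lra.
have m0 : 0 < m by rewrite mv divr_gt0.
have m2v : m ^+ 2 <= 2 * v.
  have h1 : m <= 1 by rewrite mv ler_pdivrMr//; lra.
  have h2 : m <= 2 * v.
    rewrite mv ler_pdivrMr//.
    by have : v * v <= v * (1 / 2) by [rewrite ler_pM2l]; lra.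
  by rewrite expr2; apply: le_trans h2; rewrite -[leRHS]mulr1 ler_pM2l.
have m1 : 0 < 1 + m ^+ 2 by have := sqr_ge0 m; lra.
have A0 : 0 < D + a by lra.
have A'0 : 0 < D + a' by lra.
have N0 : 0 < N by rewrite mulr_gt0//; lra.
have JJ : 0 < J * J by rewrite mulr_gt0.
have J12 : J <= J * J by rewrite -[leLHS]mulr1 ler_pM2l.
have atm : m / (1 + m ^+ 2) <= atan m <= m.
  by have := @atan_sub_bounds _ 0 m m; rewrite atan0 !subr0; apply=> //; rewrite ?lexx ?ltW.
have s0 : 0 <= b / (D + a) by rewrite divr_ge0// ltW.
have ss' : b / (D + a) <= b' / (D + a').
  by rewrite -subr_ge0 slope_sub// mulr_ge0// divr_ge0// ?ltW// mulr_gt0.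
have s'm : b' / (D + a') <= m.
  apply: ler_pM => //; first by rewrite invr_ge0 ltW.
  by rewrite lef_pV2// ?posrE; lra.
have := atan_sub_bounds s0 ss' s'm.
rewrite slope_sub// -/d -/th -/th'; set AA := (D + a) * _.
have AA0 : 0 < AA by apply: mulr_gt0.
move: atm; set am := atan m in delta *; move=> /andP[am1 am2] /andP[h1 h2].
split => hd.
- have h3 : d * (b / AA) < (1 + m ^+ 2) * (lambda * (m / N)).
    rewrite [ltRHS]mulrC -ltr_pdivrMr//; apply: (le_lt_trans h1).
    have : th' - th < delta by lra.
    move/lt_le_trans; apply; rewrite /delta ler_pM2l// ler_pM2r ?invr_gt0//.
  have {}h3 : d < (1 + m ^+ 2) * (lambda * (m / N)) * AA / b.
    by rewrite ltr_pdivlMr// -ltr_pdivrMr// -mulrA.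
  apply: (lt_le_trans h3).
  rewrite ler_pdivrMr// /y.
  have -> : lambda * t * J / (2 * b) * (1 + e) * b = lambda * (t * J * (1 + e) / 2).
    by field; rewrite gt_eqF.
  have -> : (1 + m ^+ 2) * (lambda * (m / N)) * AA = lambda * ((1 + m ^+ 2) * m * AA / N) by ring.
  rewrite ler_pM2l// TE; apply: (@angle_window_upper_num _ v J) => //.
  + by apply: le_trans he; rewrite -/v lerDl divr_ge0// ltW.
  + by rewrite /N expr2; lra.
  + by rewrite -TE expr2 /AA; apply: ler_pM; rewrite ?DE; rewrite ?DE in A0 A'0 *; lra.
- have h3 : lambda * (m / (1 + m ^+ 2) / N) <= d * (b / AA).
    apply: le_trans h2; apply: (@le_trans _ _ delta); last by lra.
    by rewrite /delta ler_pM2l// ler_pM2r ?invr_gt0.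
  have {}h3 : lambda * (m / (1 + m ^+ 2) / N) * AA / b <= d.
    by rewrite ler_pdivrMr// -ler_pdivlMr// -[leRHS]mulrA.
  apply: le_trans h3.
  rewrite ler_pdivlMr// /y.
  have -> : lambda * t * J / (2 * b) * (1 - e) * b = lambda * (t * J * (1 - e) / 2).
    by field; rewrite gt_eqF.
  rewrite -[leRHS]mulrA ler_pM2l// TE; apply: (@angle_window_lower_num _ v J) => //.
  + have -> : 2 * J ^+ 2 * (1 + 2 / J) = 2 * (J * J) + 4 * J by field; rewrite gt_eqF.
    by rewrite /N; lra.
  + by rewrite -TE expr2 /AA; apply: ler_pM; rewrite ?mulr_ge0 ?DE; rewrite ?DE in A0 A'0 *; lra.
Qed.

(** * Counting integers at which an affine function is small *)

Lemma count_union_bound {T : Type} {I : Type} (P : pred T) (Q : I -> pred T) (ls : seq I) (s : seq T) :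
  (forall x, P x -> has (fun l => Q l x) ls) ->
  (count P s <= \sum_(l <- ls) count (Q l) s)%N.
Proof.
move=> h; elim: s => [|x s IH] /=; first by rewrite big1.
rewrite big_split /=; apply: leq_add IH.
case Px: (P x) => //; have {Px} := h _ Px.
elim: ls {h} => [//|l ls IH] /=; rewrite big_cons.
by case/orP => [->|/IH h]; [rewrite leq_addr|apply: leq_trans h (leq_addl _ _)].
Qed.

Lemma count_diam (P : pred nat) (m n L : nat) :
  (forall i j, (i <= j)%N -> P i -> P j -> (j - i <= L)%N) ->
  (count P (iota m n) <= L.+1)%N.
Proof.
move=> h; rewrite -size_filter.
case: (pickP [pred i : 'I_(m + n) | P i]) => [i0 /= Pi0|noP]; last first.
  suff -> : [seq i <- iota m n | P i] = [::] by [].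
  apply/eqP; rewrite -[_ == _]negbK -has_filter; apply/hasPn => i; rewrite mem_iota => /andP[_ lti].
  by have := noP (Ordinal lti) => /= ->.
case: (@arg_minnP _ i0 (fun i : 'I_(m + n) => P i) (fun i => nat_of_ord i) Pi0) => k Pk kmin.
rewrite -(size_iota k L.+1); apply: uniq_leq_size; first by rewrite filter_uniq// iota_uniq.
move=> i; rewrite mem_filter !mem_iota => /andP[Pi /andP[_ lti]].
have ki : (k <= i)%N by apply: (kmin (Ordinal lti)).
by rewrite ki /=; have := h _ _ ki Pk Pi; lia.
Qed.

Lemma count_affine_window {R : realType} (P : pred nat) (m n : nat) (al be rho : R) :
  0 < al -> 0 <= rho -> (forall i, P i -> `|al * i%:R + be| <= rho) ->
  (count P (iota m n))%:R <= 2 * rho / al + 1.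
Proof.
move=> al0 rho0 h.
have b0 : 0 <= 2 * rho / al by rewrite divr_ge0 ?mulr_ge0// ltW.
apply: (@le_trans _ _ ((Num.truncn (2 * rho / al)).+1)%:R).
  rewrite ler_nat; apply: count_diam => i j ij Pi Pj.
  rewrite truncn_ge_nat// natrB// ler_pdivlMr//.
  by have := h _ Pi; have := h _ Pj; rewrite !ler_norml => /andP[_ ?] /andP[? _]; lra.
by rewrite -addn1 natrD lerD2r truncn_le.
Qed.

(** The values sweep an interval of length |al| n, so they come close to O(|al| n) integers, and
    to each of them for O(rho / |al|) indices. *)
Lemma count_affine_mod {R : realType} (P : pred nat) (n : nat) (al be rho : R) :
  al != 0 -> 0 <= rho ->
  (forall i, (i < n)%N -> P i -> exists k : int, `|al * i%:R + be - k%:~R| <= rho) ->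
  (count P (iota 0 n))%:R <= (`|al| * n%:R + 2 * rho + 2) * (2 * rho / `|al| + 1).
Proof.
wlog al0 : al be / 0 < al => [H|].
  move=> aln0 rho0 h; have := aln0; rewrite neq_lt => /orP[al0|al0]; last first.
    by apply: (H al be).
  rewrite -normrN; apply: (H (- al) (- be)) => //; rewrite ?oppr_gt0 ?oppr_eq0// => i ni Pi.
  have [k hk] := h i ni Pi; exists (- k).
  rewrite mulrNz -normrN; have -> : - (- al * i%:R - be - - k%:~R) = al * i%:R + be - k%:~R by ring.
  by [].
move=> _ rho0 h; rewrite (gtr0_norm al0).
set M := Num.truncn (al * n%:R + 2 * rho + 1).
have X0 : 0 <= al * n%:R by rewrite mulr_ge0// ltW.
pose m0 := Num.floor (be - rho).
pose Q (l : nat) := fun i => `|al * i%:R + be - (m0 + l%:Z)%:~R| <= rho.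
pose P' := fun i => P i && (i < n)%N.
have -> : count P (iota 0 n) = count P' (iota 0 n).
  by apply: eq_in_count => i; rewrite mem_iota /P' => /andP[_ ->]; rewrite andbT.
have hQ i : P' i -> has (fun l => Q l i) (iota 0 M.+1).
  move=> /andP[Pi ni]; have [k hk] := h i ni Pi.
  move: (hk); rewrite ler_norml => /andP[k1 k2].
  have ai : 0 <= al * i%:R by rewrite mulr_ge0// ltW.
  have ain : al * i%:R <= al * n%:R by rewrite ler_pM2l// ler_nat ltnW.
  have m0k : m0 <= k.
    have : be - rho - 1 < m0%:~R :> R by have := floorD1_gt (be - rho); rewrite intrD; lra.
    have m0le : m0%:~R <= be - rho :> R by apply: floor_le.
    by rewrite -(ler_int R); lra.
  have kE : k = m0 + `|k - m0|%N%:Z by lia.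
  apply/hasP; exists `|k - m0|%N; last by rewrite /Q -kE.
  rewrite mem_iota add0n ltnS /M truncn_ge_nat; last lra.
  rewrite -[_%:R]/((`|k - m0|%N%:Z)%:~R) (_ : `|k - m0|%N%:Z = k - m0); last lia.
  have : be - rho - 1 < m0%:~R :> R by have := floorD1_gt (be - rho); rewrite intrD; lra.
  by rewrite /= intrB; lra.
have := count_union_bound (iota 0 n) hQ; rewrite -(ler_nat R) => /le_trans; apply.
rewrite natr_sum.
apply: (@le_trans _ _ (\sum_(l <- iota 0 M.+1) (2 * rho / al + 1))).
  apply: ler_sum => l _; apply: (@count_affine_window _ _ _ _ _ (be - (m0 + l%:Z)%:~R)) => //.
  by move=> i; rewrite /Q addrA.
rewrite big_const_seq count_predT size_iota iter_addr_0 -[_ *+ _]mulr_natl.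
apply: ler_wpM2r; first by rewrite addr_ge0// divr_ge0 ?mulr_ge0// ltW.
rewrite -addn1 natrD; have : M%:R <= al * n%:R + 2 * rho + 1 by rewrite truncn_le; lra.
lra.
Qed.

(** * Lengths of sets defined by fractional parts *)

(** Both sides are measures of A, and they agree on half-open intervals. *)
Lemma lebesgue_measure_shift {R : realType} (c : R) (A : set R) : measurable A ->
  lebesgue_measure [set z | A (z - c)] = lebesgue_measure A.
Proof.
move=> mA; have mf : measurable_fun setT (fun z : R => z - c).
  by apply: measurable_realfun.measurable_funB.
pose f : R -> measurableTypeR R := fun z => z - c.
rewrite -[LHS]/(pushforward (@lebesgue_measure R) f A).
apply/esym; apply: lebesgue_measure_unique => // X /ocitvP[->|[[p q]/= pq ->]].
  by rewrite !measure0.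
rewrite /pushforward.
have -> : f @^-1` `]p, q] = `]p + c, q + c]%classic.
  by apply/seteqP; split => z /=; rewrite /f !in_itv /= ltrBrDr lerBlDr.
rewrite !lebesgue_measure_itv /= !lte_fin ltrD2r; case: ifP => // _.
by rewrite -!EFinB; congr (_%:E); ring.
Qed.

(** The measure as a real number, which loses nothing for bounded measurable sets. *)
Definition len {R : realType} (A : set R) : R := fine (lebesgue_measure A).

Lemma len_fin {R : realType} (p q : R) (A : set R) : measurable A -> A `<=` `[p, q] ->
  lebesgue_measure A = (len A)%:E.
Proof.
move=> mA Apq; rewrite /len fineK// ge0_fin_numE//.
apply: (@le_lt_trans _ _ (lebesgue_measure (`[p, q]%classic : set R))).
  by apply: le_measure => //; rewrite inE.
by rewrite lebesgue_measure_itv /=; case: ifP => _; rewrite ltry.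
Qed.

Lemma len_ge0 {R : realType} (A : set R) : 0 <= len A.
Proof. exact: fine_ge0. Qed.

Lemma len_le {R : realType} (p q : R) (A B : set R) : measurable A -> measurable B ->
  B `<=` `[p, q] -> A `<=` B -> len A <= len B.
Proof.
move=> mA mB Bpq AB.
rewrite -lee_fin -(len_fin mA (subset_trans AB Bpq)) -(len_fin mB Bpq).
by apply: le_measure => //; rewrite inE.
Qed.

Lemma len_subU {R : realType} (p q : R) (A B C : set R) :
  measurable A -> measurable B -> measurable C ->
  B `<=` `[p, q] -> C `<=` `[p, q] -> A `<=` B `|` C -> len A <= len B + len C.
Proof.
move=> mA mB mC Bpq Cpq ABC.
have BCpq : B `|` C `<=` `[p, q] by rewrite subUset.
have mBC := measurableU _ _ mB mC.
apply: (le_trans (len_le mA mBC BCpq ABC)).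
rewrite -lee_fin EFinD -(len_fin mBC BCpq) -(len_fin mB Bpq) -(len_fin mC Cpq).
exact: measureU2.
Qed.

Lemma len_itvcc {R : realType} (p q : R) : len `[p, q] <= `|q - p|.
Proof.
rewrite /len lebesgue_measure_itv /=; case: ifP => _ //=.
exact: ler_norm.
Qed.

Lemma len_cover {R : realType} (p q e : R) (I : eqType) (ls : seq I) (B : I -> set R) (A : set R) :
  (forall l, measurable (B l)) -> (forall l, B l `<=` `[p, q]) ->
  {in ls, forall l, len (B l) <= e} -> measurable A ->
  A `<=` [set z | has (fun l => z \in B l) ls] -> len A <= (size ls)%:R * e.
Proof.
move=> mB Bpq; elim: ls A => [|l ls IH] A Be mA h.
  suff -> : A = set0 by rewrite mul0r /len measure0.
  by rewrite -subset0 => z /h.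
have mC := measurableD mA (mB l).
apply: (@le_trans _ _ (len (B l) + len (A `\` B l))).
  have AC : A `<=` `[p, q].
    move=> z /h /= /orP[|]; first by rewrite inE; apply: Bpq.
    by case/hasP => // l' _; rewrite inE; apply: Bpq.
  apply: (@len_subU _ p q) => //; first by move=> z [/AC].
  by move=> z Az; have [Bz|Bz] := pselect (B l z); [left|right].
rewrite /= -addn1 addnC natrD mulrDl mul1r; apply: lerD; first by apply: Be; rewrite inE eqxx.
apply: IH => //; first by move=> l' hl'; apply: Be; rewrite inE hl' orbT.
by move=> z [/h /= /orP[]//]; rewrite inE.
Qed.

Lemma frac_int {R : realType} (m : int) (v : R) : m%:~R <= v < m%:~R + 1 -> frac v = v - m%:~R.
Proof.
move=> h; rewrite /frac; congr (_ - _%:~R); apply/eqP; rewrite floor_eq.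
by rewrite intrD.
Qed.

Lemma frac_bounds {R : realType} (v : R) : 0 <= frac v < 1.
Proof.
rewrite /frac; have := floorD1_gt v; rewrite intrD => h1.
have h2 : (Num.floor v)%:~R <= v by apply: floor_le.
by lra.
Qed.

Lemma frac_addz {R : realType} (m : int) (v : R) : frac (v + m%:~R) = frac v.
Proof.
rewrite (@frac_int _ (Num.floor v + m)); first by rewrite /frac intrD; ring.
have := frac_bounds v; rewrite /frac intrD; lra.
Qed.

Definition jrange (k r : nat) : seq int :=
  [seq j <- [seq i%:Z - k%:Z | i <- iota 0 (k + r).+1] | j != 0].

Lemma mem_jrange (k r : nat) (j : int) :
  (j \in jrange k r) = [&& j != 0, - k%:Z <= j & j <= r%:Z].
Proof.
rewrite mem_filter; congr andb; apply/mapP/andP => [[i]|[h1 h2]].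
  by rewrite mem_iota => h ->; split; lia.
by exists (absz (j + k%:Z)); [rewrite mem_iota|]; lia.
Qed.

Definition frac_above {R : realType} (k r : nat) (y z : R) : bool :=
  all (fun j : int => y <= frac (j%:~R * z)) (jrange k r).

(** The set A_{k,r,w}(x) with its end points p, q and its threshold y made independent of w and x,
    so that its measure can be compared at different parameters. *)
Definition good_set {R : realType} (k r : nat) (p q y : R) : set R :=
  [set z | (p <= z <= q) && frac_above k r y z].

Definition good_len {R : realType} (k r : nat) (p q y : R) : R := len (good_set k r p q y).

Lemma min_frac_ge {R : realType} (k r : nat) (y z : R) :
  (y%:E <= min_frac k r z)%E = frac_above k r y z.
Proof.
apply/bigmin_geP/allP => [[_ h] j|h].
  rewrite mem_jrange => /and3P[j0 kj jr].
  have lt : (absz (j + k%:Z)%R < (k + r).+1)%N by lia.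
  have E : (Ordinal lt)%:Z - k%:Z = j by rewrite /=; lia.
  by have := h (Ordinal lt); rewrite E lee_fin; apply.
split; first by rewrite leey.
move=> i i0; rewrite lee_fin; apply: h.
by rewrite mem_jrange i0 /=; have := ltn_ord i; lia.
Qed.

Lemma Akr_good_set {R : realType} (t lambda : R) (k r : nat) (w x : R) :
  Akr t lambda k r w x = good_set k r (Rkr t k r w + x) (Skr t k r w + x) (yw t lambda w).
Proof.
apply/seteqP; split => z; rewrite /Akr /good_set /= min_frac_ge in_itv /=.
  by case=> -> ->.
by case/andP.
Qed.

Lemma measurable_frac_ge {R : realType} (y c : R) : measurable [set z : R | y <= frac (c * z)].
Proof.
have mf : measurable_fun setT (fun z : R => c * z).
  by apply: measurable_realfun.measurable_funM.
have mS : measurable [set v : R | y <= frac v].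
  have -> : [set v : R | y <= frac v] =
      \bigcup_(m in [set: int]) (`[m%:~R, m%:~R + 1[ `&` `[m%:~R + y, +oo[).
    apply/seteqP; split => v /=.
      move=> h; exists (Num.floor v) => //=; rewrite !in_itv /= andbT.
      have := frac_bounds v; move: h; rewrite /frac; set m := _%:~R.
      by move=> h hb; split; [lra|lra].
    case=> m _ /=; rewrite !in_itv /= andbT => -[h1 h2].
    by rewrite (frac_int h1); lra.
  apply: countable_bigcupT_measurable; first exact: countableP.
  by move=> m; apply: measurableI; apply: measurable_itv.
by have := mf measurableT _ mS; rewrite setTI.
Qed.

Lemma measurable_good_set {R : realType} (k r : nat) (p q y : R) : measurable (good_set k r p q y).
Proof.
have -> : good_set k r p q y = `[p, q]%classic `&` [set z | frac_above k r y z].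
  apply/seteqP; split => z; rewrite /good_set /= in_itv /=; first by case/andP.
  by case=> -> ->.
apply: measurableI; first exact: measurable_itv.
rewrite /frac_above; elim: (jrange k r) => [|j js IH] /=.
  by rewrite (_ : [set _ | _] = setT) //; apply/seteqP; split.
have -> : [set z : R | (y <= frac (j%:~R * z)) && all (fun j0 : int => y <= frac (j0%:~R * z)) js] =
  [set z | y <= frac (j%:~R * z)] `&` [set z | all (fun j0 : int => y <= frac (j0%:~R * z)) js].
  by apply/seteqP; split => z /=; [case/andP|case=> -> ->].
by apply: measurableI => //; apply: measurable_frac_ge.
Qed.

Lemma good_set_sub {R : realType} (k r : nat) (p q y : R) : good_set k r p q y `<=` `[p, q].
Proof. by move=> z; rewrite /good_set /= in_itv /= => /andP[]. Qed.

Lemma frac_above_shift {R : realType} (k r : nat) (y z : R) (m : int) :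
  frac_above k r y (z + m%:~R) = frac_above k r y z.
Proof. by apply: eq_all => j; rewrite mulrDr -intrM frac_addz. Qed.

Lemma good_len_shift {R : realType} (k r : nat) (p q y : R) (m : int) :
  good_len k r (p + m%:~R) (q + m%:~R) y = good_len k r p q y.
Proof.
rewrite /good_len /len -(@lebesgue_measure_shift _ m%:~R (good_set k r p q y)); last exact: measurable_good_set.
have E z : frac_above k r y (z - m%:~R) = frac_above k r y z.
  by rewrite -[in RHS](subrK m%:~R z) frac_above_shift.
congr (fine (lebesgue_measure _)); apply/seteqP.
by split => z; rewrite /good_set /= E lerBrDr lerBlDr.
Qed.

Lemma addz_absz_sub (m0 m : int) : m0 <= m -> m0 + (absz (m - m0))%:Z = m.
Proof. by lia. Qed.

Lemma absz_sub_intr {R : realType} (m0 m : int) : m0 <= m ->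
  (absz (m - m0))%:Z%:~R = m%:~R - m0%:~R :> R.
Proof. by move=> h; rewrite -intrB; congr (_%:~R); lia. Qed.

(** The band consists of one interval of length |y' - y| / |j| for each integer part that j z can
    take, and there are at most |j| |q - p| + 2 of these. *)
Lemma len_frac_band {R : realType} (j : int) (p q y y' : R) : j != 0 ->
  len [set z | (p <= z <= q) && (y <= frac (j%:~R * z) < y')] <=
  (`|j|%:~R * `|q - p| + 2) * `|y' - y|.
Proof.
move=> j0; set c : R := j%:~R.
have cj : `|c| = `|j|%:~R by rewrite /c intr_norm.
have c0 : c != 0 by rewrite intr_eq0.
have c1 : 1 <= `|c| by rewrite cj -[1]/(1%:~R) ler_int; lia.
set a := Num.min (c * p) (c * q).
have ab : forall z, p <= z <= q -> a <= c * z <= a + `|c| * `|q - p|.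
  move=> z hz; have -> : `|q - p| = q - p by rewrite ger0_norm; lra.
  rewrite /a minEle; have [c_ge0|c_le0] := lerP 0 c.
    by rewrite ger0_norm//; case: ifP => h; nra.
  by rewrite ltr0_norm//; case: ifP => h; nra.
pose m0 := Num.floor a.
set M := Num.truncn (`|c| * `|q - p| + 1).
pose u1 (l : nat) := ((m0 + l%:Z)%:~R + y) / c.
pose u2 (l : nat) := ((m0 + l%:Z)%:~R + y') / c.
pose B (l : nat) := `[p, q]%classic `&` `[Num.min (u1 l) (u2 l), Num.max (u1 l) (u2 l)]%classic.
have X0 : 0 <= `|c| * `|q - p| by rewrite mulr_ge0.
apply: (@le_trans _ _ ((size (iota 0 M.+1))%:R * `|y' - y|)); last first.
  apply: ler_wpM2r => //; rewrite size_iota -addn1 natrD.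
  have : M%:R <= `|c| * `|q - p| + 1 by rewrite truncn_le; lra.
  by rewrite cj; lra.
have mB l : measurable (B l) by apply: measurableI; apply: measurable_itv.
apply: (@len_cover _ p q _ _ _ B) => //.
- by move=> l; apply: subIsetl.
- move=> l _; apply: (@le_trans _ _ (len `[Num.min (u1 l) (u2 l), Num.max (u1 l) (u2 l)])).
    apply: (@len_le _ (Num.min (u1 l) (u2 l)) (Num.max (u1 l) (u2 l))) => //.
    exact: subIsetr.
  apply: (le_trans (len_itvcc _ _)).
  have -> : `|Num.max (u1 l) (u2 l) - Num.min (u1 l) (u2 l)| = `|u2 l - u1 l|.
    by rewrite maxEle minEle; case: ifP => // _; rewrite distrC.
  rewrite /u1 /u2 -mulrBl normrM normfV.
  have -> : (m0 + l)%:~R + y' - ((m0 + l)%:~R + y) = y' - y by ring.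
  by rewrite ler_pdivrMr ?normr_gt0// ler_peMr.
- have -> : [set z | (p <= z <= q) && (y <= frac (c * z) < y')] =
      `[p, q]%classic `&` ([set z | y <= frac (c * z)] `\` [set z | y' <= frac (c * z)]).
    apply/seteqP; split => z /=; rewrite in_itv /=.
      by move=> /andP[-> /andP[-> h]]; split => //; split => //; apply/negP; rewrite -ltNge.
    by case=> -> [-> /negP]; rewrite -ltNge => ->.
  apply: measurableI; first exact: measurable_itv.
  by apply: measurableD; apply: measurable_frac_ge.
- move=> z /andP[hz /andP[h1 h2]]; change (has (fun l => z \in B l) (iota 0 M.+1)).
  suff [l lM hl] : exists2 l, l \in iota 0 M.+1 & z \in B l by apply/(@hasP nat); exists l.
  set m := Num.floor (c * z).
  have /andP[az bz] := ab z hz.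
  have mlt : c * z < m%:~R + 1 by have := floorD1_gt (c * z); rewrite intrD.
  have mle : m%:~R <= c * z by apply: floor_le.
  have m0lt : a < m0%:~R + 1 by have := floorD1_gt a; rewrite intrD.
  have m0le : m0%:~R <= a by apply: floor_le.
  have m0m : m0 <= m.
    by rewrite -ltzD1 -(ltr_int R) intrD; lra.
  have kE := addz_absz_sub m0m.
  exists (absz (m - m0)).
    rewrite mem_iota /= add0n ltnS /M truncn_ge_nat; last lra.
    rewrite -[_%:R]/(((absz (m - m0))%:Z)%:~R).
    by rewrite absz_sub_intr//; lra.
  rewrite inE; split; rewrite /= in_itv //=.
  rewrite /u1 /u2 kE ge_min le_max.
  move: h1 h2; rewrite /frac -/m => h1 h2.
  have [c_ge0|c_le0] := lerP 0 c.
    have cp : 0 < c by rewrite lt0r c0.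
    apply/andP; split; apply/orP; [left|right].
      by rewrite ler_pdivrMr//; lra.
    by rewrite ler_pdivlMr//; lra.
  apply/andP; split; apply/orP; [right|left].
    by rewrite ler_ndivrMr//; lra.
  by rewrite ler_ndivlMr//; lra.
Qed.

(** A point of the first set that is missing from the second lies between p and p', or between q
    and q', or satisfies y <= frac (j z) < y' for some j. *)
Lemma good_len_le {R : realType} (k r : nat) (p q y p' q' y' d : R) : `|q - p| <= d ->
  good_len k r p q y <= good_len k r p' q' y' + `|p - p'| + `|q - q'| +
    (k + r).+1%:R * (((k + r)%:R * d + 2) * `|y - y'|).
Proof.
move=> qpd.
pose lo := Num.min p (Num.min p' (Num.min q q')).
pose hi := Num.max p (Num.max p' (Num.max q q')).
have sub (u v : R) : lo <= u -> v <= hi -> `[u, v]%classic `<=` `[lo, hi].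
  move=> lu vh z /=; rewrite !in_itv /= => /andP[uz zv].
  by rewrite (le_trans lu uz) (le_trans zv vh).
have [lp lp' lq lq'] : [/\ lo <= p, lo <= p', lo <= q & lo <= q'].
  by split; rewrite /lo !ge_min lexx ?orbT.
have [ph p'h qh q'h] : [/\ p <= hi, p' <= hi, q <= hi & q' <= hi].
  by split; rewrite /hi !le_max lexx ?orbT.
pose band (j : int) := [set z | (p <= z <= q) && (y <= frac (j%:~R * z) < y')].
pose bands := [set z | has (fun j => z \in band j) (jrange k r)].
have mband j : measurable (band j).
  have -> : band j =
      `[p, q]%classic `&` ([set z | y <= frac (j%:~R * z)] `\` [set z | y' <= frac (j%:~R * z)]).
    apply/seteqP; split => z /=; rewrite /band /= in_itv /=.
      by move=> /andP[-> /andP[-> h]]; split => //; split => //; apply/negP; rewrite -ltNge.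
    by case=> -> [-> /negP]; rewrite -ltNge => ->.
  apply: measurableI; first exact: measurable_itv.
  by apply: measurableD; apply: measurable_frac_ge.
have band_sub j : band j `<=` `[lo, hi].
  by apply: subset_trans (sub p q _ _) => // z; rewrite /band /= in_itv /= => /andP[].
have mbands : measurable bands.
  rewrite /bands; elim: (jrange k r) => [|j js IH] /=.
    by rewrite (_ : [set _ | _] = set0) //; apply/seteqP; split.
  have -> : [set z : R | (z \in band j) || has (fun j0 : int => z \in band j0) js] =
    band j `|` [set z | has (fun j0 : int => z \in band j0) js].
    apply/seteqP; split => z /=; first by case/orP; [rewrite inE; left|right].
    by case=> [h|->]; [rewrite mem_set|rewrite orbT].
  by apply: measurableU.
have bands_sub : bands `<=` `[lo, hi].
  move=> z /= /(@hasP int)[j _]; rewrite inE; exact: band_sub.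
have lenbands : len bands <= (k + r).+1%:R * (((k + r)%:R * d + 2) * `|y - y'|).
  have d0 : 0 <= d by apply: le_trans qpd.
  have e0 : 0 <= ((k + r)%:R * d + 2) * `|y - y'|.
    by rewrite mulr_ge0// addr_ge0// mulr_ge0.
  apply: (@le_trans _ _ ((size (jrange k r))%:R * (((k + r)%:R * d + 2) * `|y - y'|))).
    apply: (@len_cover _ lo hi _ _ _ band) => // j.
    rewrite mem_jrange => /and3P[j0 kj jr].
    apply: (le_trans (len_frac_band _ _ _ _ j0)); rewrite (distrC y y').
    apply: ler_wpM2r => //; rewrite lerD2r.
    have hj : `|j|%:~R <= (k + r)%:R :> R.
      by rewrite -[(k + r)%:R]/(((k + r)%N%:Z)%:~R) ler_int; lia.
    by apply: ler_pM => //; rewrite ler0z.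
  apply: ler_wpM2r => //; rewrite ler_nat.
  by rewrite size_filter (leq_trans (count_size _ _))// size_map size_iota.
have mg := @measurable_good_set R k r.
have gs := @good_set_sub R k r.
have mi (u v : R) : measurable (`[u, v]%classic : set R) by apply: measurable_itv.
pose A1 := good_set k r p' q' y' `|` `[p, p']; pose A2 := A1 `|` `[q', q].
have mA1 : measurable A1 by apply: measurableU.
have mA2 : measurable A2 by apply: measurableU.
have g'sub : good_set k r p' q' y' `<=` `[lo, hi] by apply: subset_trans (gs _ _ _) (sub _ _ _ _).
have A1sub : A1 `<=` `[lo, hi] by rewrite subUset; split => //; apply: sub.
have A2sub : A2 `<=` `[lo, hi] by rewrite subUset; split => //; apply: sub.
apply: (@le_trans _ _ (len A2 + len bands)).
  apply: (@len_subU _ lo hi) => //.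
  move=> z /andP[hz hf].
  have [ge_y'|/allPn[j jr]] := boolP (frac_above k r y' z); last first.
    rewrite -ltNge => hlt; right; apply/(@hasP int); exists j => //.
    by rewrite inE /band /= hz hlt (allP hf) .
  left; have [zp'|p'z] := ltP z p'; first by left; right; rewrite /= in_itv /=; lra.
  have [q'z|zq'] := ltP q' z; first by right; rewrite /= in_itv /=; lra.
  by left; left; rewrite /good_set /= p'z zq'.
apply: lerD => //.
apply: (@le_trans _ _ (len A1 + `|q - q'|)).
  apply: (@le_trans _ _ (len A1 + len `[q', q])); last by rewrite lerD2l len_itvcc.
  by apply: (@len_subU _ lo hi) => //; apply: sub.
rewrite lerD2r.
apply: (@le_trans _ _ (good_len k r p' q' y' + len `[p, p'])); last by rewrite lerD2l distrC len_itvcc.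
by apply: (@len_subU _ lo hi) => //; apply: sub.
Qed.

Lemma good_len_lipschitz {R : realType} (k r : nat) (p q y p' q' y' d : R) :
  `|q - p| <= d -> `|q' - p'| <= d ->
  `|good_len k r p q y - good_len k r p' q' y'| <= `|p - p'| + `|q - q'| +
    (k + r).+1%:R * (((k + r)%:R * d + 2) * `|y - y'|).
Proof.
move=> h h'; have h1 := good_len_le k r y p' q' y' h.
have h2 := good_len_le k r y' p q y h'.
rewrite ler_norml; move: h2; rewrite (distrC p') (distrC q') (distrC y') => h2.
by apply/andP; split; lra.
Qed.

(** Additivity over a subdivision into closed cells, which overlap in null sets only. *)
Lemma len_cells {R : realType} (p s : R) (n : nat) (A : set R) : 0 <= s -> measurable A ->
  A `<=` `[p, p + n%:R * s] ->
  len A = \sum_(i <- iota 0 n) len (A `&` `[p + i%:R * s, p + i.+1%:R * s]).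
Proof.
move=> s0; elim: n A => [|n IH] A mA Asub.
  rewrite big_nil; apply/eqP; rewrite eq_le len_ge0 andbT.
  move: Asub; rewrite mul0r addr0 => Asub.
  have mi : measurable (`[p, p]%classic : set R) by apply: measurable_itv.
  apply: (le_trans (len_le mA mi (@subset_refl _ _) Asub)).
  by apply: (le_trans (len_itvcc _ _)); rewrite subrr normr0.
have mi (u v : R) : measurable (`[u, v]%classic : set R) by apply: measurable_itv.
pose m := p + n%:R * s.
pose B := A `&` `[p, m]%classic; pose C := A `&` `[m, p + n.+1%:R * s]%classic.
have mB : measurable B by apply: measurableI.
have mC : measurable C by apply: measurableI.
have pm : p <= m by rewrite lerDl mulr_ge0.
have mq : m <= p + n.+1%:R * s by rewrite lerD2l ler_wpM2r// ler_nat.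
have AE : A = B `|` C.
  apply/seteqP; split=> [z Az|z [[]|[]]//].
  have := Asub _ Az; rewrite /= in_itv /= => /andP[z1 z2].
  have [zm|mz] := leP z m; first by left; split=> //=; rewrite in_itv /= z1.
  by right; split=> //=; rewrite in_itv /= z2 ltW.
have Bsub : B `<=` `[p, m] by apply: subIsetr.
have Csub : C `<=` `[m, p + n.+1%:R * s] by apply: subIsetr.
have null : lebesgue_measure (B `&` C) = 0%E.
  apply/eqP; rewrite eq_le measure_ge0 andbT.
  rewrite -(lebesgue_measure_set1 m); apply: le_measure; rewrite ?inE//.
    exact: measurableI.
  move=> z [/Bsub + /Csub]; rewrite /= !in_itv /= => /andP[_ zm] /andP[mz _].
  by apply/eqP; rewrite eq_le zm mz.
have lenA : len A = len B + len C.
  apply/EFin_inj; rewrite EFinD -(len_fin mA Asub) -(len_fin mB Bsub) -(len_fin mC Csub).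
  have Cfin : (lebesgue_measure C < +oo)%E by rewrite (len_fin mC Csub) ltry.
  have U : lebesgue_measure (B `|` C) =
    (lebesgue_measure B + lebesgue_measure C - lebesgue_measure (B `&` C))%E by apply: measureUfinr.
  by rewrite {1}AE U null sube0.
rewrite lenA -[in RHS](addn1 n) iotaD big_cat /= big_cons big_nil addr0 add0n; congr (_ + _).
rewrite (IH B mB Bsub) big_seq [RHS]big_seq; apply: eq_bigr => i; rewrite mem_iota => /= ilt.
congr len; rewrite /B -setIA; congr (_ `&` _); apply: setIidr => z.
rewrite /= !in_itv /= => /andP[z1 z2]; apply/andP; split.
  by apply: le_trans z1; rewrite lerDl mulr_ge0.
by apply: (le_trans z2); rewrite lerD2l ler_wpM2r// ler_nat.
Qed.

(** * Equidistribution of the sequence t J^2 / b modulo 1 *)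

Notation Rint u v f := (Rintegral (@lebesgue_measure _) `[u, v] f).

Lemma lip_continuous {R : realType} (K : R) (f : R -> R) :
  (forall x y, `|f x - f y| <= K * `|x - y|) -> continuous f.
Proof.
move=> fK x; apply/cvgrPdist_le => e e0.
have K1 : 0 < `|K| + 1 by rewrite ltr_wpDl.
near=> y.
apply: (le_trans (fK _ _)); apply: (@le_trans _ _ ((`|K| + 1) * `|x - y|)).
  by apply: ler_wpM2r => //; have := ler_norm K; lra.
rewrite mulrC -ler_pdivlMr//; near: y.
apply: cvgr_dist_le; [exact: cvg_id|exact: divr_gt0].
Unshelve. all: by end_near. Qed.

Lemma continuous_integrable_itv {R : realType} (f : R -> R) (u v : R) : continuous f ->
  (@lebesgue_measure R).-integrable `[u, v] (EFin \o f).
Proof.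
move=> cf; apply: continuous_compact_integrable; first exact: segment_compact.
exact: continuous_subspaceT.
Qed.

Lemma Rint_cat {R : realType} (f : R -> R) (u w v : R) : continuous f ->
  u <= w -> w <= v -> Rint u v f = Rint u w f + Rint w v f.
Proof.
move=> cf uw wv.
have := @Rintegral_itvB _ f (BLeft u) (BRight v) w (continuous_integrable_itv u v cf).
rewrite !bnd_simp => /(_ uw wv) h.
rewrite -(@Rintegral_itv_obnd_cbnd _ w (BRight v)); last first.
  apply: integrableS (continuous_integrable_itv w v cf) => //.
  by apply: subset_itvr; rewrite bnd_simp.
by rewrite -h; ring.
Qed.

Lemma Rint_cst {R : realType} (c u v : R) : u <= v -> Rint u v (fun=> c) = c * (v - u).
Proof.
move=> uv; rewrite Rintegral_cst; last exact: measurable_itv.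
transitivity (c * fine (@lebesgue_measure R (`[u, v]%classic : set R))) => //.
rewrite lebesgue_measure_itv /= lte_fin; by case: ltgtP uv => //= -> _; lra.
Qed.

Lemma le_Rint {R : realType} (f g : R -> R) (u v : R) : continuous f -> continuous g ->
  (forall x, u <= x <= v -> f x <= g x) -> Rint u v f <= Rint u v g.
Proof.
move=> cf cg h; apply: le_Rintegral; first exact: measurable_itv.
- exact: continuous_integrable_itv.
- exact: continuous_integrable_itv.
- by move=> x /=; rewrite in_itv; apply: h.
Qed.

Lemma Rint_near_cst {R : realType} (f : R -> R) (c e u v : R) : continuous f -> u <= v ->
  (forall x, u <= x <= v -> `|f x - c| <= e) -> `|Rint u v f - c * (v - u)| <= e * (v - u).
Proof.
move=> cf uv h.
have cc (a : R) : continuous (fun _ : R => a) by move=> x; exact: cvg_cst.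
have h1 : Rint u v f <= Rint u v (fun=> c + e).
  by apply: le_Rint => // x /h; rewrite ler_norml; lra.
have h2 : Rint u v (fun=> c - e) <= Rint u v f.
  by apply: le_Rint => // x /h; rewrite ler_norml; lra.
by move: h1 h2; rewrite !Rint_cst// ler_norml => h1 h2; lra.
Qed.

Lemma Rint_dist {R : realType} (f g : R -> R) (e u v : R) : continuous f -> continuous g -> u <= v ->
  (forall x, u <= x <= v -> `|f x - g x| <= e) -> `|Rint u v f - Rint u v g| <= e * (v - u).
Proof.
move=> cf cg uv h.
rewrite -RintegralB; first last.
- exact: continuous_integrable_itv.
- exact: continuous_integrable_itv.
- exact: measurable_itv.
have cfg : continuous (fun x => f x - g x) by move=> x; apply: cvgB; [apply: cf|apply: cg].
have := @Rint_near_cst _ (fun x => f x - g x) 0 e u v cfg uv.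
by rewrite mul0r subr0; apply=> x hx; rewrite subr0; apply: h.
Qed.

(** On each step the function is within K h of its value at the left end. *)
Lemma riemann_sum {R : realType} (K : R) (f : R -> R) (u h : R) (n : nat) :
  (forall x y, `|f x - f y| <= K * `|x - y|) -> 0 <= h ->
  `|\sum_(i <- iota 0 n) h * f (u + i%:R * h) - Rint u (u + n%:R * h) f| <= n%:R * (K * h ^+ 2).
Proof.
move=> fK h0; have cf := lip_continuous fK.
have K0 : 0 <= K.
  by have := le_trans (normr_ge0 _) (fK 1 0); rewrite subr0 normr1 mulr1.
elim: n => [|n IH].
  rewrite big_nil !mul0r addr0 sub0r normrN set_itv1.
  by rewrite Rintegral_set1 normr0.
rewrite -{1}addn1 iotaD big_cat /= big_cons big_nil addr0 add0n.
have nh : u <= u + n%:R * h by rewrite lerDl mulr_ge0.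
have nh1 : u + n%:R * h <= u + n.+1%:R * h by rewrite lerD2l ler_wpM2r// ler_nat.
rewrite (Rint_cat cf nh nh1).
have := @Rint_near_cst _ f (f (u + n%:R * h)) (K * h) _ _ cf nh1.
have -> : u + n.+1%:R * h - (u + n%:R * h) = h by rewrite -addn1 natrD; ring.
move=> /(_ _) hc.
have {}hc : `|Rint (u + n%:R * h) (u + n.+1%:R * h) f - f (u + n%:R * h) * h| <= K * h * h.
  apply: hc => x /andP[x1 x2]; apply: (le_trans (fK _ _)).
  apply: ler_wpM2l => //; rewrite ger0_norm; last lra.
  by move: x2; rewrite -addn1 natrD; lra.
move: IH hc; rewrite -[n.+1]addn1 natrD.
set S := \sum_(_ <- _) _; set I1 := Rint u _ f; set I2 := Rint _ _ f; set y := f _.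
rewrite expr2 !ler_norml => /andP[? ?] /andP[? ?]; apply/andP; split; lra.
Qed.

Lemma residue_unique (a b q : nat) (c : int) :
  b%:Z - a%:Z = c * q%:Z -> (a < q)%N -> (b < q)%N -> a = b.
Proof.
move=> h aq bq; have [c0|[c1|c1]] : c = 0 \/ (1 <= c \/ c <= -1) by lia.
- by move: h; rewrite c0 mul0r; lia.
- by nia.
- by nia.
Qed.

(** As p is prime to q, the numerators m - i p run through all classes modulo q. *)
Lemma sum_residues {R : realType} (g : R -> R) (p q m : nat) : (0 < q)%N -> coprime p q ->
  (forall (c : int) x, g (x + c%:~R) = g x) ->
  \sum_(0 <= i < q) g ((m%:R - i%:R * p%:R) / q%:R) = \sum_(0 <= i < q) g (i%:R / q%:R).
Proof.
move=> q0 cpq gper; rewrite !big_mkord.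
have q0R : q%:R != 0 :> R by rewrite pnatr_eq0 -lt0n.
pose s (i : nat) := absz (((m%:Z - (i * p)%N%:Z) %% q%:Z)%Z).
have sE i : (s i)%:Z = ((m%:Z - (i * p)%N%:Z) %% q%:Z)%Z.
  by rewrite /s gez0_abs// modz_ge0// eqz_nat -lt0n.
have slt (i : 'I_q) : (s i < q)%N.
  by rewrite -ltz_nat sE ltz_pmod// ltz_nat.
pose sg (i : 'I_q) : 'I_q := Ordinal (slt i).
have sg_inj : injective sg.
  move=> i j /(congr1 val) /= sij; apply/val_inj => /=.
  have : ((m%:Z - (i * p)%N%:Z) = (m%:Z - (j * p)%N%:Z) %[mod q%:Z])%Z by rewrite -!sE sij.
  move/eqP; rewrite eqz_mod_dvd.
  have -> : m%:Z - (i * p)%N%:Z - (m%:Z - (j * p)%N%:Z) = (j%:Z - i%:Z) * p%:Z by lia.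
  rewrite Gauss_dvdzl; last by rewrite /coprimez gcdzC.
  move=> /dvdzP[c hc].
  exact: residue_unique hc (ltn_ord i) (ltn_ord j).
rewrite [RHS](reindex_inj sg_inj) /=; apply: eq_bigr => i _.
have E := divz_eq (m%:Z - (i * p)%N%:Z) q%:Z; rewrite -sE in E.
rewrite -(gper (((m%:Z - (i * p)%N%:Z) %/ q%:Z)%Z) ((s i)%:R / q%:R)); congr g.
have -> : m%:R - i%:R * p%:R = (m%:Z - (i * p)%N%:Z)%:~R :> R by rewrite intrB -!pmulrn natrM.
by rewrite {1}E intrD intrM -!pmulrn; field.
Qed.

(** A full period of the rotation by p/q visits every class mod 1/q once, so a Lipschitz function
    is averaged correctly up to O(1/q), whatever the starting point. *)
Lemma block_sum {R : realType} (K e x : R) (g : R -> R) (p q : nat) (pt : nat -> R) :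
  (forall x y, `|g x - g y| <= K * `|x - y|) ->
  (forall (c : int) x, g (x + c%:~R) = g x) -> (0 < q)%N -> coprime p q -> 0 <= x ->
  (forall i, (i < q)%N -> `|pt i - (x - i%:R * (p%:R / q%:R))| <= e) ->
  `|\sum_(0 <= i < q) g (pt i) - q%:R * Rint 0 1 g| <= q%:R * (K * e) + 2 * K.
Proof.
move=> gK gper q0 cpq x0 hpt.
have K0 : 0 <= K.
  by have := le_trans (normr_ge0 _) (gK 1 0); rewrite subr0 normr1 mulr1.
have qR : 0 < q%:R :> R by rewrite ltr0n.
pose m := Num.truncn (x * q%:R).
have xq0 : 0 <= x * q%:R by rewrite mulr_ge0// ltW.
have mx : m%:R <= x * q%:R < m%:R + 1.
  by apply/andP; split; [rewrite truncn_le|rewrite natr1; exact: truncnS_gt].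
have h1 : `|\sum_(0 <= i < q) g (pt i) - \sum_(0 <= i < q) g (i%:R / q%:R)| <= q%:R * (K * e) + K.
  rewrite -(sum_residues m q0 cpq gper) -sumrB.
  apply: (le_trans (ler_norm_sum _ _ _)).
  apply: (@le_trans _ _ (\sum_(0 <= i < q) (K * e + K / q%:R))).
    rewrite !big_mkord; apply: ler_sum => i _.
    apply: (le_trans (gK _ _)); rewrite -mulrDr; apply: ler_wpM2l => //.
    have -> : pt i - (m%:R - i%:R * p%:R) / q%:R =
      (pt i - (x - i%:R * (p%:R / q%:R))) + (x - m%:R / q%:R) by ring.
    apply: (le_trans (ler_normD _ _)); apply: lerD; first exact: hpt.
    rewrite ger0_norm; last by rewrite subr_ge0 ler_pdivrMr//; lra.
    have -> : x - m%:R / q%:R = (x * q%:R - m%:R) / q%:R by field; rewrite gt_eqF.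
    by rewrite ler_pdivrMr// mulVf ?gt_eqF//; lra.
  rewrite sumr_const_nat subn0 -[_ *+ _]mulr_natl mulrDr lerD2l.
  by rewrite mulrCA divff ?gt_eqF// mulr1.
have h2 : `|\sum_(0 <= i < q) g (i%:R / q%:R) - q%:R * Rint 0 1 g| <= K.
  have := @riemann_sum _ K g 0 (q%:R^-1) q gK.
  rewrite invr_ge0 ltW// => /(_ isT).
  rewrite mulfV ?gt_eqF// add0r -{1}(subn0 q) -/(index_iota 0 q) -mulr_sumr.
  have -> : \sum_(0 <= i < q) g (0 + i%:R / q%:R) = \sum_(0 <= i < q) g (i%:R / q%:R).
    by apply: eq_bigr => i _; rewrite add0r.
  set S := \sum_(_ <= _ < _) _; set I := Rint _ _ _ => h.
  have -> : S - q%:R * I = q%:R * (q%:R^-1 * S - I) by field; rewrite gt_eqF.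
  rewrite normrM (ger0_norm (ltW qR)).
  apply: (le_trans (ler_wpM2l (ltW qR) h)).
  rewrite le_eqVlt; apply/orP; left; apply/eqP.
  by field; rewrite gt_eqF.
have := ler_normD (\sum_(0 <= i < q) g (pt i) - \sum_(0 <= i < q) g (i%:R / q%:R))
  (\sum_(0 <= i < q) g (i%:R / q%:R) - q%:R * Rint 0 1 g).
by rewrite addrA subrK => /le_trans; apply; lra.
Qed.

(** Dirichlet's theorem: two of the Q + 1 numbers frac (i th) share one of the Q intervals of
    length 1/Q.  Reducing the resulting fraction does not spoil the bound. *)
Lemma dirichlet {R : realType} (th : R) (Q : nat) : 0 <= th -> (0 < Q)%N ->
  exists p q : nat, [/\ (0 < q <= Q)%N, coprime p q & `|th - p%:R / q%:R| <= (q%:R * Q%:R)^-1].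
Proof.
move=> th0 Q0; have QR : 0 < Q%:R :> R by rewrite ltr0n.
pose f (i : nat) := Num.truncn (Q%:R * frac (i%:R * th)).
have fx0 i : 0 <= Q%:R * frac (i%:R * th).
  by rewrite mulr_ge0//; case/andP: (frac_bounds (i%:R * th)).
have flt i : (f i < Q)%N.
  rewrite -(ltr_nat R); apply: (@le_lt_trans _ _ (Q%:R * frac (i%:R * th))).
    by rewrite truncn_le.
  by rewrite gtr_pMr//; case/andP: (frac_bounds (i%:R * th)).
pose F (i : 'I_Q.+1) : 'I_Q := Ordinal (flt i).
have /injectivePn[i0 [j0 ij0 Fij]] : ~~ injectiveb F.
  by apply/negP => /injectiveP /leq_card; rewrite !card_ord ltnn.
have [i [j [ij iQ fij]]] : exists i j : nat, [/\ (j < i)%N, (i <= Q)%N & f i = f j].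
  move: Fij => /(congr1 val) /= Fij.
  have [lt|gt|eq] := ltngtP i0 j0; last by case/eqP: ij0; apply/val_inj.
    by exists j0, i0; split => //; rewrite -ltnS.
  by exists i0, j0; split => //; rewrite -ltnS.
pose n := (i - j)%N.
have nE : n%:R = i%:R - j%:R :> R by rewrite natrB// ltnW.
pose Ai := Num.floor (i%:R * th); pose Aj := Num.floor (j%:R * th).
have Aij : Aj <= Ai by apply: le_floor; rewrite ler_wpM2r// ler_nat ltnW.
pose P := absz (Ai - Aj).
have PE : P%:R = Ai%:~R - Aj%:~R :> R by rewrite -absz_sub_intr.
have close : `|n%:R * th - P%:R| <= Q%:R^-1.
  have e1 : `|Q%:R * frac (i%:R * th) - Q%:R * frac (j%:R * th)| <= 1.
    have a1 : (f i)%:R <= Q%:R * frac (i%:R * th) by rewrite truncn_le.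
    have a2 : (f j)%:R <= Q%:R * frac (j%:R * th) by rewrite truncn_le.
    have b1 : Q%:R * frac (i%:R * th) < (f i)%:R + 1 by rewrite natr1 truncnS_gt.
    have b2 : Q%:R * frac (j%:R * th) < (f j)%:R + 1 by rewrite natr1 truncnS_gt.
    by rewrite fij in a1 b1; rewrite ler_norml; lra.
  have -> : n%:R * th - P%:R = Q%:R^-1 * (Q%:R * frac (i%:R * th) - Q%:R * frac (j%:R * th)).
    by rewrite /frac -/Ai -/Aj nE PE; field; rewrite gt_eqF.
  by rewrite normrM gtr0_norm ?invr_gt0// -[leRHS]mulr1 ler_pM2l ?invr_gt0.
have n0 : (0 < n)%N by rewrite subn_gt0.
have g0 : (0 < gcdn P n)%N by rewrite gcdn_gt0 n0 orbT.
exists (P %/ gcdn P n)%N, (n %/ gcdn P n)%N; split.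
- rewrite divn_gt0// dvdn_leq ?dvdn_gcdr//=.
  by rewrite (leq_trans (leq_div _ _))// (leq_trans (leq_subr _ _)).
- by rewrite /coprime -(eqn_pmul2r g0) mul1n muln_gcdl !divnK ?dvdn_gcdl ?dvdn_gcdr.
- set p := (P %/ _)%N; set q := (n %/ _)%N.
  have nq : n%:R = q%:R * (gcdn P n)%:R :> R by rewrite -natrM divnK// dvdn_gcdr.
  have Pp : P%:R = p%:R * (gcdn P n)%:R :> R by rewrite -natrM divnK// dvdn_gcdl.
  have q0 : 0 < q%:R :> R by rewrite ltr0n divn_gt0// dvdn_leq// dvdn_gcdr.
  have g1 : 1 <= (gcdn P n)%:R :> R by rewrite ler1n.
  have gR : 0 < (gcdn P n)%:R :> R by rewrite ltr0n.
  have -> : th - p%:R / q%:R = (q%:R * (gcdn P n)%:R)^-1 * (n%:R * th - P%:R).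
    by rewrite nq Pp; field; rewrite !gt_eqF.
  rewrite normrM gtr0_norm ?invr_gt0 ?mulr_gt0//.
  apply: (@le_trans _ _ ((q%:R * (gcdn P n)%:R)^-1 * Q%:R^-1)).
    by rewrite ler_pM2l// invr_gt0 mulr_gt0.
  rewrite [leRHS]invfM ler_pM2r ?invr_gt0// lef_pV2 ?posrE ?mulr_gt0//.
  by rewrite ler_peMr// ltW.
Qed.

Lemma sum_nat_dist {R : realType} (f g : nat -> R) (e : R) (m n : nat) :
  (forall i, (m <= i < n)%N -> `|f i - g i| <= e) ->
  `|\sum_(m <= i < n) f i - \sum_(m <= i < n) g i| <= (n - m)%:R * e.
Proof.
move=> h; rewrite -sumrB; apply: (le_trans (ler_norm_sum _ _ _)).
rewrite mulr_natl -sumr_const_nat big_nat [leRHS]big_nat.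
by apply: ler_sum => i hi; apply: h.
Qed.

(** Cut an interval of indices greedily into blocks on which E sums to little; only the indices
    where no block starts and the last, incomplete block are estimated trivially. *)
Lemma greedy_blocks {R : realType} (E : nat -> R) (bad : pred nat) (e K : R) (Q m n : nat) :
  0 <= e -> 0 <= K ->
  (forall i, (m <= i < n)%N -> `|E i| <= K) ->
  (forall i, (m <= i)%N -> (i + Q <= n)%N -> ~~ bad i ->
    exists2 q, (0 < q <= Q)%N & `|\sum_(i <= j < i + q) E j| <= q%:R * e) ->
  `|\sum_(m <= i < n) E i| <=
    (n - m)%:R * e + (count bad (iota m (n - m)))%:R * K + Q%:R * K.
Proof.
move=> e0 K0; have [l] := ubnP (n - m); elim: l m => // l IH m nml EK hE.
have triv : (n - m <= Q)%N -> `|\sum_(m <= i < n) E i| <=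
    (n - m)%:R * e + (count bad (iota m (n - m)))%:R * K + Q%:R * K.
  move=> small; have := @sum_nat_dist _ E (fun=> 0) K m n.
  rewrite big1_eq subr0 => h; apply: (le_trans (h _)).
    by move=> i hi; rewrite subr0; apply: EK.
  apply: (@le_trans _ _ (Q%:R * K)); first by rewrite ler_wpM2r// ler_nat.
  by rewrite lerDr addr_ge0// mulr_ge0.
have [//|big] := leqP (n - m) Q.
have mQn : (m + Q <= n)%N by lia.
have [badm|goodm] := boolP (bad m).
- have mn : (m < n)%N by lia.
  rewrite big_ltn//.
  have -> : (n - m)%N = (n - m.+1).+1 by lia.
  rewrite /= badm natrD [(_ + _) * K]mulrDl (_ : true%:R = 1 :> R)// mul1r.
  apply: (le_trans (ler_normD _ _)).
  have h1 : `|E m| <= K by apply: EK; rewrite leqnn.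
  have h2 : `|\sum_(m.+1 <= i < n) E i| <=
    (n - m.+1)%:R * e + (count bad (iota m.+1 (n - m.+1)))%:R * K + Q%:R * K.
    apply: IH; first by lia.
    - by move=> i hi; apply: EK; lia.
    - by move=> i hi; apply: hE; lia.
  by rewrite -natr1 mulrDl mul1r; lra.
- have [q /andP[q0 qQ] hq] := hE m (leqnn _) mQn goodm.
  rewrite (@big_cat_nat _ _ _ (m + q)); [|lia|lia].
  apply: (le_trans (ler_normD _ _)).
  have h2 : `|\sum_(m + q <= i < n) E i| <=
    (n - (m + q))%:R * e + (count bad (iota (m + q) (n - (m + q))))%:R * K + Q%:R * K.
    apply: IH; first by lia.
    - by move=> i hi; apply: EK; lia.
    - by move=> i hi; apply: hE; lia.
  have -> : (n - m)%N = (q + (n - (m + q)))%N by lia.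
  rewrite iotaD count_cat !natrD !mulrDl.
  have : 0 <= (count bad (iota m q))%:R * K by rewrite mulr_ge0.
  by lra.
Qed.

Lemma div_nat_small {R : realType} (a d : R) : 0 < d ->
  exists n0 : nat, (0 < n0)%N /\ forall n : nat, (n0 <= n)%N -> a / n%:R <= d.
Proof.
move=> d0; exists (Num.truncn (`|a| / d)).+1; split=> // n hn.
have n0 : 0 < n%:R :> R by rewrite ltr0n; lia.
rewrite ler_pdivrMr// mulrC -ler_pdivrMr//.
apply: (@le_trans _ _ (`|a| / d)); first by rewrite ler_pM2r ?invr_gt0// ler_norm.
apply: ltW; apply: (lt_le_trans (truncnS_gt _)); by rewrite ler_nat.
Qed.

Lemma periodic_near_mean {R : realType} (K x : R) (g : R -> R) :
  (forall x y, `|g x - g y| <= K * `|x - y|) ->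
  (forall (c : int) x, g (x + c%:~R) = g x) -> `|g x - Rint 0 1 g| <= K.
Proof.
move=> gK gper.
have K0 : 0 <= K.
  by have := le_trans (normr_ge0 _) (gK 1 0); rewrite subr0 normr1 mulr1.
have -> : g x = g (frac x) by rewrite -[RHS](gper (Num.floor x)) /frac subrK.
have := @Rint_near_cst _ g (g (frac x)) K 0 1 (lip_continuous gK) ler01.
rewrite !subr0 !mulr1 distrC; apply => y hy.
apply: (le_trans (gK _ _)); rewrite -[leRHS]mulr1 ler_wpM2l// ler_norml.
by have := frac_bounds x; lra.
Qed.

(** From the row b to the next, t J^2 / b decreases by about the step t J^2 / b^2.  The steps
    decrease with b, and those of adjacent rows differ by at least 2 c t / J. *)
Lemma count_step_near {R : realType} (t c a : R) (J Q n m : nat) :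
  0 < t -> 0 < c -> (0 < J)%N -> (0 < Q)%N ->
  (count (fun b => [&& c * J%:R <= b%:R, (b <= J)%N &
     `|t * J%:R ^+ 2 / b%:R ^+ 2 - a| <= Q%:R^-1]) (iota m n))%:R
  <= J%:R / (c * t * Q%:R) + 1.
Proof.
move=> t0 c0 J0 Q0.
have JR : 0 < J%:R :> R by rewrite ltr0n.
have QR : 0 < Q%:R :> R by rewrite ltr0n.
set X := J%:R / (c * t * Q%:R).
have X0 : 0 <= X by rewrite divr_ge0// !mulr_ge0// ltW.
apply: (@le_trans _ _ ((Num.truncn X).+1)%:R); last by rewrite -natr1 lerD2r truncn_le.
rewrite ler_nat; apply: count_diam => i j ij /and3P[ci iJ hi] /and3P[cj jJ hj].
rewrite truncn_ge_nat// natrB//.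
have iR : 0 < i%:R :> R by apply: lt_le_trans ci; apply: mulr_gt0.
have jR : 0 < j%:R :> R by apply: lt_le_trans cj; apply: mulr_gt0.
have ijR : i%:R <= j%:R :> R by rewrite ler_nat.
have iJR : i%:R <= J%:R :> R by rewrite ler_nat.
have jJR : j%:R <= J%:R :> R by rewrite ler_nat.
move: iR jR ijR iJR jJR ci cj hi hj; set x := i%:R; set y := j%:R; set w := J%:R in JR X X0 *.
move=> x0 y0 xy xw yw cx cy hi hj.
have h1 : t * w ^+ 2 / x ^+ 2 - t * w ^+ 2 / y ^+ 2 <= 2 / Q%:R.
  by move: hi hj; rewrite !ler_norml -[2 / _]/(2 * _^-1); lra.
have h2 : t * w ^+ 2 / x ^+ 2 - t * w ^+ 2 / y ^+ 2 = (y - x) * (t * w ^+ 2 * (y + x) / (x ^+ 2 * y ^+ 2)).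
  by field; rewrite !gt_eqF.
have h3 : 2 * c * t / w <= t * w ^+ 2 * (y + x) / (x ^+ 2 * y ^+ 2).
  rewrite ler_pdivrMr// -[leRHS]mulrAC ler_pdivlMr ?mulr_gt0 ?exprn_gt0//.
  have -> : 2 * c * t * (x ^+ 2 * y ^+ 2) = t * ((2 * c) * (x ^+ 2 * y ^+ 2)) by ring.
  have -> : t * w ^+ 2 * (y + x) * w = t * (w ^+ 2 * ((y + x) * w)) by ring.
  rewrite ler_pM2l//.
  apply: (@le_trans _ _ ((2 * c) * (w ^+ 2 * w ^+ 2))).
    rewrite ler_pM2l ?mulr_gt0//; apply: ler_pM; rewrite ?sqr_ge0//.
      by rewrite ler_pXn2r// nnegrE ltW.
    by rewrite ler_pXn2r// nnegrE ltW.
  have -> : (2 * c) * (w ^+ 2 * w ^+ 2) = w ^+ 2 * ((c * w + c * w) * w) by ring.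
  by rewrite ler_pM2l ?exprn_gt0// ler_pM2r//; lra.
have h4 : (y - x) * (2 * c * t / w) <= 2 / Q%:R.
  by apply: le_trans h1; rewrite h2; apply: ler_wpM2l => //; lra.
have -> : X = (2 / Q%:R) / (2 * c * t / w) by rewrite /X; field; rewrite !gt_eqF.
by rewrite ler_pdivlMr// divr_gt0// !mulr_gt0.
Qed.

(** A row is bad when its step is close to a fraction with denominator below q0: the points
    t J^2 / b of the following rows then stay close to fewer than q0 points of the circle. *)
Lemma count_bad_rows {R : realType} (t c : R) (J Q q0 P m n : nat) :
  0 < t -> 0 < c -> (0 < J)%N -> (0 < Q)%N ->
  (count (fun b => [&& c * J%:R <= b%:R, (b <= J)%N & has (fun pq : nat * nat =>
     `|t * J%:R ^+ 2 / b%:R ^+ 2 - pq.1%:R / pq.2%:R| <= Q%:R^-1)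
       [seq (p, q) | p <- iota 0 P, q <- iota 0 q0]]) (iota m n))%:R
  <= (P * q0)%:R * (J%:R / (c * t * Q%:R) + 1).
Proof.
move=> t0 c0 J0 Q0.
set ls := [seq _ | _ <- _, _ <- _].
set bad := fun b : nat => _.
pose near (pq : nat * nat) (b : nat) := [&& c * J%:R <= b%:R, (b <= J)%N &
     `|t * J%:R ^+ 2 / b%:R ^+ 2 - pq.1%:R / pq.2%:R| <= Q%:R^-1].
have h b : bad b -> has (fun pq => near pq b) ls.
  move=> /and3P[h1 h2 /hasP[pq hpq h3]]; apply/hasP; exists pq => //.
  by rewrite /near h1 h2.
have := count_union_bound (iota m n) h; rewrite -(ler_nat R) => /le_trans; apply.
rewrite natr_sum.
apply: (@le_trans _ _ (\sum_(pq <- ls) (J%:R / (c * t * Q%:R) + 1))).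
  by apply: ler_sum => pq _; apply: count_step_near.
rewrite le_eqVlt; apply/orP; left; apply/eqP.
by rewrite big_const_seq count_predT iter_addr_0 size_allpairs !size_iota [RHS]mulr_natl.
Qed.

(** The first order expansion at b of t w^2 / b, whose slope is then replaced by r; the remainder
    is of second order in i. *)
Lemma hyperbola_taylor {R : realType} (t c w b i Q th r : R) :
  0 < t -> 0 < c -> 0 < w -> c * w <= b -> 0 <= i -> i <= Q ->
  `|t * w ^+ 2 / b ^+ 2 - r| <= th ->
  `|t * w ^+ 2 / (b + i) - (t * w ^+ 2 / b - i * r)| <= i * th + t * Q ^+ 2 / c ^+ 3 / w.
Proof.
move=> t0 c0 w0 cb i0 iQ hr.
have b0 : 0 < b by apply: lt_le_trans cb; apply: mulr_gt0.
have bi : 0 < b + i by lra.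
have -> : t * w ^+ 2 / (b + i) - (t * w ^+ 2 / b - i * r) =
   - (i * (t * w ^+ 2 / b ^+ 2 - r)) + t * i ^+ 2 * (w ^+ 2 / (b ^+ 2 * (b + i))).
  by field; rewrite !gt_eqF.
apply: (le_trans (ler_normD _ _)); rewrite normrN normrM (ger0_norm i0).
apply: lerD; first by rewrite ler_wpM2l.
have X0 : 0 <= w ^+ 2 / (b ^+ 2 * (b + i)).
  by rewrite divr_ge0 ?sqr_ge0// mulr_ge0 ?sqr_ge0// ltW.
rewrite ger0_norm; last by apply: mulr_ge0 => //; rewrite mulr_ge0 ?sqr_ge0// ltW.
have -> : t * Q ^+ 2 / c ^+ 3 / w = t * Q ^+ 2 * (w ^+ 2 / ((c * w) ^+ 2 * (c * w))).
  by field; rewrite !gt_eqF.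
apply: ler_pM => //.
- by rewrite mulr_ge0 ?sqr_ge0// ltW.
- by rewrite ler_pM2l// ler_pXn2r// nnegrE; lra.
- rewrite ler_pM2l ?exprn_gt0//.
  have cw : 0 < c * w by apply: mulr_gt0.
  rewrite lef_pV2 ?posrE; last 2 first.
  + by rewrite mulr_gt0 ?exprn_gt0.
  + by rewrite mulr_gt0 ?exprn_gt0.
  apply: ler_pM; [by rewrite sqr_ge0|exact: ltW| |by lra].
  by rewrite ler_pXn2r// nnegrE ltW.
Qed.

Section Equidistribution.
Variables (R : realType) (Phi : R -> R -> R) (K : R).
Hypothesis PhiK : forall w w' x x', `|Phi w x - Phi w' x'| <= K * (`|w - w'| + `|x - x'|).
Hypothesis Phiper : forall (c : int) w x, Phi w (x + c%:~R) = Phi w x.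

Definition mean_Phi w := Rint 0 1 (Phi w).
Notation Psi := mean_Phi.

Lemma Phi_lip w x y : `|Phi w x - Phi w y| <= K * `|x - y|.
Proof. by have := PhiK w w x y; rewrite subrr normr0 add0r. Qed.

Lemma K_ge0 : 0 <= K.
Proof. by have := le_trans (normr_ge0 _) (Phi_lip 0 1 0); rewrite subr0 normr1 mulr1. Qed.

Lemma Psi_lip v w : `|Psi v - Psi w| <= K * `|v - w|.
Proof.
have := @Rint_dist _ (Phi v) (Phi w) (K * `|v - w|) 0 1 (lip_continuous (Phi_lip v))
  (lip_continuous (Phi_lip w)) ler01.
rewrite subr0 mulr1; apply=> x _.
by have := PhiK v w x x; rewrite subrr normr0 addr0.
Qed.

Lemma Phi_near_mean w x : `|Phi w x - Psi w| <= K.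
Proof. by apply: periodic_near_mean; [exact: Phi_lip|move=> c y; exact: Phiper]. Qed.

(** Over q rows the height b / J moves by O(1/J) and t J^2 / b follows the rotation by p / q. *)
Lemma good_block (t c : R) (J Q p q b : nat) : 0 < t -> 0 < c -> (0 < J)%N -> (0 < Q)%N ->
  c * J%:R <= b%:R -> (0 < q <= Q)%N -> coprime p q ->
  `|t * J%:R ^+ 2 / b%:R ^+ 2 - p%:R / q%:R| <= (q%:R * Q%:R)^-1 ->
  `|\sum_(b <= i < b + q) (Phi (i%:R / J%:R) (t * J%:R ^+ 2 / i%:R) - Psi (i%:R / J%:R))| <=
    q%:R * ((2 * K * Q%:R + K * (t * Q%:R ^+ 2 / c ^+ 3)) / J%:R + K / Q%:R + 2 * K / q%:R).
Proof.
move=> t0 c0 J0 Q0 cb /andP[q0 qQ] cpq hth.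
have JR : 0 < J%:R :> R by rewrite ltr0n.
have QR : 0 < Q%:R :> R by rewrite ltr0n.
have qR : 0 < q%:R :> R by rewrite ltr0n.
have bR : 0 < b%:R :> R by apply: lt_le_trans cb; apply: mulr_gt0.
have qQR : q%:R <= Q%:R :> R by rewrite ler_nat.
have K0 := K_ge0.
pose w : R := b%:R / J%:R; pose x : R := t * J%:R ^+ 2 / b%:R.
pose pt (i : nat) := t * J%:R ^+ 2 / (b%:R + i%:R).
pose e := Q%:R^-1 + t * Q%:R ^+ 2 / c ^+ 3 / J%:R.
have hpt i : (i < q)%N -> `|pt i - (x - i%:R * (p%:R / q%:R))| <= e.
  move=> iq; have iqR : i%:R <= q%:R :> R by rewrite ler_nat ltnW.
  have := @hyperbola_taylor _ t c J%:R b%:R i%:R Q%:R _ _ t0 c0 JR cb (ler0n _ _) (le_trans iqR qQR) hth.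
  move/le_trans; apply; rewrite /e lerD2r.
  rewrite ler_pdivrMr ?mulr_gt0//; apply: (le_trans iqR).
  by rewrite mulrCA mulVf ?gt_eqF// mulr1.
have x0 : 0 <= x by rewrite divr_ge0 ?mulr_ge0 ?sqr_ge0// ltW.
have := @block_sum _ K e x (Phi w) p q pt (Phi_lip w) (fun c y => Phiper c w y) q0 cpq x0 hpt.
rewrite -/(Psi w) => hb.
have -> : \sum_(b <= i < b + q) (Phi (i%:R / J%:R) (t * J%:R ^+ 2 / i%:R) - Psi (i%:R / J%:R)) =
  \sum_(0 <= i < q) (Phi (w + i%:R / J%:R) (pt i) - Psi (w + i%:R / J%:R)).
  rewrite -{1}(add0n b) (addnC b q) big_addn addnK; apply: eq_bigr => i _.
  by rewrite /w /pt -mulrDl natrD [i%:R + _]addrC.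
have h1 := @sum_nat_dist _ (fun i => Phi (w + i%:R / J%:R) (pt i) - Psi (w + i%:R / J%:R))
   (fun i => Phi w (pt i) - Psi w) (2 * K * Q%:R / J%:R) 0 q.
have {}h1 : `|\sum_(0 <= i < q) (Phi (w + i%:R / J%:R) (pt i) - Psi (w + i%:R / J%:R)) -
   \sum_(0 <= i < q) (Phi w (pt i) - Psi w)| <= q%:R * (2 * K * Q%:R / J%:R).
  rewrite subn0 in h1; apply: h1 => i /= iq.
  have iQJ : `|w + i%:R / J%:R - w| <= Q%:R / J%:R.
    rewrite addrAC subrr add0r ger0_norm ?divr_ge0// ler_pM2r ?invr_gt0// ler_nat.
    by rewrite (leq_trans _ qQ)// ltnW.
  have a1 := PhiK (w + i%:R / J%:R) w (pt i) (pt i).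
  have a2 := Psi_lip (w + i%:R / J%:R) w.
  have a3 : K * `|w + i%:R / J%:R - w| <= K * (Q%:R / J%:R) by rewrite ler_wpM2l.
  rewrite subrr normr0 addr0 in a1.
  have -> : Phi (w + i%:R / J%:R) (pt i) - Psi (w + i%:R / J%:R) - (Phi w (pt i) - Psi w) =
    (Phi (w + i%:R / J%:R) (pt i) - Phi w (pt i)) - (Psi (w + i%:R / J%:R) - Psi w) by ring.
  apply: (le_trans (ler_normB _ _)); lra.
move: h1; rewrite [X in _ - X]sumrB sumr_const_nat subn0 -[Psi w *+ q]mulr_natl.
set S := \sum_(_ <= _ < _) _ in hb *; set S' := \sum_(_ <= _ < _) (_ - _) => h1.
have -> : S' = (S' - (S - q%:R * Psi w)) + (S - q%:R * Psi w) by ring.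
apply: (le_trans (ler_normD _ _)); apply: (le_trans (lerD h1 hb)).
rewrite le_eqVlt; apply/orP; left; apply/eqP.
by rewrite /e; field; rewrite !gt_eqF.
Qed.

(** The parameters are chosen in this order: q0, so that a period of length at least q0 averages
    well; Q, so that the rotations are precise and the bad rows are few; and J last. *)
Lemma equidistribution_error (t c d : R) : 0 < t -> 0 < c -> 0 < d -> exists J0 : nat,
  forall J m : nat, (J0 <= J)%N -> c * J%:R <= m%:R ->
  `|\sum_(m <= i < J.+1) (Phi (i%:R / J%:R) (t * J%:R ^+ 2 / i%:R) - Psi (i%:R / J%:R))| <= d * J%:R.
Proof.
move=> t0 c0 d0; have K0 := K_ge0.
(* Of the nine parts, six pay for the good blocks (2 J rows at the rate 3 e), two for the bad
   rows and one for the last block. *)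
pose e := d / 9; have e0 : 0 < e by rewrite divr_gt0.
have [q0 [q00 hq0]] := div_nat_small (2 * K) e0.
(* A fraction within 1/Q of a step is at most t / c^2 + 1, which bounds its numerator. *)
pose P := (Num.truncn (q0%:R * (t / c ^+ 2 + 1))).+1.
pose np := (P * q0)%N.
have [Q1 [_ hQ1]] := div_nat_small K e0.
have [Q2 [_ hQ2]] := div_nat_small (np%:R * K / (c * t)) e0.
pose Q := maxn Q1 (maxn Q2 1).
have Q0 : (0 < Q)%N by rewrite /Q !leq_max /= !orbT.
have QR : 0 < Q%:R :> R by rewrite ltr0n.
have {}hQ1 : K / Q%:R <= e by apply: hQ1; rewrite /Q leq_maxl.
have {}hQ2 : np%:R * K / (c * t) / Q%:R <= e by apply: hQ2; rewrite /Q !leq_max leqnn orbT.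
have [J1 [J10 hJ1]] := div_nat_small (2 * K * Q%:R + K * (t * Q%:R ^+ 2 / c ^+ 3)) e0.
have [J2 [_ hJ2]] := div_nat_small (np%:R * K) e0.
have [J3 [_ hJ3]] := div_nat_small (Q%:R * K) e0.
exists (maxn J1 (maxn J2 J3)) => J m; rewrite !geq_max => /and3P[/[dup] JJ1 /hJ1{}hJ1 /hJ2{}hJ2 /hJ3{}hJ3] cm.
have J0 : (0 < J)%N by apply: leq_trans JJ1.
have JR : 0 < J%:R :> R by rewrite ltr0n.
pose bad b := [&& c * J%:R <= b%:R, (b <= J)%N & has (fun pq : nat * nat =>
     `|t * J%:R ^+ 2 / b%:R ^+ 2 - pq.1%:R / pq.2%:R| <= Q%:R^-1)
       [seq (p, q) | p <- iota 0 P, q <- iota 0 q0]].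
have hE i : (m <= i)%N -> (i + Q <= J.+1)%N -> ~~ bad i ->
    exists2 q, (0 < q <= Q)%N &
     `|\sum_(i <= j < i + q) (Phi (j%:R / J%:R) (t * J%:R ^+ 2 / j%:R) - Psi (j%:R / J%:R))| <= q%:R * (3 * e).
  move=> mi iQ nbad.
  have ci : c * J%:R <= i%:R by apply: (le_trans cm); rewrite ler_nat.
  have iJ : (i <= J)%N by clear -iQ Q0; lia.
  have iR : 0 < i%:R :> R by apply: lt_le_trans ci; apply: mulr_gt0.
  have th0 : 0 <= t * J%:R ^+ 2 / i%:R ^+ 2 by rewrite divr_ge0 ?mulr_ge0 ?sqr_ge0// ltW.
  have [p [q [qQ cpq hpq]]] := dirichlet th0 Q0.
  have q0R : 0 < q%:R :> R by rewrite ltr0n; case/andP: qQ.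
  exists q => //.
  apply: (le_trans (good_block t0 c0 J0 Q0 ci qQ cpq hpq)).
  rewrite ler_pM2l//.
  suff qq0 : (q0 <= q)%N by have := hq0 q qq0; lra.
  rewrite leqNgt; apply/negP => qlt; move/negP: nbad; apply.
  rewrite /bad ci iJ !andTb.
  have hQ : `|t * J%:R ^+ 2 / i%:R ^+ 2 - p%:R / q%:R| <= Q%:R^-1.
    apply: (le_trans hpq); rewrite lef_pV2 ?posrE ?mulr_gt0//.
    by apply: ler_peMl; [exact: ltW|rewrite ler1n; case/andP: qQ].
  apply/hasP; exists (p, q) => //; apply/allpairsPdep; exists p, q; split => //; last by rewrite mem_iota.
  rewrite mem_iota /= add0n /P ltnS.
  rewrite truncn_ge_nat; last by rewrite mulr_ge0// addr_ge0// divr_ge0 ?sqr_ge0// ltW.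
  have thc : t * J%:R ^+ 2 / i%:R ^+ 2 <= t / c ^+ 2.
    rewrite ler_pdivrMr ?exprn_gt0//.
    have -> : t / c ^+ 2 * i%:R ^+ 2 = t * (i%:R / c) ^+ 2 by field; rewrite gt_eqF.
    rewrite ler_pM2l// ler_pXn2r ?nnegrE ?divr_ge0//; last exact: ltW.
    by rewrite ler_pdivlMr// mulrC.
  have Q1R : Q%:R^-1 <= 1 :> R by rewrite invf_le1// ler1n.
  have pq : p%:R / q%:R <= t / c ^+ 2 + 1.
    by move: hQ; rewrite ler_norml => /andP[? ?]; lra.
  have -> : p%:R = q%:R * (p%:R / q%:R) :> R by field; rewrite gt_eqF.
  by apply: ler_pM; [exact: ler0n|rewrite divr_ge0// ltW|rewrite ler_nat ltnW|exact: pq].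
have Kb i : (m <= i < J.+1)%N ->
  `|Phi (i%:R / J%:R) (t * J%:R ^+ 2 / i%:R) - Psi (i%:R / J%:R)| <= K.
  by move=> _; apply: Phi_near_mean.
have e30 : 0 <= 3 * e by lra.
apply: (le_trans (greedy_blocks e30 K0 Kb hE)).
have := @count_bad_rows R t c J Q q0 P m (J.+1 - m) t0 c0 J0 Q0.
rewrite -/bad -/np => hc.
have b1 : (J.+1 - m)%:R * (3 * e) <= 2 * J%:R * (3 * e).
  by rewrite ler_wpM2r// -natrM ler_nat; clear -J0; lia.
have b2 : (count bad (iota m (J.+1 - m)))%:R * K <= 2 * e * J%:R.
  apply: (le_trans (ler_wpM2r K0 hc)).
  rewrite ler_pdivrMr// in hJ2.
  have -> : np%:R * (J%:R / (c * t * Q%:R) + 1) * K = np%:R * K / (c * t) / Q%:R * J%:R + np%:R * K.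
    by field; rewrite !gt_eqF.
  have : np%:R * K / (c * t) / Q%:R * J%:R <= e * J%:R by rewrite ler_pM2r.
  lra.
have b3 : Q%:R * K <= e * J%:R by rewrite ler_pdivrMr// in hJ3.
have -> : d = 9 * e by rewrite /e; field.
move: b1 b2 b3; clear; lra.
Qed.

End Equidistribution.

(** By equidistribution_error the values of Phi may be replaced by their means over a period, and
    the sum of the means is a Riemann sum. *)
Theorem equidistribution {R : realType} (Phi : R -> R -> R) (K t c d : R) :
  (forall w w' x x', `|Phi w x - Phi w' x'| <= K * (`|w - w'| + `|x - x'|)) ->
  (forall (m : int) w x, Phi w (x + m%:~R) = Phi w x) ->
  0 < t -> 0 < c -> c <= 1 -> 0 < d -> exists J0 : nat, forall J : nat, (J0 <= J)%N ->
  `|(\sum_(0 <= b < J.+1 | c * J%:R <= b%:R) Phi (b%:R / J%:R) (t * J%:R ^+ 2 / b%:R)) / J%:R -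
     Rint c 1 (mean_Phi Phi)| <= d.
Proof.
move=> PhiK Phiper t0 c0 c1 d0.
set Psi := mean_Phi Phi.
have PsiK := Psi_lip PhiK; rewrite -/Psi in PsiK.
have K0 := K_ge0 PhiK.
have cPsi := lip_continuous PsiK.
have d20 : 0 < d / 2 by rewrite divr_gt0.
have [J1 hJ1] := equidistribution_error PhiK Phiper t0 c0 d20.
pose B := `|Psi 1| + K.
have [J2 [J20 hJ2]] := div_nat_small (2 * K + 2 * B) d20.
exists (maxn J1 J2) => J; rewrite geq_max => /andP[/hJ1{}hJ1 /[dup] JJ2 /hJ2{}hJ2].
have J0 : (0 < J)%N by apply: leq_trans JJ2.
have JR : 0 < J%:R :> R by rewrite ltr0n.
have J1R : 1 <= J%:R :> R by rewrite ler1n.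
have exm : exists m : nat, c * J%:R <= m%:R by exists J; rewrite ler_piMl// ltW.
case: (ex_minnP exm) => m cm mmin.
have mJ : (m <= J)%N by apply: mmin; rewrite ler_piMl// ltW.
have mc : m%:R < c * J%:R + 1.
  case: m cm mmin {hJ1 mJ} => [|m] cm mmin; first by rewrite ltr_wpDl// mulr_ge0// ltW.
  rewrite -natr1 ltrD2r ltNge; apply/negP => /mmin; by rewrite ltnn.
have -> : \sum_(0 <= b < J.+1 | c * J%:R <= b%:R) Phi (b%:R / J%:R) (t * J%:R ^+ 2 / b%:R) =
   \sum_(m <= b < J.+1) Phi (b%:R / J%:R) (t * J%:R ^+ 2 / b%:R).
  rewrite [RHS](big_nat_widenl m 0)//; apply: eq_bigl => b /=.
  by apply/idP/idP => [/mmin//|mb]; apply: (le_trans cm); rewrite ler_nat.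
have {hJ1} := hJ1 m cm; rewrite sumrB -/Psi.
set S := \sum_(_ <= _ < _) Phi _ _; set S' := \sum_(_ <= _ < _) _ => hS.
pose h : R := J%:R^-1; have h0 : 0 < h by rewrite invr_gt0.
have := @riemann_sum _ K Psi (m%:R * h) h (J.+1 - m) PsiK (ltW h0).
have iotaE : iota 0 (J.+1 - m) = index_iota 0 (J.+1 - m) by rewrite /index_iota subn0.
rewrite iotaE -mulr_sumr.
have -> : \sum_(0 <= i < J.+1 - m) Psi (m%:R * h + i%:R * h) = S'.
  rewrite /S' -[in RHS](add0n m) big_addn; apply: eq_bigr => i _.
  by rewrite -mulrDl natrD addrC.
have mJ1 : (m <= J.+1)%N by rewrite ltnW// ltnS.
have -> : m%:R * h + (J.+1 - m)%:R * h = 1 + h.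
  by rewrite natrB// -natr1 /h; field; rewrite gt_eqF.
have nle : (J.+1 - m)%:R * (K * h ^+ 2) <= 2 * K * h.
  have -> : 2 * K * h = (2 * J%:R) * (K * h ^+ 2) by rewrite /h; field; rewrite gt_eqF.
  apply: ler_wpM2r; first by rewrite mulr_ge0// sqr_ge0.
  by rewrite -natrM ler_nat; clear -J0; lia.
move=> hR.
have cu : c <= m%:R * h by rewrite ler_pdivlMr.
have uh : m%:R * h <= 1 + h.
  by rewrite ler_pdivrMr// mulrDl mul1r /h mulVf ?gt_eqF// natr1 ler_nat.
have h1 : h <= 1 by rewrite invf_le1.
have E1 := Rint_cat cPsi cu uh.
have E2 : Rint c (1 + h) Psi = Rint c 1 Psi + Rint 1 (1 + h) Psi.
  by apply: Rint_cat => //; rewrite lerDl ltW.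
have bnd (u v : R) : 0 <= u -> u <= v -> v <= 2 -> v - u <= h -> `|Rint u v Psi| <= B * h.
  move=> u0 uv v2 vu; have := @Rint_near_cst _ Psi 0 B u v cPsi uv.
  rewrite mul0r subr0 => hb; apply: (@le_trans _ _ (B * (v - u))).
    apply: hb => x hx; rewrite subr0 /B.
    have -> : Psi x = Psi 1 + (Psi x - Psi 1) by ring.
    apply: (le_trans (ler_normD _ _)); rewrite lerD2l; apply: (le_trans (PsiK _ _)).
    by rewrite -[leRHS]mulr1 ler_wpM2l// ler_norml; lra.
  by rewrite ler_wpM2l// /B addr_ge0.
have b1 : `|Rint c (m%:R * h) Psi| <= B * h.
  apply: bnd => //; first exact: ltW.
    rewrite ler_pdivrMr//; apply: (@le_trans _ _ J%:R); first by rewrite ler_nat.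
    by rewrite ler_peMl// ler1n.
  have -> : m%:R * h - c = (m%:R - c * J%:R) * h by rewrite /h; field; rewrite gt_eqF.
  by rewrite ger_pMl//; lra.
have b2 : `|Rint 1 (1 + h) Psi| <= B * h by apply: bnd; lra.
have hS2 : `|S / J%:R - h * S'| <= d / 2.
  have -> : S / J%:R - h * S' = h * (S - S') by rewrite /h; ring.
  rewrite normrM (gtr0_norm h0) mulrC ler_pdivrMr//.
rewrite -[_ / J%:R]/(_ * h) in hJ2.
have {}hJ2 : 2 * K * h + 2 * (B * h) <= d / 2.
  by move: hJ2; rewrite mulrDl -[2 * B * h]mulrA.
move: hS2 hR b1 b2; rewrite !ler_norml.
move: nle hJ2 E1 E2; clear.
move: (Rint c 1 Psi) (Rint 1 _ Psi) (Rint c (1 + h) Psi) (Rint c _ Psi) (Rint _ _ Psi) (S / J%:R) (h * S') (_ * (K * h ^+ 2)).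
move=> i1 i2 i3 i4 i5 s s' x.
lra.
Qed.

(** * Gaps that begin in a given row *)

(** The row is that of height b.  In it, x, w and y are the parameters of the model sets, c is the
    height above which y <= 1, and kappa / J is the relative error of angle_window.  The numbers C
    and rho are the margins required of abscissas and of fractional parts. *)
Section Rows.
Variables (R : realType) (t lambda : R) (J b h : nat) (C rho : R).
Let D : R := t * J%:R ^+ 2.
Let x : R := D / b%:R.
Let w : R := b%:R / J%:R.
Let y : R := yw t lambda w.
Let c : R := lambda * t / 2.
Let H := h.+1.
Let kappa : R := 18 / t + 2.
Hypotheses (t0 : 0 < t) (l0 : 0 < lambda) (ht : 2 / t < h.+1%:R).
Hypotheses (J0 : (0 < J)%N) (T2 : 2 <= t * J%:R) (Tbig : h%:R + 3 <= t * J%:R).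
Hypotheses (b0 : (0 < b)%N) (bJ : (b <= J)%N).

Definition abscissa (i : nat) : R := i%:R - J%:R.
Notation a := abscissa.

(** Up to equality cases, - J <= s + j x <= J holds exactly for - k <= j <= r.  With a
    bounded error in s, these are the rows b + j in which the ray through the point of abscissa s
    meets the rectangle. *)
Definition in_cell (k r : nat) (s : R) : bool :=
  [&& k%:R * x - J%:R <= s, s <= k.+1%:R * x - J%:R,
      J%:R - r.+1%:R * x <= s & s <= J%:R - r%:R * x].

Definition in_model (k r i : nat) : bool :=
  in_cell k r (a i) && frac_above k r y (x + a i / b%:R).

(** No comparison that decides membership in a model set is close to an equality.  The range of j
    is that of the boundaries of the cells with k, r <= h, which involve k + 1 and r + 1. *)
Definition robust (i : nat) : Prop :=
  (forall j : int, `|j| <= H%:Z ->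
    C < `|a i + j%:~R * x - J%:R| /\ C < `|a i + j%:~R * x + J%:R|) /\
  (forall j m : int, j != 0 -> `|j| <= H%:Z ->
    rho < `|j%:~R * (x + a i / b%:R) - m%:~R| /\
    rho < `|j%:~R * (x + a i / b%:R) - y - m%:~R|).

Lemma JR0 : 0 < J%:R :> R. Proof. by rewrite ltr0n. Qed.
Lemma bR0 : 0 < b%:R :> R. Proof. by rewrite ltr0n. Qed.
Lemma J1R : 1 <= J%:R :> R. Proof. by rewrite ler1n. Qed.
Lemma bJR : b%:R <= J%:R :> R. Proof. by rewrite ler_nat. Qed.
Lemma D_ge : 2 * J%:R <= D.
Proof. by rewrite /D expr2 mulrA ler_pM2r ?JR0. Qed.
Lemma x_gt0 : 0 < x.
Proof. by rewrite divr_gt0 ?bR0//; have := D_ge; have := JR0; lra. Qed.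
Lemma c_gt0 : 0 < c. Proof. by rewrite divr_gt0// mulr_gt0. Qed.
Lemma kappa_gt0 : 0 < kappa. Proof. by rewrite addr_gt0// divr_gt0. Qed.

Lemma yE : y = lambda * t * J%:R / (2 * b%:R).
Proof. by rewrite /y /yw /w; field; rewrite !gt_eqF ?JR0 ?bR0. Qed.

Lemma ycE : y = c * J%:R / b%:R.
Proof. by rewrite yE /c; field; rewrite !gt_eqF ?bR0. Qed.

Lemma y_gt0 : 0 < y.
Proof. by rewrite ycE divr_gt0 ?bR0// mulr_gt0 ?JR0 ?c_gt0. Qed.

Lemma a_bounds i : (i < (2 * J).+1)%N -> - J%:R <= a i <= J%:R.
Proof.
move=> iJ; rewrite /a; have : i%:R <= (2 * J)%:R :> R by rewrite ler_nat -ltnS.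
by rewrite natrM => h1; have := ler0n R i; lra.
Qed.

Lemma in_cell_Rkr k r s : in_cell k r s = (Rkr t k r w <= s / b%:R <= Skr t k r w).
Proof.
have E1 (n : R) : n * t / w ^+ 2 - 1 / w = (n * x - J%:R) / b%:R.
  by rewrite /w /x /D; field; rewrite !gt_eqF ?JR0 ?bR0.
have E2 (n : R) : 1 / w - n * t / w ^+ 2 = (J%:R - n * x) / b%:R.
  by rewrite /w /x /D; field; rewrite !gt_eqF ?JR0 ?bR0.
have ib : 0 < b%:R^-1 :> R by rewrite invr_gt0 bR0.
rewrite /Rkr /Skr ge_max le_min !E1 !E2 !(ler_pM2r ib) /in_cell.
by rewrite -!andbA; congr andb; rewrite andbCA.
Qed.

(** Distinct cells meet only at their ends, which robust points avoid. *)
Lemma in_cell_unique k r k' r' i : 0 <= C -> robust i -> (k <= h)%N -> (r <= h)%N ->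
  (k' <= h)%N -> (r' <= h)%N -> in_cell k r (a i) -> in_cell k' r' (a i) -> k = k' /\ r = r'.
Proof.
move=> C0 [rob _] kh rh k'h r'h /and4P[h1 h2 h3 h4] /and4P[h1' h2' h3' h4'].
have x0 := x_gt0.
have mono (m n : nat) : (m <= n)%N -> m%:R * x <= n%:R * x.
  by move=> mn; rewrite ler_pM2r// ler_nat.
have nk (n : nat) : (n <= h)%N -> a i = n.+1%:R * x - J%:R -> False.
  move=> nh E; have [] := rob (- n.+1%:Z); first by rewrite normrN.
  rewrite mulrNz mulNr /= E => _.
  have -> : n.+1%:R * x - J%:R - n.+1%:R * x + J%:R = 0 by ring.
  by rewrite normr0; lra.
have nr (n : nat) : (n <= h)%N -> a i = J%:R - n.+1%:R * x -> False.
  move=> nh E; have [] := rob n.+1%:Z; first by [].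
  rewrite /= E => + _.
  have -> : J%:R - n.+1%:R * x + n.+1%:R * x - J%:R = 0 by ring.
  by rewrite normr0; lra.
split.
  have [lt|gt|//] := ltngtP k k'.
    by case: (nk k) => //; have := mono _ _ lt; lra.
  by case: (nk k') => //; have := mono _ _ gt; lra.
have [lt|gt|//] := ltngtP r r'.
  by case: (nr r) => //; have := mono _ _ lt; lra.
by case: (nr r') => //; have := mono _ _ gt; lra.
Qed.

(** The indices are bounded by 2 J / x, hence by 2 / t. *)
Lemma in_cell_exists s : - J%:R <= s <= J%:R ->
  exists k r : nat, [/\ (k <= h)%N, (r <= h)%N & in_cell k r s].
Proof.
move=> /andP[s1 s2]; have x0 := x_gt0.
have small u : 0 <= u -> u <= 2 * J%:R -> (Num.truncn (u / x) <= h)%N.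
  move=> u0 uJ; rewrite -ltnS -(ltr_nat R).
  apply: (@le_lt_trans _ _ (u / x)); first by rewrite truncn_le divr_ge0// ltW.
  apply: (@le_lt_trans _ _ (2 / t)) => //.
  rewrite ler_pdivrMr//; apply: (le_trans uJ).
  have -> : 2 / t * x = 2 * J%:R * (J%:R / b%:R).
    by rewrite /x /D; field; rewrite !gt_eqF ?bR0.
  by rewrite ler_peMr ?mulr_ge0// ler_pdivlMr ?bR0// mul1r bJR.
have br u : 0 <= u -> (Num.truncn (u / x))%:R * x <= u <= (Num.truncn (u / x)).+1%:R * x.
  move=> u0; rewrite -ler_pdivlMr// truncn_le divr_ge0//=; last exact: ltW.
  by rewrite -ler_pdivrMr// ltW// truncnS_gt.
exists (Num.truncn ((s + J%:R) / x)), (Num.truncn ((J%:R - s) / x)); split.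
- by apply: small; lra.
- by apply: small; lra.
- have /andP[g1 g2] : _ := br (s + J%:R) ltac:(lra).
  have /andP[g3 g4] : _ := br (J%:R - s) ltac:(lra).
  by rewrite /in_cell; apply/and4P; split; lra.
Qed.

Definition pt_angle (i b' : nat) : R := atan (b'%:R / (D + a i)).
(** The number lambda times the average gap; the largest angle is that of the point (- J, J). *)
Definition window : R :=
  lambda * (atan (J%:R / (D - J%:R)) / ((2 * J%:R + 1) * (J%:R + 1))).

Lemma pt_offset i i' b' :
  offset D (a i) b%:R (a i') b'%:R = i%:R - i'%:R + (b'%:R - b%:R) * (x + a i / b%:R).
Proof. by rewrite /offset /x /a; field; rewrite gt_eqF ?bR0. Qed.

Lemma pt_den_gt0 i : (i < (2 * J).+1)%N -> 0 < D + a i.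
Proof. by move/a_bounds; have := D_ge; have := JR0; lra. Qed.

Lemma pt_lt i i' b' : (i < (2 * J).+1)%N -> (i' < (2 * J).+1)%N ->
  (pt_angle i b < pt_angle i' b') = (0 < offset D (a i) b%:R (a i') b'%:R).
Proof. by move=> hi hi'; apply: angle_lt_offset; rewrite ?bR0 ?pt_den_gt0. Qed.

Lemma pt_le i i' b' : (i < (2 * J).+1)%N -> (i' < (2 * J).+1)%N ->
  (pt_angle i b <= pt_angle i' b') = (0 <= offset D (a i) b%:R (a i') b'%:R).
Proof. by move=> hi hi'; apply: angle_le_offset; rewrite ?bR0 ?pt_den_gt0. Qed.

Lemma kappaE : 18 / (t * J%:R) + 2 / J%:R = kappa / J%:R.
Proof. by rewrite /kappa; field; rewrite !gt_eqF ?JR0. Qed.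

Lemma pt_window i i' b' : (i < (2 * J).+1)%N -> (i' < (2 * J).+1)%N -> (b' <= J)%N ->
  0 <= offset D (a i) b%:R (a i') b'%:R ->
  (pt_angle i' b' < pt_angle i b + window ->
     offset D (a i) b%:R (a i') b'%:R < y * (1 + kappa / J%:R)) /\
  (pt_angle i b + window <= pt_angle i' b' ->
     y * (1 - kappa / J%:R) <= offset D (a i) b%:R (a i') b'%:R).
Proof.
move=> hi hi' hb'; rewrite yE -kappaE; apply: angle_window => //.
- exact: J1R.
- exact: a_bounds.
- by rewrite bR0 bJR.
- exact: a_bounds.
- by rewrite ler0n ler_nat.
Qed.

Hypotheses (rho_kappa : kappa / J%:R <= rho) (rho_H : H%:R / (c * J%:R) <= rho).
Hypotheses (C_H : H%:R / c + 2 <= C) (C_kappa : c * kappa <= C).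

(** Here y < 1 with some room.  This matters because the left neighbour of a point in its own row
    is at offset 1. *)
Definition upper_row : Prop := c * J%:R + C < b%:R.

Lemma slope_ge : t * J%:R - 1 <= x + abscissa 0 / b%:R.
Proof.
have -> : x + abscissa 0 / b%:R = (D - J%:R) / b%:R.
  by rewrite /x /abscissa /=; field; rewrite gt_eqF ?bR0.
rewrite ler_pdivlMr ?bR0//.
have -> : D - J%:R = (t * J%:R - 1) * J%:R by rewrite /D; ring.
by rewrite ler_wpM2l ?bJR//; have := T2; lra.
Qed.

Lemma slope_mono i : x + abscissa 0 / b%:R <= x + a i / b%:R.
Proof.
by rewrite lerD2l ler_pM2r ?invr_gt0 ?bR0// /abscissa lerD2r ler_nat.
Qed.

(** The ray through (a, b) meets the row b + j at the abscissa a + j (x + a / b), whereas the cells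
    are defined by a + j x; the difference is bounded. *)
Lemma jshift_small (j : int) i : upper_row -> (i < (2 * J).+1)%N -> `|j| <= H%:Z ->
  `|j%:~R * (a i / b%:R)| <= C - 2.
Proof.
move=> ub /a_bounds ai jH.
have b0R := bR0.
have cJ : 0 < c * J%:R by rewrite mulr_gt0 ?c_gt0 ?JR0.
have Cp : 0 < C by have := C_H; have : 0 <= H%:R / c by [rewrite divr_ge0 ?ltW ?c_gt0]; lra.
have cb : c * J%:R <= b%:R by have := ub; rewrite /upper_row; lra.
have jR : `|j%:~R| <= H%:R :> R by rewrite -intr_norm -[H%:R]/((H%:Z)%:~R) ler_int.
have aJ : `|a i| <= J%:R by rewrite ler_norml.
apply: (@le_trans _ _ (H%:R / c)); last by have := C_H; lra.
rewrite normrM normrM normfV (gtr0_norm b0R) ler_pdivlMr ?c_gt0//.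
rewrite -mulrA -[leRHS]mulr1; apply: ler_pM => //.
  by apply: mulr_ge0; [rewrite divr_ge0|exact: ltW c_gt0].
rewrite mulrAC ler_pdivrMr// mul1r; apply: le_trans cb; rewrite mulrC.
by rewrite ler_pM2l ?c_gt0.
Qed.

Lemma upper_y : upper_row -> y * (1 + kappa / J%:R) < 1.
Proof.
move=> ub; have b0R := bR0; have J0R := JR0.
have -> : y * (1 + kappa / J%:R) = (c * J%:R + c * kappa) / b%:R.
  by rewrite ycE; field; rewrite !gt_eqF.
by rewrite ltr_pdivrMr// mul1r; have := ub; rewrite /upper_row; have := C_kappa; lra.
Qed.

Lemma upper_y1 : upper_row -> y < 1.
Proof.
move/upper_y; have : 0 <= kappa / J%:R by rewrite divr_ge0// ltW// kappa_gt0.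
by have := y_gt0; nra.
Qed.

Lemma floor_frac (v : R) : v = (Num.floor v)%:~R + frac v.
Proof. by rewrite /frac; ring. Qed.

Lemma frac_unique (n : int) (v d : R) : v - d = n%:~R -> 0 <= d < 1 -> frac v = d.
Proof. by move=> E hd; rewrite (@frac_int _ n) -E; lra. Qed.

Lemma offset_int_shift i i' b' (j : int) : b'%:Z - b%:Z = j ->
  j%:~R * (x + a i / b%:R) - offset D (a i) b%:R (a i') b'%:R = (i'%:Z - i%:Z)%:~R.
Proof.
move=> <-; rewrite pt_offset !intrB -!pmulrn; ring.
Qed.

(** Let d be the offset of a point in the window, and j = b' - b.  If j <> 0, then d = frac (j z),
    where z = x + a / b, and d < y (1 + kappa / J).  By robustness j belongs to [- k, r], so that
    d >= y, and then d >= y + rho, a contradiction.  If j = 0, then d is an integer in [0, 1). *)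
Lemma in_model_isolated k r i i' b' : upper_row -> robust i -> (k <= h)%N -> (r <= h)%N ->
  (i < (2 * J).+1)%N -> (i' < (2 * J).+1)%N -> (b' <= J)%N ->
  in_model k r i -> pt_angle i b <= pt_angle i' b' < pt_angle i b + window ->
  i' = i /\ b' = b.
Proof.
move=> ub [rob1 rob2] kh rh hi hi' hb' /andP[hcell hfrac] /andP[hle hlt].
have d0 : 0 <= offset D (a i) b%:R (a i') b'%:R by rewrite -pt_le.
have [/(_ hlt) hd _] := pt_window hi hi' hb' d0.
pose j : int := b'%:Z - b%:Z.
have jz := @offset_int_shift i i' b' j erefl.
move: d0 hd jz; set d := offset _ _ _ _ _; set z := x + _ => d0 hd jz.
have d1 : d < 1 by apply: lt_trans hd (upper_y ub).
have [j0|jn0] := eqVneq j 0.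
  have bb : b' = b by move: j0; rewrite /j; clear; lia.
  split=> //; move: jz; rewrite j0 mul0r sub0r => jz.
  have : (i'%:Z - i%:Z)%:~R = - d by [].
  have [lt|gt|//] := ltngtP i' i => E.
    have : (i'%:Z - i%:Z)%:~R <= (-1)%:~R :> R by rewrite ler_int; clear -lt; lia.
    by rewrite E (_ : (-1)%:~R = -1 :> R)// => bad; exfalso; lra.
  have : (1)%:~R <= (i'%:Z - i%:Z)%:~R :> R by rewrite ler_int; clear -gt; lia.
  by rewrite E (_ : 1%:~R = 1 :> R)// => bad; exfalso; lra.
have fz : frac (j%:~R * z) = d by apply: frac_unique jz _; rewrite d0 d1.
have ai' := a_bounds hi'; have ai := a_bounds hi.
have aE : a i + j%:~R * z = a i' + d.
  have -> : j%:~R * z = d + (i'%:Z - i%:Z)%:~R by rewrite -jz; ring.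
  by rewrite /abscissa intrB -!pmulrn; ring.
have z1 : t * J%:R - 1 <= z by apply: le_trans slope_ge (slope_mono i).
have jH : `|j| <= H%:Z.
  rewrite -ltzD1 -(ltr_int R) intrD /H.
  have z0 : 0 < z by have := T2; lra.
  have : `|j%:~R * z| < 2 * J%:R + 1.
    have -> : j%:~R * z = a i' + d - a i by rewrite -aE; ring.
    by rewrite ltr_norml; lra.
  rewrite normrM (gtr0_norm z0) -intr_norm => hjz.
  rewrite -(ltr_pM2r z0); apply: (lt_le_trans hjz).
  apply: (@le_trans _ _ ((h.+2)%:R * (t * J%:R - 1))); last first.
    by rewrite -[h.+2]addn1 natrD ler_pM2l// -natrD ltr0n addn1.
  have : 2 * J%:R < h.+1%:R * (t * J%:R).
    by have := ht; rewrite ltr_pdivrMr// mulrA ltr_pM2r ?JR0.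
  have := Tbig; rewrite -[h.+2]addn2 -[h.+1]addn1 !natrD; lra.
have sm := jshift_small ub hi jH.
have [] := rob1 j jH.
have -> : a i + j%:~R * x = a i' + d - j%:~R * (a i / b%:R) by rewrite -aE /z; ring.
move: sm; rewrite ler_norml; set q := j%:~R * (a i / _) => sm.
move=> g1 g2.
have hC : 2 <= C by have := C_H; have : 0 <= H%:R / c by [apply: divr_ge0; rewrite // ltW ?c_gt0]; lra.
have e1 : - J%:R < a i' + d - q.
  move: g2; case: (lerP 0 (a i' + d - q + J%:R)) => [e0|e0]; first by rewrite ger0_norm//; lra.
  by rewrite ltr0_norm//; lra.
have e2 : a i' + d - q < J%:R.
  move: g1; case: (lerP 0 (a i' + d - q - J%:R)) => [e0|e0]; first by rewrite ger0_norm//; lra.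
  by rewrite ltr0_norm//; lra.
have aq : a i + j%:~R * x = a i' + d - q by rewrite -aE /z /q; ring.
move: e1 e2; rewrite -aq => e1 e2.
have x0 := x_gt0.
move: hcell => /and4P[c1 c2 c3 c4].
have jr : j \in jrange k r.
  rewrite mem_jrange jn0 /=; apply/andP; split; rewrite leNgt; apply/negP => hj.
    have : j%:~R * x <= (- k.+1%:Z)%:~R * x.
      by rewrite ler_pM2r// ler_int; clear -hj; lia.
    by rewrite mulrNz mulNr -[k.+1%:Z%:~R]/(k.+1%:R); lra.
  have : (r.+1%:Z)%:~R * x <= j%:~R * x.
    by rewrite ler_pM2r// ler_int; clear -hj; lia.
  by rewrite -[r.+1%:Z%:~R]/(r.+1%:R); lra.
have yd := allP hfrac j jr; rewrite -/z fz in yd.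
have [_] := rob2 j (Num.floor (j%:~R * z)) jn0 jH.
rewrite -/z {1}(floor_frac (j%:~R * z)) fz.
have -> : (Num.floor (j%:~R * z))%:~R + d - y - (Num.floor (j%:~R * z))%:~R = d - y by ring.
rewrite ger0_norm; last lra.
have := upper_y1 ub; have := rho_kappa; have := y_gt0.
have kJ : 0 <= kappa / J%:R by apply: divr_ge0; [exact: ltW kappa_gt0|exact: ler0n].
have yk : y < 1 -> y * (kappa / J%:R) <= kappa / J%:R by move=> y1; apply: ler_piMl => //; exact: ltW.
by move=> ? ? /yk hyk hrho; exfalso; lra.
Qed.

Lemma kappaJ_ge0 : 0 <= kappa / J%:R.
Proof. by apply: divr_ge0; [exact: ltW kappa_gt0|exact: ler0n]. Qed.

Lemma rho_ge0 : 0 <= rho.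
Proof. exact: le_trans kappaJ_ge0 rho_kappa. Qed.

Lemma C_ge2 : 2 <= C.
Proof.
by apply: le_trans C_H; rewrite lerDr; apply: divr_ge0; [exact: ler0n|exact: ltW c_gt0].
Qed.

Lemma gt_norm_cases (s u : R) : u < `|s| -> s < - u \/ u < s.
Proof. by rewrite ltr_normr => /orP[|]; [right|left; lra]. Qed.

(** Conversely, suppose that frac (j z) < y for some nonzero j of [- k, r].  Then the first lattice
    point to the left of the ray in the row b + j has offset frac (j z), so it is strictly inside
    the window. *)
Lemma gap_in_model i : upper_row -> (b + H <= J)%N -> (H <= b)%N -> robust i ->
  (i < (2 * J).+1)%N ->
  (forall i' b', (i' < (2 * J).+1)%N -> (b' <= J)%N ->
     ~ (pt_angle i b < pt_angle i' b' < pt_angle i b + window)) ->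
  exists k r, [/\ (k <= h)%N, (r <= h)%N & in_model k r i].
Proof.
move=> ub bH Hb rob hi gap; have [rob1 rob2] := rob.
have ai := a_bounds hi.
have [k [r [kh rh hc]]] := in_cell_exists ai.
exists k, r; split=> //; rewrite /in_model hc /=.
apply/allP => j; rewrite mem_jrange => /and3P[jn0 kj jr].
have x0 := x_gt0.
have jH : `|j| <= H%:Z by rewrite /H; clear -kj jr kh rh; lia.
rewrite leNgt; apply/negP => hlt.
set z := x + _ in hlt; set f := frac _ in hlt.
have fb := frac_bounds (j%:~R * z); rewrite -/f in fb.
have inside : - J%:R <= a i + j%:~R * x <= J%:R.
  have /and4P[c1 c2 c3 c4] := hc.
  have [j0|j0] := lerP 0 j.
    have u1 : j%:~R * x <= r%:R * x by rewrite ler_pM2r// -[r%:R]/((r%:Z)%:~R) ler_int.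
    have u2 : 0 <= j%:~R * x by apply: mulr_ge0; [rewrite ler0z|exact: ltW].
    by lra.
  have u1 : - (k%:R * x) <= j%:~R * x.
    by rewrite -mulNr ler_pM2r// -[k%:R]/((k%:Z)%:~R) -mulrNz ler_int.
  have u2 : j%:~R * x <= 0 by apply: mulr_le0_ge0; [rewrite lerz0 ltW|exact: ltW].
  by lra.
have [g1 g2] := rob1 j jH.
have sm := jshift_small ub hi jH.
have C2 := C_ge2.
have in2 : - J%:R + 1 < a i + j%:~R * z < J%:R.
  have -> : a i + j%:~R * z = a i + j%:~R * x + j%:~R * (a i / b%:R) by rewrite /z; ring.
  move: sm; rewrite ler_norml.
  by case: (gt_norm_cases g1) => ?; case: (gt_norm_cases g2) => ?; lra.
pose n := Num.floor (j%:~R * z).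
have zE : j%:~R * z = n%:~R + f by apply: floor_frac.
pose ii : int := i%:Z + n.
have ii0 : 0 <= ii.
  rewrite -(ler_int R) /ii intrD -[(i%:Z)%:~R]/(i%:R).
  by have : a i + n%:~R = i%:R - J%:R + n%:~R by []; lra.
have iiJ : ii <= (2 * J)%N%:Z.
  rewrite -(ler_int R) /ii intrD -[(i%:Z)%:~R]/(i%:R) -[((2 * J)%N%:Z)%:~R]/((2 * J)%N%:R) natrM.
  by have : a i + n%:~R = i%:R - J%:R + n%:~R by []; lra.
pose i' := absz ii.
have i'E : i'%:Z = ii by rewrite /i' gez0_abs.
have hi' : (i' < (2 * J).+1)%N by rewrite ltnS -lez_nat i'E.
have bj0 : 0 <= b%:Z + j by clear -Hb jH; lia.
pose b' := absz (b%:Z + j).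
have b'E : b'%:Z = b%:Z + j by rewrite /b' gez0_abs.
have hb' : (b' <= J)%N by clear -bH jH b'E; lia.
have jE : b'%:Z - b%:Z = j by rewrite b'E; clear; lia.
have := @offset_int_shift i i' b' j jE.
rewrite i'E -/z zE (_ : ii - i%:Z = n); last by rewrite /ii; clear; lia.
move=> oE; have {oE} dE : offset D (a i) b%:R (a i') b'%:R = f by lra.
have [q1 q2] := rob2 j n jn0 jH.
move: q1 q2; rewrite -/z zE.
have -> : n%:~R + f - n%:~R = f by ring.
have -> : n%:~R + f - y - n%:~R = f - y by ring.
have r0 := rho_ge0.
rewrite ger0_norm; last lra.
rewrite ltr0_norm; last lra.
move=> q1 q2.
apply: (gap i' b' hi' hb'); apply/andP; split.
  by rewrite pt_lt// dE; lra.
rewrite ltNge; apply/negP => hge.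
have [_ /(_ hge)] := pt_window hi hi' hb' ltac:(by rewrite dE; lra).
rewrite dE.
have := upper_y1 ub; have := rho_kappa; have := y_gt0.
have yk : y < 1 -> y * (kappa / J%:R) <= kappa / J%:R.
  by move=> y1; apply: ler_piMl; [exact: kappaJ_ge0|exact: ltW].
by move=> ? ? /yk ? ?; lra.
Qed.

(** Here y > 1, so that the left neighbour in the same row is inside the window. *)
Lemma low_row_no_gap i : b%:R < c * J%:R - C -> (0 < i)%N -> (i < (2 * J).+1)%N ->
  exists i' b', [/\ (i' < (2 * J).+1)%N, (b' <= J)%N &
     pt_angle i b < pt_angle i' b' < pt_angle i b + window].
Proof.
move=> low i0 hi; exists i.-1, b.
have hi' : (i.-1 < (2 * J).+1)%N by apply: leq_ltn_trans (leq_pred _) hi.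
split=> //.
have dE : offset D (a i) b%:R (a i.-1) b%:R = 1.
  by rewrite pt_offset subrr mul0r addr0 -{1}(prednK i0) -natr1; ring.
apply/andP; split; first by rewrite pt_lt// dE.
rewrite ltNge; apply/negP => hge.
have [_ /(_ hge)] := pt_window hi hi' bJ ltac:(by rewrite dE).
rewrite dE ycE.
have -> : c * J%:R / b%:R * (1 - kappa / J%:R) = (c * J%:R - c * kappa) / b%:R.
  by field; rewrite !gt_eqF ?JR0 ?bR0.
by rewrite ler_pdivrMr ?bR0//; have := C_kappa; lra.
Qed.

(** Moving the point by v <= 1 changes the abscissa by less than C and j z by at most rho, too
    little to reverse a comparison. *)
Lemma model_cell k r i (v : R) : upper_row -> robust i -> (k <= h)%N -> (r <= h)%N ->
  0 <= v <= 1 ->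
  ((x + (a i + v) / b%:R) \in good_set k r (Rkr t k r w + x) (Skr t k r w + x) y) = in_model k r i.
Proof.
move=> ub [rob1 rob2] kh rh v01.
have x0 := x_gt0; have C2 := C_ge2; have b0R := bR0.
have -> : ((x + (a i + v) / b%:R) \in good_set k r (Rkr t k r w + x) (Skr t k r w + x) y) =
    in_cell k r (a i + v) && frac_above k r y (x + (a i + v) / b%:R).
  rewrite in_cell_Rkr; set u := (a i + v) / _.
  have E : (Rkr t k r w + x <= x + u <= Skr t k r w + x) = (Rkr t k r w <= u <= Skr t k r w).
    by rewrite ![_ + x]addrC !lerD2l.
  by apply/idP/idP; rewrite inE /good_set /= E.
rewrite /in_model; congr andb.
  have cmpN (n : nat) : (n <= H)%N ->
      ((n%:R * x - J%:R <= a i + v) = (n%:R * x - J%:R <= a i)) *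
      ((a i + v <= n%:R * x - J%:R) = (a i <= n%:R * x - J%:R)).
    move=> nH; have [] := rob1 (- n%:Z); first by rewrite normrN.
    rewrite mulrNz mulNr -[(n%:Z)%:~R]/(n%:R) => _ /gt_norm_cases q.
    by split; apply/idP/idP; case: q => ?; lra.
  have cmpP (n : nat) : (n <= H)%N ->
      ((J%:R - n%:R * x <= a i + v) = (J%:R - n%:R * x <= a i)) *
      ((a i + v <= J%:R - n%:R * x) = (a i <= J%:R - n%:R * x)).
    move=> nH; have [] := rob1 n%:Z; first by [].
    rewrite -[(n%:Z)%:~R]/(n%:R) => /gt_norm_cases q _.
    by split; apply/idP/idP; case: q => ?; lra.
  have kH : (k <= H)%N by rewrite ltnW.
  have rH : (r <= H)%N by rewrite ltnW.
  by rewrite /in_cell !cmpN// !cmpP.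
apply: eq_in_all => j; rewrite mem_jrange => /and3P[jn0 kj jr].
have jH : `|j| <= H%:Z by rewrite /H; clear -kj jr kh rh; lia.
set z := x + a i / b%:R.
have -> : x + (a i + v) / b%:R = z + v / b%:R by rewrite /z; ring.
pose n := Num.floor (j%:~R * z); pose f := frac (j%:~R * z).
have zE : j%:~R * z = n%:~R + f by apply: floor_frac.
have fb : 0 <= f < 1 by apply: frac_bounds.
have s_small : `|j%:~R * (v / b%:R)| <= rho.
  apply: le_trans rho_H.
  have cJ : 0 < c * J%:R by rewrite mulr_gt0 ?c_gt0 ?JR0.
  have cb : c * J%:R <= b%:R by have := ub; rewrite /upper_row; lra.
  have jR : `|j%:~R| <= H%:R :> R by rewrite -intr_norm -[H%:R]/((H%:Z)%:~R) ler_int.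
  rewrite normrM; apply: ler_pM => //.
  rewrite ger0_norm; last by apply: divr_ge0; [lra|exact: ltW].
  rewrite ler_pdivrMr// mulrC ler_pdivlMr//; apply: le_trans cb.
  by apply: ler_piMl; [exact: ltW|lra].
set s := j%:~R * (v / b%:R) in s_small.
have [q1 q2] := rob2 j n jn0 jH; have [q3 _] := rob2 j (n + 1) jn0 jH.
move: q1 q2 q3; rewrite -/z zE.
have -> : n%:~R + f - n%:~R = f by ring.
have -> : n%:~R + f - y - n%:~R = f - y by ring.
have -> : n%:~R + f - (n + 1)%:~R = f - 1 by rewrite intrD; ring.
move=> /gt_norm_cases q1 /gt_norm_cases q2 /gt_norm_cases q3.
have r0 := rho_ge0.
move: s_small; rewrite ler_norml => /andP[s1 s2].
have fs : frac (j%:~R * (z + v / b%:R)) = f + s.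
  apply: (@frac_unique n); first by rewrite mulrDr -/s zE; ring.
  by case: q1 => ?; case: q3 => ?; lra.
rewrite fs -zE -/f.
by apply/idP/idP; case: q2 => ?; lra.
Qed.

Hypotheses (rhoJ : rho * J%:R <= C).

(** The number e selects one of the four inequalities in the definition of robust. *)
Definition defect (j : int) (e i : nat) : Prop :=
  match e with
  | 0 => `|a i + j%:~R * x - J%:R| <= C
  | 1 => `|a i + j%:~R * x + J%:R| <= C
  | 2 => j != 0 /\ exists m : int, `|j%:~R * (x + a i / b%:R) - m%:~R| <= rho
  | _ => j != 0 /\ exists m : int, `|j%:~R * (x + a i / b%:R) - y - m%:~R| <= rho
  end.

Lemma not_robust_defect i : ~ robust i ->
  exists j e, [/\ `|j| <= H%:Z, (e < 4)%N & defect j e i].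
Proof.
move=> nrob; apply: contrapT => none; apply: nrob.
have good j e : `|j| <= H%:Z -> (e < 4)%N -> ~ defect j e i.
  by move=> jH e4 dj; apply: none; exists j, e.
split=> [j jH|j m jn0 jH]; split; rewrite ltNge; apply/negP => hle.
- exact: (good j 0%N jH).
- exact: (good j 1%N jH).
- by apply: (good j 2%N jH) => //; split=> //; exists m.
- by apply: (good j 3%N jH) => //; split=> //; exists m.
Qed.

Definition defect_bound : R := (5 * C + 2) * (2 * C + 1).

(** The first two kinds of defect confine the abscissa to an interval of length 2 C.  The other two
    say that an affine function of slope j / b is close to an integer; as b >= c J, its values at
    the O(J) abscissas sweep a bounded interval. *)
Lemma count_defect (j : int) (e : nat) : c * J%:R <= b%:R -> `|j| <= H%:Z ->
  (count (fun i => `[< defect j e i >]) (iota 0 (2 * J).+1))%:R <= defect_bound.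
Proof.
move=> cb jH; have C2 := C_ge2; have J0R := JR0; have b0R := bR0.
have win q : (count (fun i => `[< `|a i + q| <= C >]) (iota 0 (2 * J).+1))%:R <= defect_bound.
  apply: (@le_trans _ _ (2 * C / 1 + 1)).
    apply: (@count_affine_window _ _ _ _ 1 (q - J%:R)) => //; first lra.
    by move=> i /asboolP; rewrite /abscissa mul1r addrA addrAC.
  by rewrite divr1 /defect_bound; nra.
have wrap q : j != 0 ->
  (count (fun i => `[< exists m : int, `|j%:~R * (x + a i / b%:R) - q - m%:~R| <= rho >])
     (iota 0 (2 * J).+1))%:R <= defect_bound.
  move=> jn0; have r0 := rho_ge0.
  pose al := j%:~R / b%:R : R.
  have j1 : 1 <= `|j%:~R| :> R by rewrite -intr_norm -[1]/(1%:~R) ler_int; clear -jn0; lia.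
  have jR : `|j%:~R| <= H%:R :> R by rewrite -intr_norm -[H%:R]/((H%:Z)%:~R) ler_int.
  have alE : `|al| = `|j%:~R| / b%:R by rewrite normrM normfV (gtr0_norm b0R).
  have al0 : 0 < `|al| by rewrite alE divr_gt0//; lra.
  have := @count_affine_mod _ (fun i => `[< exists m : int, `|j%:~R * (x + a i / b%:R) - q - m%:~R| <= rho >])
    (2 * J).+1 al (j%:~R * x - j%:~R * J%:R / b%:R - q) rho.
  move=> /(_ _ r0 _) hcm; apply: le_trans (hcm _ _) _.
  - by rewrite -normr_gt0.
  - move=> i _ /asboolP[m hm]; exists m; move: hm.
    rewrite (_ : al * i%:R + _ - _ = j%:~R * (x + a i / b%:R) - q - m%:~R)//.
    by rewrite /al /abscissa; ring.
  have c0 := c_gt0.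
  have HC : H%:R / c <= C by have := C_H; lra.
  have n3 : `|al| * (2 * J).+1%:R <= 3 * C.
    apply: (@le_trans _ _ (3 * (H%:R / c))); last by rewrite ler_pM2l.
    rewrite alE; apply: (@le_trans _ _ (H%:R / (c * J%:R) * (3 * J%:R))).
      apply: ler_pM => //.
      - by apply: ler_pM; rewrite ?normr_ge0 ?invr_ge0 ?(ltW b0R)// lef_pV2 ?posrE ?mulr_gt0.
      - by rewrite -natrM ler_nat; clear -J0; lia.
    rewrite le_eqVlt; apply/orP; left; apply/eqP.
    by field; rewrite !gt_eqF.
  have rC : rho <= C by apply: le_trans rhoJ; rewrite ler_peMr// J1R.
  have ra : rho / `|al| <= C.
    apply: le_trans rhoJ; rewrite ler_wpM2l// alE invf_div.
    rewrite ler_pdivrMr; last lra.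
    apply: le_trans bJR _; rewrite ler_peMr//; exact: ltW.
  rewrite /defect_bound; apply: ler_pM.
  - by rewrite addr_ge0// addr_ge0 ?mulr_ge0.
  - by rewrite addr_ge0// divr_ge0// mulr_ge0.
  - lra.
  - by rewrite -mulrA; lra.
have B0 : 0 <= defect_bound by apply: mulr_ge0; lra.
case: e => [|[|[|e]]].
- apply: le_trans (win (j%:~R * x - J%:R)); rewrite ler_nat; apply: sub_count => i.
  by rewrite addrA.
- apply: le_trans (win (j%:~R * x + J%:R)); rewrite ler_nat; apply: sub_count => i.
  by rewrite addrA.
- have [j0|jn0] := eqVneq j 0.
    rewrite (@eq_count _ _ pred0) ?count_pred0// => i /=.
    by apply/asboolP => -[]; rewrite j0.
  apply: le_trans (wrap 0 jn0); rewrite ler_nat; apply: sub_count => i /asboolP[_ [m hm]].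
  by apply/asboolP; exists m; rewrite subr0.
- have [j0|jn0] := eqVneq j 0.
    rewrite (@eq_count _ _ pred0) ?count_pred0// => i /=.
    by apply/asboolP => -[]; rewrite j0.
  apply: le_trans (wrap y jn0); rewrite ler_nat; apply: sub_count => i /asboolP[_ [m hm]].
  by apply/asboolP; exists m.
Qed.

Definition nonrobust_bound : R := (4 * (2 * H).+1)%:R * defect_bound.

Lemma count_nonrobust : c * J%:R <= b%:R ->
  (count (fun i => ~~ `[< robust i >]) (iota 0 (2 * J).+1))%:R <= nonrobust_bound.
Proof.
move=> cb.
pose ls := [seq (l, e) | l <- iota 0 (2 * H).+1, e <- iota 0 4].
pose Q (le : nat * nat) i := `[< defect (le.1%:Z - H%:Z) le.2 i >].
have hQ i : ~~ `[< robust i >] -> has (fun le => Q le i) ls.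
  move=> /asboolP /not_robust_defect[j [e [jH e4 dj]]].
  apply/hasP; exists (absz (j + H%:Z), e).
    apply/allpairsPdep; exists (absz (j + H%:Z)), e; split => //; rewrite mem_iota //.
    by clear -jH; lia.
  rewrite /Q /=; apply/asboolP.
  by have -> : (absz (j + H%:Z))%:Z - H%:Z = j by clear -jH; lia.
have := count_union_bound (iota 0 (2 * J).+1) hQ; rewrite -(ler_nat R) => /le_trans; apply.
rewrite natr_sum.
apply: (@le_trans _ _ (\sum_(le <- ls) defect_bound)).
  rewrite big_seq [leRHS]big_seq; apply: ler_sum => -[l e] /allpairsPdep[l' [e' [hl _ [-> ->]]]].
  apply: count_defect => //=; move: hl; rewrite mem_iota.
  by clear; lia.
rewrite big_const_seq count_predT iter_addr_0 size_allpairs !size_iota /nonrobust_bound [leRHS]mulr_natl.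
by rewrite mulnC.
Qed.

Definition model_len (k r : nat) : R := good_len k r (Rkr t k r w + x) (Skr t k r w + x) y.

Definition robust_model (k r i : nat) : bool := `[< robust i >] && in_model k r i.

Lemma cell_len_robust k r i : upper_row -> robust i -> (k <= h)%N -> (r <= h)%N ->
  len (good_set k r (Rkr t k r w + x) (Skr t k r w + x) y `&`
       `[x + a i / b%:R, x + a i / b%:R + b%:R^-1]) = (in_model k r i)%:R / b%:R.
Proof.
move=> ub rob kh rh; have b0R := bR0.
have cell z : `[x + a i / b%:R, x + a i / b%:R + b%:R^-1]%classic z ->
    (z \in good_set k r (Rkr t k r w + x) (Skr t k r w + x) y) = in_model k r i.
  rewrite /= in_itv /= => /andP[z1 z2].
  pose v := (z - x) * b%:R - a i.
  have -> : z = x + (a i + v) / b%:R by rewrite /v; field; rewrite gt_eqF.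
  have i1 : b%:R^-1 * b%:R = 1 :> R by rewrite mulVf ?gt_eqF.
  have z3 : a i <= (z - x) * b%:R by rewrite -ler_pdivrMr//; lra.
  have z4 : (z - x) * b%:R <= a i + 1.
    by rewrite -ler_pdivlMr// mulrDl mul1r; lra.
  by apply: model_cell => //; rewrite /v; lra.
case E : (in_model k r i).
  rewrite setIidr; last by move=> z /cell; rewrite E => /set_mem.
  rewrite mul1r /len lebesgue_measure_itv /= lte_fin ltrDl invr_gt0 b0R /=.
  by ring.
rewrite mul0r (_ : _ `&` _ = set0) ?/len ?measure0//.
by rewrite -subset0 => z [gz /cell]; rewrite E mem_set.
Qed.

Lemma good_set_window k r :
  good_set k r (Rkr t k r w + x) (Skr t k r w + x) y `<=` `[x - J%:R / b%:R, x + J%:R / b%:R].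
Proof.
have b0R := bR0; have x0 := x_gt0.
move=> z /good_set_sub; rewrite /= !in_itv /= => hz.
have : in_cell k r ((z - x) * b%:R).
  by rewrite in_cell_Rkr mulfK ?gt_eqF//; lra.
move=> /and4P[c1 _ _ c4].
have k0 : 0 <= k%:R * x by rewrite mulr_ge0// ltW.
have r0 : 0 <= r%:R * x by rewrite mulr_ge0// ltW.
have z1 : - J%:R / b%:R <= z - x by rewrite ler_pdivrMr//; lra.
have z2 : z - x <= J%:R / b%:R by rewrite ler_pdivlMr//; lra.
by move: z1; rewrite mulNr => z1; lra.
Qed.

Lemma model_len_bounds k r : 0 <= b%:R * model_len k r <= 2 * J%:R.
Proof.
have b0R := bR0; apply/andP; split; first by apply: mulr_ge0; [exact: ltW|exact: len_ge0].
rewrite mulrC -ler_pdivlMr//.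
have mi (u v : R) : measurable (`[u, v]%classic : set R) by apply: measurable_itv.
apply: (le_trans (len_le (@measurable_good_set _ _ _ _ _ _) (mi _ _) (@subset_refl _ _) (@good_set_window k r))).
apply: (le_trans (len_itvcc _ _)).
have -> : x + J%:R / b%:R - (x - J%:R / b%:R) = 2 * J%:R / b%:R by ring.
by rewrite ger0_norm// divr_ge0 ?mulr_ge0// ltW.
Qed.

Lemma model_len_cells k r :
  model_len k r = \sum_(i <- iota 0 (2 * J))
    len (good_set k r (Rkr t k r w + x) (Skr t k r w + x) y `&`
       `[x + a i / b%:R, x + a i / b%:R + b%:R^-1]).
Proof.
have b0R := bR0; have x0 := x_gt0.
rewrite /model_len /good_len (@len_cells _ (x - J%:R / b%:R) (b%:R^-1) (2 * J)).
- apply: eq_bigr => i _.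
  have -> : x - J%:R / b%:R + i%:R * b%:R^-1 = x + a i / b%:R by rewrite /abscissa; ring.
  have -> // : x - J%:R / b%:R + i.+1%:R * b%:R^-1 = x + a i / b%:R + b%:R^-1.
  by rewrite -natr1 /abscissa; ring.
- by rewrite invr_ge0 ltW.
- exact: measurable_good_set.
- apply: subset_trans (@good_set_window k r) _ => z; rewrite /= !in_itv /= natrM.
  by have -> : x - J%:R / b%:R + 2 * J%:R / b%:R = x + J%:R / b%:R by ring.
Qed.

Lemma count_sum_nat {T : Type} (P : pred T) (s : seq T) :
  (count P s)%:R = \sum_(i <- s) (P i)%:R :> R.
Proof. by elim: s => [|z s IH] /=; rewrite ?big_nil// big_cons natrD IH. Qed.

(** Both terms agree on the cell of a robust point.  The point of abscissa J begins no cell, whence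
    the additional 1. *)
Lemma model_len_count k r : upper_row -> (k <= h)%N -> (r <= h)%N -> c * J%:R <= b%:R ->
  `|b%:R * model_len k r - (count (robust_model k r) (iota 0 (2 * J).+1))%:R| <= nonrobust_bound + 1.
Proof.
move=> ub kh rh cb; have b0R := bR0.
have mi (u v : R) : measurable (`[u, v]%classic : set R) by apply: measurable_itv.
set G := good_set k r (Rkr t k r w + x) (Skr t k r w + x) y.
have mG : measurable G by apply: measurable_good_set.
have cell1 i : `|b%:R * len (G `&` `[x + a i / b%:R, x + a i / b%:R + b%:R^-1]) - (robust_model k r i)%:R|
    <= (~~ `[< robust i >])%:R.
  rewrite /robust_model; case: asboolP => [rob|_] /=.
    by rewrite cell_len_robust// mulrCA mulfV ?gt_eqF// mulr1 subrr normr0.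
  rewrite subr0 ger0_norm; last by apply: mulr_ge0; [exact: ltW|exact: len_ge0].
  rewrite mulrC -ler_pdivlMr// mul1r.
  apply: (@le_trans _ _ (len `[x + a i / b%:R, x + a i / b%:R + b%:R^-1])).
    apply: (@len_le _ (x + a i / b%:R) (x + a i / b%:R + b%:R^-1)) => //.
    exact: measurableI.
  apply: (le_trans (len_itvcc _ _)).
  by rewrite addrAC subrr add0r ger0_norm// invr_ge0 ltW.
rewrite model_len_cells -/G mulr_sumr.
have -> : iota 0 (2 * J).+1 = iota 0 (2 * J) ++ [:: (2 * J)%N] by rewrite -addn1 iotaD.
rewrite count_cat natrD count_sum_nat opprD addrA -sumrB.
apply: (le_trans (ler_normB _ _)); apply: lerD; last first.
  by rewrite /= addn0; case: robust_model; rewrite ?normr1 ?normr0.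
apply: (le_trans (ler_norm_sum _ _ _)).
apply: (@le_trans _ _ (\sum_(i <- iota 0 (2 * J)) (~~ `[< robust i >])%:R)).
  by apply: ler_sum => i _; apply: cell1.
apply: le_trans (count_nonrobust cb).
by rewrite -count_sum_nat ler_nat -[(2 * J).+1]addn1 iotaD count_cat leq_addr.
Qed.

Definition all_angles : seq R := [seq pt_angle i b' | i <- iota 0 (2 * J).+1, b' <- iota 0 J.+1].

Definition row_model_len : R :=
  b%:R * \sum_(k <- iota 0 h.+1) \sum_(r <- iota 0 h.+1) model_len k r.

Lemma row_model_len_bounds : 0 <= row_model_len <= (h.+1 * h.+1)%:R * (2 * J%:R).
Proof.
rewrite /row_model_len mulr_sumr; apply/andP; split.
  by apply: sumr_ge0 => k _; rewrite mulr_sumr; apply: sumr_ge0 => r _; case/andP: (model_len_bounds k r).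
apply: (@le_trans _ _ (\sum_(k <- iota 0 h.+1) h.+1%:R * (2 * J%:R))).
  apply: ler_sum => k _; rewrite mulr_sumr.
  apply: (@le_trans _ _ (\sum_(r <- iota 0 h.+1) (2 * J%:R))).
    by apply: ler_sum => r _; case/andP: (model_len_bounds k r).
  by rewrite big_const_seq count_predT iter_addr_0 size_iota [leRHS]mulr_natl.
by rewrite big_const_seq count_predT iter_addr_0 size_iota natrM -[leRHS]mulrA [leRHS]mulr_natl.
Qed.

Lemma row_model_count : upper_row -> c * J%:R <= b%:R ->
  `|row_model_len - \sum_(k <- iota 0 h.+1) \sum_(r <- iota 0 h.+1)
     (count (robust_model k r) (iota 0 (2 * J).+1))%:R| <= (h.+1 * h.+1)%:R * (nonrobust_bound + 1).
Proof.
move=> ub cb; rewrite /row_model_len mulr_sumr -sumrB.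
apply: (le_trans (ler_norm_sum _ _ _)).
apply: (@le_trans _ _ (\sum_(k <- iota 0 h.+1) (h.+1)%:R * (nonrobust_bound + 1))).
  rewrite big_seq [leRHS]big_seq; apply: ler_sum => k; rewrite mem_iota add0n => /andP[_ kh].
  rewrite mulr_sumr -sumrB; apply: (le_trans (ler_norm_sum _ _ _)).
  apply: (@le_trans _ _ (\sum_(r <- iota 0 h.+1) (nonrobust_bound + 1))).
    rewrite big_seq [leRHS]big_seq; apply: ler_sum => r; rewrite mem_iota add0n => /andP[_ rh].
    by apply: model_len_count.
  by rewrite big_const_seq count_predT iter_addr_0 size_iota [leRHS]mulr_natl.
by rewrite big_const_seq count_predT iter_addr_0 size_iota natrM -[leRHS]mulrA [leRHS]mulr_natl.
Qed.

Lemma gap_above_angles i : (i < (2 * J).+1)%N -> gap_above window all_angles (pt_angle i b) ->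
  forall i' b', (i' < (2 * J).+1)%N -> (b' <= J)%N ->
     ~ (pt_angle i b < pt_angle i' b' < pt_angle i b + window).
Proof.
move=> hi /hasPn hgap i' b' hi' hb' hw.
have /hgap /negP : pt_angle i' b' \in all_angles.
  by apply/allpairsPdep; exists i', b'; split=> //; rewrite mem_iota.
by apply.
Qed.

Lemma isolated_angles i : (i < (2 * J).+1)%N ->
  (forall i' b', (i' < (2 * J).+1)%N -> (b' <= J)%N ->
     pt_angle i b <= pt_angle i' b' < pt_angle i b + window -> i' = i /\ b' = b) ->
  isolated window all_angles (pt_angle i b).
Proof.
move=> hi only; rewrite /isolated.
have -> : all_angles = [seq pt_angle ib.1 ib.2 | ib <-
    [seq (i, b') | i <- iota 0 (2 * J).+1, b' <- iota 0 J.+1]] by rewrite map_allpairs.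
rewrite count_map.
set s := [seq _ | _ <- _, _ <- _].
have us : uniq s by apply: allpairs_uniq; rewrite ?iota_uniq// => -[? ?] [? ?] _ _ [-> ->].
apply: (@leq_trans (count_mem (i, b) s)); last by rewrite count_uniq_mem// leq_b1.
apply: count_sub_in => -[i' b'] /allpairsPdep[i1 [b1 [hi1 hb1 [-> ->]]]] /=.
move: hi1 hb1; rewrite !mem_iota !add0n => /andP[_ hi1] /andP[_ hb1] hw.
by have [-> ->] := only _ _ hi1 hb1 hw.
Qed.

(** A robust point followed by a gap belongs to at least one model set, by gap_in_model. *)
Lemma gap_above_row_le : upper_row -> c * J%:R <= b%:R -> (b + H <= J)%N -> (H <= b)%N ->
  (count (fun i => gap_above window all_angles (pt_angle i b)) (iota 0 (2 * J).+1))%:R <=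
  row_model_len + (h.+1 * h.+1)%:R * (nonrobust_bound + 1) + nonrobust_bound.
Proof.
move=> ub cb bH Hb.
have hrow := row_model_count ub cb; have hnr := count_nonrobust cb.
move: hrow hnr; set S := \sum_(_ <- _) _; set Nr := count _ _ => hrow hnr.
suff : (count (fun i => gap_above window all_angles (pt_angle i b)) (iota 0 (2 * J).+1))%:R <= S + Nr%:R.
  by move: hrow; rewrite ler_norml; lra.
rewrite /S /Nr; set i1 := iota 0 h.+1; set i2 := iota 0 (2 * J).+1.
under eq_bigr do under eq_bigr do rewrite count_sum_nat.
rewrite !count_sum_nat.
under eq_bigr do rewrite exchange_big /=.
rewrite exchange_big /= -big_split /= big_seq [leRHS]big_seq; apply: ler_sum => i.
rewrite mem_iota add0n => /andP[_ hi].
case: asboolP => [rob|_] /=; last first.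
  rewrite ler_wpDl ?ler1n ?lern1//; last by case: gap_above.
  by rewrite sumr_ge0// => k _; rewrite sumr_ge0.
rewrite addr0; case: (boolP (gap_above _ _ _)) => [hgap|_]; last first.
  by rewrite sumr_ge0// => k _; rewrite sumr_ge0.
have [k [r [kh rh hm]]] := gap_in_model ub bH Hb rob hi (gap_above_angles hi hgap).
have k1 : k \in i1 by rewrite mem_iota.
have r1 : r \in i1 by rewrite mem_iota.
rewrite (bigD1_seq k) ?iota_uniq//= (bigD1_seq r) ?iota_uniq//=.
rewrite /robust_model hm asboolT//= -addrA ler_wpDr// addr_ge0// sumr_ge0// => k' _.
by rewrite sumr_ge0.
Qed.

(** A robust point belongs to at most one model set, and is then isolated by in_model_isolated. *)
Lemma isolated_row_ge : upper_row -> c * J%:R <= b%:R ->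
  row_model_len - (h.+1 * h.+1)%:R * (nonrobust_bound + 1) <=
  (count (fun i => isolated window all_angles (pt_angle i b)) (iota 0 (2 * J).+1))%:R.
Proof.
move=> ub cb.
have hrow := row_model_count ub cb.
move: hrow; set S := \sum_(_ <- _) _ => hrow.
suff : S <= (count (fun i => isolated window all_angles (pt_angle i b)) (iota 0 (2 * J).+1))%:R.
  by move: hrow; rewrite ler_norml; lra.
rewrite /S; set i1 := iota 0 h.+1; set i2 := iota 0 (2 * J).+1.
under eq_bigr do under eq_bigr do rewrite count_sum_nat.
rewrite count_sum_nat.
under eq_bigr do rewrite exchange_big /=.
rewrite exchange_big /= big_seq [leRHS]big_seq; apply: ler_sum => i.
rewrite mem_iota add0n => /andP[_ hi].
have [[k0 [r0 [kh0 rh0 hm0]]]|none] := pselect (exists k r, [/\ (k <= h)%N, (r <= h)%N & robust_model k r i]).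
  have /andP[/asboolP rob hm] := hm0.
  have -> : isolated window all_angles (pt_angle i b).
    apply: isolated_angles => // i' b' hi' hb' hw.
    exact: in_model_isolated ub rob kh0 rh0 hi hi' hb' hm hw.
  have /andP[hc0 _] := hm; have C0 : 0 <= C by have := C_ge2; lra.
  have k1 : k0 \in i1 by rewrite mem_iota.
  have r1 : r0 \in i1 by rewrite mem_iota.
  rewrite (bigD1_seq k0) ?iota_uniq//= (bigD1_seq r0) ?iota_uniq//=.
  have sr : \sum_(r <- i1 | r != r0) (robust_model k0 r i)%:R = 0 :> R.
    rewrite big_seq_cond big1// => r /andP[]; rewrite mem_iota add0n => /andP[_ rh] rn.
    case: (boolP (robust_model k0 r i)) => // /andP[_ /andP[hc _]].
    by have [_ er] := in_cell_unique C0 rob kh0 rh kh0 rh0 hc hc0; rewrite er eqxx in rn.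
  have sk : \sum_(k <- i1 | k != k0) \sum_(r <- i1) (robust_model k r i)%:R = 0 :> R.
    rewrite big_seq_cond big1// => k /andP[]; rewrite mem_iota add0n => /andP[_ kh] kn.
    rewrite big_seq big1// => r; rewrite mem_iota add0n => /andP[_ rh].
    case: (boolP (robust_model k r i)) => // /andP[_ /andP[hc _]].
    by have [ek _] := in_cell_unique C0 rob kh rh kh0 rh0 hc hc0; rewrite ek eqxx in kn.
  by rewrite hm0 sr sk !addr0.
rewrite big_seq big1// => k; rewrite mem_iota add0n => /andP[_ kh].
rewrite big_seq big1// => r; rewrite mem_iota add0n => /andP[_ rh].
case: (boolP (robust_model k r i)) => // hm; exfalso; apply: none.
by exists k, r.
Qed.

(** The possible exception is the leftmost point of the row. *)
Lemma gap_above_low_row : b%:R < c * J%:R - C ->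
  (count (fun i => gap_above window all_angles (pt_angle i b)) (iota 0 (2 * J).+1) <= 1)%N.
Proof.
move=> low; rewrite -[(2 * J).+1]add1n iotaD count_cat /= addn0 -[X in (_ <= X)%N]addn0.
apply: leq_add; first by case: gap_above.
rewrite leqn0; apply/eqP; rewrite -[RHS](count_pred0 (iota (0 + 1) (2 * J))).
apply: eq_in_count => i; rewrite mem_iota => /andP[i0 hi].
apply/negbTE/negP => hgap.
have hi' : (i < (2 * J).+1)%N by move: hi; rewrite add0n add1n.
have [i' [b' [h1 h2 h3]]] := low_row_no_gap low i0 hi'.
exact: gap_above_angles hi' hgap _ _ h1 h2 h3.
Qed.

End Rows.

(** * The number of gaps *)

Definition num_gaps {R : realType} (t lambda : R) (J : nat) : nat :=
  count (fun j => lambda * average_gap t J <= alpha t J j.+1 - alpha t J j)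
    (iota 1 (npoints J).-1).

Lemma lattice_angles {R : realType} (t : R) (J : nat) : (0 < J)%N -> 2 <= t * J%:R ->
  [seq angle P (viewpoint t J) (origin R) | P <- lattice_rect R J] = all_angles t J.
Proof.
move=> J0 T2; have D2 := D_ge J0 T2; have J0R : 0 < J%:R :> R by rewrite ltr0n.
rewrite /lattice_rect map_allpairs /all_angles.
apply/eq_in_allpairs => i b; rewrite !mem_iota add0n => /andP[_ hi] _.
rewrite /viewpoint /origin angle_atan//; first lra.
exact: (pt_den_gt0 J0 T2 hi).
Qed.

Lemma all_angles_max {R : realType} (t : R) (J : nat) : (0 < J)%N -> 2 <= t * J%:R ->
  let m := atan (J%:R / (t * J%:R ^+ 2 - J%:R)) in
  m \in all_angles t J /\ {in all_angles t J, forall v, v <= m}.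
Proof.
move=> J0 T2 m; have D2 := D_ge J0 T2; have J0R : 0 < J%:R :> R by rewrite ltr0n.
split.
  apply/allpairsPdep; exists 0%N, J; split.
  - by rewrite mem_iota.
  - by rewrite mem_iota add0n ltnSn.
  - by rewrite /m /pt_angle /abscissa sub0r.
move=> v /allpairsPdep[i [b [hi hb ->]]].
move: hi hb; rewrite !mem_iota !add0n => /andP[_ hi] /andP[_ hb].
have /andP[ai1 ai2] : - J%:R <= abscissa R J i <= J%:R := @a_bounds _ _ _ hi.
apply: le_atan; apply: ler_pM => //.
- by rewrite invr_ge0; lra.
- by rewrite ler_nat -ltnS.
- by rewrite lef_pV2 ?posrE; lra.
Qed.

Lemma size_all_angles {R : realType} (t : R) (J : nat) : size (all_angles t J) = npoints J.
Proof. by rewrite size_allpairs !size_iota /npoints !addn1. Qed.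

Lemma sorted_anglesE {R : realType} (t : R) (J : nat) : (0 < J)%N -> 2 <= t * J%:R ->
  sorted_angles t J = sort <=%R (all_angles t J).
Proof. by move=> J0 T2; rewrite /sorted_angles lattice_angles. Qed.

Lemma npointsE {R : realType} (J : nat) : (npoints J)%:R = (2 * J%:R + 1) * (J%:R + 1) :> R.
Proof. by rewrite /npoints; ring. Qed.

Lemma window_average_gap {R : realType} (t lambda : R) (J : nat) : (0 < J)%N -> 2 <= t * J%:R ->
  lambda * average_gap t J = window t lambda J.
Proof.
move=> J0 T2; have [mL Lm] := all_angles_max J0 T2.
rewrite /average_gap /window; rewrite npointsE; congr (_ * (_ / _)).
rewrite /alpha_max /alpha sorted_anglesE//.
set m := atan _ in mL Lm *; set s := sort _ _.
have ss : sorted <=%R s by apply: sort_sorted; apply: le_total.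
have sz : size s = npoints J by rewrite size_sort size_all_angles.
have N0 : (0 < npoints J)%N by rewrite /npoints muln_gt0 !addn1.
apply/eqP; rewrite eq_le; apply/andP; split.
  by apply: Lm; rewrite -(mem_sort <=%R) mem_nth// sz prednK.
have ms : m \in s by rewrite mem_sort.
rewrite -(nth_index 0 ms); apply: sorted_nth_le => //; last by rewrite sz prednK.
by rewrite -ltnS prednK// -sz index_mem.
Qed.

Lemma num_gaps_bounds {R : realType} (t lambda : R) (J : nat) :
  0 < t -> 0 < lambda -> (0 < J)%N -> 2 <= t * J%:R ->
  let L := all_angles t J in let d := window t lambda J in
  (count (isolated d L) L <= (num_gaps t lambda J).+1)%N /\
  (num_gaps t lambda J <= count (gap_above d L) L)%N.
Proof.
move=> t0 l0 J0 T2 L d.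
pose s := sort <=%R L.
have ss : sorted <=%R s by apply: sort_sorted; apply: le_total.
have ps : perm_eq s L by rewrite perm_sort.
have sz : size s = npoints J by rewrite size_sort size_all_angles.
have D2 := D_ge J0 T2; have J0R : 0 < J%:R :> R by rewrite ltr0n.
have d0 : 0 < d.
  apply: mulr_gt0 => //; apply: divr_gt0; last by apply: mulr_gt0; lra.
  by rewrite -[X in X < _](@atan0 R); apply: lt_atan; apply: divr_gt0 => //; lra.
have -> : num_gaps t lambda J =
    count (fun j => d <= nth 0 s j.+1 - nth 0 s j) (iota 0 (size s).-1).
  rewrite /num_gaps sz -(addn0 1%N) iotaDl count_map.
  apply: eq_count => j; rewrite /= add1n /alpha /= sorted_anglesE//.
  by rewrite (window_average_gap _ J0 T2).
have iso : isolated d s =1 isolated d L.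
  by move=> v; rewrite /isolated (permP ps).
have gap : gap_above d s =1 gap_above d L.
  by move=> v; rewrite /gap_above (perm_has _ ps).
rewrite -(eq_count iso) -(eq_count gap) -!(permP ps); split.
  exact: count_isolated_le.
exact: count_gap_above_ge.
Qed.

Lemma count_all_angles {R : realType} (t : R) (J : nat) (P : pred R) :
  (count P (all_angles t J))%:R =
  \sum_(b <- iota 0 J.+1) (count (fun i => P (pt_angle t J i b)) (iota 0 (2 * J).+1))%:R :> R.
Proof.
rewrite count_sum_nat big_allpairs_dep exchange_big.
by apply: eq_bigr => b _; rewrite count_sum_nat.
Qed.

(** The rows near the edges of the rectangle or near the height at which y = 1.  They are boundedly
    many, so that their O(J) points may be ignored. *)
Definition special_row {R : realType} (c C : R) (J h b : nat) : bool :=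
  [|| (b <= h)%N, (J < b + h.+1)%N | `|b%:R - c * J%:R| <= C].

Lemma count_special_rows {R : realType} (c C : R) (J h : nat) : 0 <= C ->
  (count (special_row c C J h) (iota 0 J.+1))%:R <= h.+1%:R + h.+2%:R + (2 * C + 1) :> R.
Proof.
move=> C0.
pose Q (l b : nat) := match l with
  | 0 => (b <= h)%N | 1 => (J < b + h.+1)%N && (b <= J)%N | _ => `|b%:R - c * J%:R| <= C end.
have -> : count (special_row c C J h) (iota 0 J.+1) =
  count (fun b => special_row c C J h b && (b <= J)%N) (iota 0 J.+1).
  by apply: eq_in_count => b; rewrite mem_iota add0n ltnS => /andP[_ ->]; rewrite andbT.
have hQ b : special_row c C J h b && (b <= J)%N -> has (fun l => Q l b) [:: 0%N; 1%N; 2%N].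
  by move=> /andP[/or3P[hb|hb|hb] bJ] /=; rewrite hb ?bJ ?orbT.
have := count_union_bound (iota 0 J.+1) hQ.
have q0 : (count (Q 0%N) (iota 0 J.+1))%:R <= h.+1%:R :> R.
  by rewrite ler_nat; apply: count_diam => i j ij; rewrite /Q => ih jh; clear -ij ih jh; lia.
have q1 : (count (Q 1%N) (iota 0 J.+1))%:R <= h.+2%:R :> R.
  rewrite ler_nat; apply: count_diam => i j ij /andP[i1 i2] /andP[j1 j2].
  by clear -ij i1 j2; lia.
have q2 : (count (Q 2%N) (iota 0 J.+1))%:R <= 2 * C + 1.
  have := @count_affine_window _ (fun b => `|b%:R - c * J%:R| <= C) 0 J.+1 1 (- (c * J%:R)) C ltr01 C0.
  by rewrite divr1; apply => i; rewrite mul1r.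
rewrite !big_cons big_nil addn0 -(ler_nat R).
have key (n n0 n1 n2 : nat) (x0 x1 x2 : R) : n0%:R <= x0 -> n1%:R <= x1 -> n2%:R <= x2 ->
    n%:R <= (n0 + (n1 + n2))%:R :> R -> n%:R <= x0 + x1 + x2.
  by rewrite !natrD; lra.
exact: key q0 q1 q2.
Qed.

Lemma ler_sum_except {R : realType} (P : pred nat) (s : seq nat) (B e : R) (f g : nat -> R) :
  0 <= e -> 0 <= B ->
  (forall b, b \in s -> P b -> f b <= g b + B) ->
  (forall b, b \in s -> ~~ P b -> f b <= g b + e) ->
  \sum_(b <- s) f b <= \sum_(b <- s) g b + (count P s)%:R * B + (size s)%:R * e.
Proof.
move=> e0 B0; elim: s => [|b s IH] hP hN; first by rewrite !big_nil !mul0r !addr0.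
rewrite !big_cons [count _ _]/= [size _]/= -natr1 natrD.
have sub b' : b' \in s -> b' \in b :: s by rewrite inE orbC => ->.
have IH' := IH (fun b' bs => hP b' (sub b' bs)) (fun b' bs => hN b' (sub b' bs)).
have bb : b \in b :: s by rewrite inE eqxx.
have [Pb|nPb] := boolP (P b).
  by have := hP b bb Pb; rewrite (_ : true%:R = 1 :> R)//; lra.
by have := hN b bb nPb; rewrite (_ : false%:R = 0 :> R)//; lra.
Qed.

(** Up to 1, the number of gaps lies between the counts of isolated points and of points with a gap
    above.  In each row that is not special, both counts are within O(1) of the model. *)
Lemma num_gaps_model {R : realType} (t lambda : R) : 0 < t -> 0 < lambda ->
  exists K : R, exists J1 : nat, forall J : nat, (J1 <= J)%N ->
  `|(num_gaps t lambda J)%:R - \sum_(0 <= b < J.+1 | lambda * t / 2 * J%:R <= b%:R)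
      row_model_len t lambda J b (hmax t)| <= K * J%:R.
Proof.
move=> t0 l0.
set h := hmax t; set c := lambda * t / 2.
have c0 : 0 < c by rewrite divr_gt0// mulr_gt0.
have hh : 2 / t < h.+1%:R by rewrite /h /hmax truncnS_gt.
pose kappa := 18 / t + 2.
have k0 : 0 < kappa by rewrite addr_gt0// divr_gt0.
(* C dominates all the constants that the estimates of a single row ask for. *)
pose C := h.+1%:R / c + 2 + c * kappa + kappa.
have hc0 : 0 <= h.+1%:R / c by rewrite divr_ge0// ltW.
have ck0 : 0 < c * kappa by rewrite mulr_gt0.
have C_H : h.+1%:R / c + 2 <= C by rewrite /C; lra.
have C_kappa : c * kappa <= C by rewrite /C; lra.
have C_k : kappa <= C by rewrite /C; lra.
have C_hc : h.+1%:R / c <= C by rewrite /C; lra.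
have C0 : 0 <= C by lra.
pose E : R := (h.+1 * h.+1)%:R * (nonrobust_bound h C + 1) + nonrobust_bound h C + 1.
have nb0 : 0 <= nonrobust_bound h C.
  by rewrite /nonrobust_bound /defect_bound mulr_ge0// mulr_ge0//; lra.
have E0 : 0 <= E by rewrite /E addr_ge0// addr_ge0// mulr_ge0//; lra.
pose n0 : R := h.+1%:R + h.+2%:R + (2 * C + 1).
have n00 : 0 <= n0 by rewrite /n0 addr_ge0// ?addr_ge0//; lra.
pose M : R := (h.+1 * h.+1)%:R * 2 + 3.
have M0 : 0 <= M by rewrite /M addr_ge0// mulr_ge0.
exists (n0 * M + 2 * E + 1).
have [J1 [J10 hJ1]] := div_nat_small (2 / t) ltr01.
have [J2 [J20 hJ2]] := div_nat_small ((h%:R + 3) / t) ltr01.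
exists (maxn J1 J2) => J; rewrite geq_max => /andP[/[dup] JJ1 /hJ1 T2 /hJ2 Tbig].
have J0 : (0 < J)%N by apply: leq_trans JJ1.
have JR : 0 < J%:R :> R by rewrite ltr0n.
have J1R : 1 <= J%:R :> R by rewrite ler1n.
have {}T2 : 2 <= t * J%:R by move: T2; rewrite ler_pdivrMr// mul1r ler_pdivrMr// mulrC.
have {}Tbig : h%:R + 3 <= t * J%:R by move: Tbig; rewrite ler_pdivrMr// mul1r ler_pdivrMr// mulrC.
pose rho := C / J%:R.
have rho_kappa : kappa / J%:R <= rho by rewrite ler_pM2r ?invr_gt0.
have rho_H : h.+1%:R / (c * J%:R) <= rho.
  by rewrite invfM mulrA ler_pM2r ?invr_gt0.
have rhoJ : rho * J%:R <= C by rewrite /rho mulfVK ?gt_eqF.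
pose sp := special_row c C J h.
pose V b := if c * J%:R <= b%:R then row_model_len t lambda J b h else 0.
pose gA b : R := (count (fun i => gap_above (window t lambda J) (all_angles t J) (pt_angle t J i b)) (iota 0 (2 * J).+1))%:R.
pose iA b : R := (count (fun i => isolated (window t lambda J) (all_angles t J) (pt_angle t J i b)) (iota 0 (2 * J).+1))%:R.
have Vb b : 0 <= V b <= (h.+1 * h.+1)%:R * (2 * J%:R).
  rewrite /V; case: ifP => hb; last by rewrite lexx mulr_ge0// mulr_ge0.
  apply: row_model_len_bounds => //; rewrite -(ltr_nat R).
  by apply: lt_le_trans hb; rewrite mulr_gt0.
have cntJ (P : pred nat) : (count P (iota 0 (2 * J).+1))%:R <= 3 * J%:R :> R.
  apply: (@le_trans _ _ (2 * J).+1%:R); first by rewrite ler_nat -{2}(size_iota 0 (2 * J).+1) count_size.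
  by rewrite -natr1 natrM; lra.
have MJ : (h.+1 * h.+1)%:R * (2 * J%:R) + 3 * J%:R = M * J%:R by rewrite /M; ring.
have up b : b \in iota 0 J.+1 -> ~~ sp b -> (0 < b)%N /\ (b <= J)%N /\
    ((b%:R < c * J%:R - C) \/ [/\ upper_row t lambda J b C, c * J%:R <= b%:R, (b + h.+1 <= J)%N & (h < b)%N]).
  rewrite mem_iota add0n ltnS => /andP[_ bJ]; rewrite /sp /special_row !negb_or -!ltnNge ltnS -ltNge.
  move=> /and3P[hb bH far]; split; first exact: leq_ltn_trans hb.
  split=> //; move: far; rewrite ltr_normr => /orP[far|far]; last by left; lra.
  by right; rewrite /upper_row; split=> //; rewrite -/c; lra.
have h1 : \sum_(b <- iota 0 J.+1) gA b <=
    \sum_(b <- iota 0 J.+1) V b + (count sp (iota 0 J.+1))%:R * (M * J%:R) + (size (iota 0 J.+1))%:R * E.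
  apply: ler_sum_except => //; first by rewrite mulr_ge0.
    move=> b _ _; have /andP[v1 v2] := Vb b; have := cntJ (fun i => gap_above (window t lambda J) (all_angles t J) (pt_angle t J i b)).
    by rewrite -/(gA b) -MJ; have := cntJ predT; lra.
  move=> b hb /(up b hb)[b0 [bJ [low|[ub cb bH hb']]]].
    have : gA b <= 1 by rewrite /gA lern1; apply: gap_above_low_row t0 l0 J0 T2 b0 bJ C_kappa low.
    have /andP[v1 _] := Vb b; move=> g1.
    have : 1 <= E by rewrite /E lerDr addr_ge0// mulr_ge0//; lra.
    by lra.
  rewrite /V cb.
  have := gap_above_row_le t0 l0 hh J0 T2 b0 bJ rho_kappa rho_H C_H C_kappa rhoJ ub cb bH hb'.
  by rewrite -/(gA b) /E; lra.
have h2 : \sum_(b <- iota 0 J.+1) V b <=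
    \sum_(b <- iota 0 J.+1) iA b + (count sp (iota 0 J.+1))%:R * (M * J%:R) + (size (iota 0 J.+1))%:R * E.
  apply: ler_sum_except => //; first by rewrite mulr_ge0.
    move=> b _ _; have /andP[v1 v2] := Vb b.
    have i0 : 0 <= iA b by [].
    by rewrite -MJ; lra.
  move=> b hb /(up b hb)[b0 [bJ [low|[ub cb bH hb']]]].
    rewrite /V ifF; last by apply/negbTE; rewrite -ltNge; lra.
    by rewrite addr_ge0.
  rewrite /V cb.
  have := isolated_row_ge t0 l0 hh J0 T2 Tbig b0 bJ rho_kappa rho_H C_H C_kappa rhoJ ub cb.
  by rewrite -/(iA b) /E; lra.
have [n1 n2] := num_gaps_bounds t0 l0 J0 T2.
have n3 : (num_gaps t lambda J)%:R <= \sum_(b <- iota 0 J.+1) gA b.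
  by rewrite -count_all_angles ler_nat.
have n4 : \sum_(b <- iota 0 J.+1) iA b <= (num_gaps t lambda J)%:R + 1.
  by rewrite -count_all_angles natr1 ler_nat.
have -> : \sum_(0 <= b < J.+1 | lambda * t / 2 * J%:R <= b%:R) row_model_len t lambda J b h =
   \sum_(b <- iota 0 J.+1) V b.
  by rewrite big_mkcond /index_iota subn0.
have nsp : (count sp (iota 0 J.+1))%:R * (M * J%:R) <= n0 * M * J%:R.
  rewrite -mulrA; apply: ler_wpM2r; first by rewrite mulr_ge0.
  exact: count_special_rows.
have nE : (size (iota 0 J.+1))%:R * E <= 2 * E * J%:R.
  rewrite size_iota -natr1 mulrDl mul1r; have : E <= E * J%:R by rewrite ler_peMr.
  by lra.
have -> : (n0 * M + 2 * E + 1) * J%:R = n0 * M * J%:R + 2 * E * J%:R + J%:R by ring.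
by rewrite ler_norml; lra.
Qed.

(** * Regularity of the density *)

(** Heights are restricted to [c, 1], away from the pole at w = 0 of the end points R_{k,r,w} and
    S_{k,r,w}. *)
Definition lip_on {R : realType} (c L : R) (f : R -> R) : Prop :=
  forall w w', c <= w <= 1 -> c <= w' <= 1 -> `|f w - f w'| <= L * `|w - w'|.

Lemma lip_on_inv {R : realType} (c : R) : 0 < c -> lip_on c (c ^- 2) (fun w => w^-1).
Proof.
move=> c0 w w' /andP[cw _] /andP[cw' _].
have w0 : 0 < w by lra.
have w'0 : 0 < w' by lra.
have -> : w^-1 - w'^-1 = (w' - w) * (w * w')^-1 by field; rewrite !gt_eqF.
rewrite normrM distrC mulrC; apply: ler_wpM2r => //.
rewrite gtr0_norm ?invr_gt0 ?mulr_gt0// lef_pV2 ?posrE ?mulr_gt0//.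
by rewrite expr2; apply: ler_pM => //; apply: ltW.
Qed.

Lemma lip_on_scale {R : realType} (c L a : R) (f : R -> R) :
  lip_on c L f -> lip_on c (`|a| * L) (fun w => a * f w).
Proof.
by move=> fL w w' hw hw'; rewrite -mulrBr normrM -mulrA ler_wpM2l// fL.
Qed.

Lemma lip_on_add {R : realType} (c L M : R) (f g : R -> R) :
  lip_on c L f -> lip_on c M g -> lip_on c (L + M) (fun w => f w + g w).
Proof.
move=> fL gM w w' hw hw'; rewrite (_ : _ - _ = (f w - f w') + (g w - g w')); last by ring.
by rewrite mulrDl (le_trans (ler_normD _ _))// lerD ?fL ?gM.
Qed.

Lemma lip_on_max {R : realType} (c L M : R) (f g : R -> R) :
  lip_on c L f -> lip_on c M g -> lip_on c (L + M) (fun w => Num.max (f w) (g w)).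
Proof.
move=> fL gM w w' hw hw'; have := fL w w' hw hw'; have := gM w w' hw hw'.
rewrite mulrDl !ler_norml.
move: (L * _) (M * _) (f w) (f w') (g w) (g w') => A B f1 f2 g1 g2 /andP[h1 h2] /andP[h3 h4].
have := Order.TotalTheory.leP f1 g1; have := Order.TotalTheory.leP f2 g2.
by case=> ? []; lra.
Qed.

Lemma lip_on_min {R : realType} (c L M : R) (f g : R -> R) :
  lip_on c L f -> lip_on c M g -> lip_on c (L + M) (fun w => Num.min (f w) (g w)).
Proof.
move=> fL gM w w' hw hw'; have := fL w w' hw hw'; have := gM w w' hw hw'.
rewrite mulrDl !ler_norml.
move: (L * _) (M * _) (f w) (f w') (g w) (g w') => A B f1 f2 g1 g2 /andP[h1 h2] /andP[h3 h4].
have := Order.TotalTheory.leP f1 g1; have := Order.TotalTheory.leP f2 g2.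
by case=> ? []; lra.
Qed.

Lemma lip_on_invsq {R : realType} (c : R) : 0 < c -> lip_on c (2 / c ^+ 3) (fun w => w ^- 2).
Proof.
move=> c0 w w' hw hw'; have := lip_on_inv c0 hw hw'.
move: hw hw' => /andP[cw _] /andP[cw' _].
have w0 : 0 < w by lra.
have w'0 : 0 < w' by lra.
have -> : w ^- 2 - w' ^- 2 = (w^-1 - w'^-1) * (w^-1 + w'^-1) by field; rewrite !gt_eqF.
have s0 : 0 < w^-1 + w'^-1 by rewrite addr_gt0 ?invr_gt0.
have s2 : w^-1 + w'^-1 <= 2 / c.
  have h1 : w^-1 <= c^-1 by rewrite lef_pV2 ?posrE.
  have h2 : w'^-1 <= c^-1 by rewrite lef_pV2 ?posrE.
  by lra.
rewrite normrM (gtr0_norm s0) => h.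
have -> : 2 / c ^+ 3 * `|w - w'| = (c ^- 2 * `|w - w'|) * (2 / c) by field; rewrite gt_eqF.
by apply: ler_pM => //; apply: ltW.
Qed.

Lemma lip_on_ext {R : realType} (c L : R) (f g : R -> R) : f =1 g -> lip_on c L f -> lip_on c L g.
Proof. by move=> fg fL w w' hw hw'; rewrite -!fg; apply: fL. Qed.

Lemma lip_on_quadratic_inv {R : realType} (c a b : R) : 0 < c ->
  exists L, lip_on c L (fun w => a / w ^+ 2 + b / w).
Proof.
move=> c0; exists (`|a| * (2 / c ^+ 3) + `|b| * c ^- 2).
by apply: lip_on_add; apply: lip_on_scale; [exact: lip_on_invsq|exact: lip_on_inv].
Qed.

Lemma lip_on_Rkr {R : realType} (c t : R) (k r : nat) : 0 < c -> exists L, lip_on c L (Rkr t k r).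
Proof.
move=> c0.
have [L hL] := lip_on_quadratic_inv (k%:R * t) (-1) c0.
have [M hM] := lip_on_quadratic_inv (- (r.+1%:R * t)) 1 c0.
exists (L + M); apply: lip_on_ext (lip_on_max hL hM) => w.
by rewrite /Rkr mulN1r div1r mulNr (addrC (- _)).
Qed.

Lemma lip_on_Skr {R : realType} (c t : R) (k r : nat) : 0 < c -> exists L, lip_on c L (Skr t k r).
Proof.
move=> c0.
have [L hL] := lip_on_quadratic_inv (k.+1%:R * t) (-1) c0.
have [M hM] := lip_on_quadratic_inv (- (r%:R * t)) 1 c0.
exists (L + M); apply: lip_on_ext (lip_on_min hL hM) => w.
by rewrite /Skr mulN1r div1r mulNr (addrC (- _)).
Qed.

Lemma lip_on_yw {R : realType} (c t lambda : R) : 0 < c -> exists L, lip_on c L (yw t lambda).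
Proof.
move=> c0; exists (`|lambda * t / 2| * c ^- 2).
apply: lip_on_ext (lip_on_scale _ (lip_on_inv c0)) => w.
by rewrite /yw invfM mulrA.
Qed.

Lemma good_len_le_itv {R : realType} (k r : nat) (p q y : R) : good_len k r p q y <= Num.max 0 (q - p).
Proof.
have := @len_le R p q _ _ (measurable_good_set k r p q y) (measurable_itv `[p, q]) (fun _ => id)
  (@good_set_sub _ k r p q y).
move=> h; apply: (le_trans h).
rewrite /len lebesgue_measure_itv /= lte_fin; case: ifP => _ /=; rewrite le_max ?lexx ?orbT//.
Qed.

(** The integrand w mu(A_{k,r,w}(x)) of the limit formula. *)
Definition density {R : realType} (t lambda : R) (k r : nat) (w x : R) : R :=
  w * good_len k r (Rkr t k r w + x) (Skr t k r w + x) (yw t lambda w).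

(** The projection onto [c, 1], used to extend the density to a function that is Lipschitz for all
    heights. *)
Definition clamp {R : realType} (c w : R) : R := Num.max c (Num.min w 1).

Lemma clamp_in {R : realType} (c w : R) : c <= 1 -> c <= clamp c w <= 1.
Proof.
move=> c1; rewrite /clamp le_max lexx ge_max c1 /=; by rewrite ge_min lexx orbT.
Qed.

Lemma clamp_id {R : realType} (c w : R) : c <= w <= 1 -> clamp c w = w.
Proof. by case/andP=> cw w1; rewrite /clamp (min_idPl w1); apply/max_idPr. Qed.

Lemma clamp_lip {R : realType} (c w w' : R) : `|clamp c w - clamp c w'| <= `|w - w'|.
Proof.
suff key (n : R) : w - w' <= n -> w' - w <= n -> - n <= clamp c w - clamp c w' <= n.
  by rewrite ler_norml; apply: key; [|rewrite distrC]; exact: ler_norm.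
move=> h1 h2; rewrite /clamp.
by case: (leP w 1) => ?; case: (leP w' 1) => ?; case: (leP c _) => ?; try case: (leP c _) => ?; lra.
Qed.

(** The end points and the threshold are Lipschitz in w, and the length of a good set is Lipschitz
    in these. *)
Lemma density_lip {R : realType} (t lambda c : R) (k r : nat) : 0 < c -> c <= 1 ->
  exists K, forall w w' x x',
    `|density t lambda k r (clamp c w) x - density t lambda k r (clamp c w') x'| <=
      K * (`|w - w'| + `|x - x'|).
Proof.
move=> c0 c1.
have [LR hR] := lip_on_Rkr t k r c0.
have [LS hS] := lip_on_Skr t k r c0.
have [Ly hy] := lip_on_yw t lambda c0.
pose L : R := `|LR| + `|LS| + `|Ly|.
have one : c <= (1 : R) <= 1 by rewrite c1 lexx.
pose d : R := `|Skr t k r 1 - Rkr t k r 1| + 2 * L.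
have bnd w : c <= w <= 1 -> `|Skr t k r w - Rkr t k r w| <= d.
  move=> hw; have h1 := hR w 1 hw one; have h2 := hS w 1 hw one.
  have w1 : `|w - 1| <= 1 by rewrite ler_norml; lra.
  have h1' : LR * `|w - 1| <= L.
    apply: (@le_trans _ _ (`|LR| * 1)); last by rewrite /L; have := normr_ge0 LS; have := normr_ge0 Ly; lra.
    apply: (@le_trans _ _ (`|LR| * `|w - 1|)); first by apply: ler_wpM2r => //; exact: ler_norm.
    exact: ler_wpM2l.
  have h2' : LS * `|w - 1| <= L.
    apply: (@le_trans _ _ (`|LS| * 1)); last by rewrite /L; have := normr_ge0 LR; have := normr_ge0 Ly; lra.
    apply: (@le_trans _ _ (`|LS| * `|w - 1|)); first by apply: ler_wpM2r => //; exact: ler_norm.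
    exact: ler_wpM2l.
  have h3 := ler_norm (Skr t k r 1 - Rkr t k r 1).
  have h4 := ler_norm (- (Skr t k r 1 - Rkr t k r 1)).
  move: h4; rewrite normrN => h4.
  move: (le_trans h1 h1') (le_trans h2 h2') h3 h4.
  rewrite /d !ler_norml; move: `|_ - _| => n; clear; lra.
have d0 : 0 <= d by apply: le_trans (bnd 1 one).
pose B : R := (k + r).+1%:R * ((k + r)%:R * d + 2).
have B0 : 0 <= B by rewrite /B mulr_ge0// addr_ge0// mulr_ge0.
pose K : R := d + 2 + L + B * L.
have L0 : 0 <= L by rewrite /L !addr_ge0.
have BL0 : 0 <= B * L by rewrite mulr_ge0.
exists K => w0 w0' x x'.
have := clamp_lip c w0 w0'; have := clamp_in w0 c1; have := clamp_in w0' c1.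
move: (clamp c w0) (clamp c w0') => w w' hw' hw ww.
rewrite /density; set g := good_len _ _ _ _ _; set g' := good_len _ _ _ _ _.
have g0 : 0 <= g <= d.
  rewrite len_ge0/=; apply: le_trans (good_len_le_itv _ _ _ _ _) _.
  rewrite ge_max d0/=; apply: le_trans (ler_norm _) _.
  by rewrite (_ : _ + x - _ = Skr t k r w - Rkr t k r w); [exact: bnd|ring].
have sh (S T y : R) : S + y - (T + y) = S - T by ring.
have gg : `|g - g'| <= (LR * `|w - w'| + `|x - x'|) + (LS * `|w - w'| + `|x - x'|) + B * (Ly * `|w - w'|).
  apply: le_trans (good_len_lipschitz _ _ _ _ _ _) _; first by rewrite sh; exact: bnd.
    by rewrite sh; exact: bnd.
  have tri (f : R -> R) M : lip_on c M f -> `|f w + x - (f w' + x')| <= M * `|w - w'| + `|x - x'|.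
    move=> hf; rewrite (_ : _ - _ = (f w - f w') + (x - x')); last by ring.
    by rewrite (le_trans (ler_normD _ _))// lerD2r hf.
  apply: lerD; first by apply: lerD; apply: tri.
  by rewrite mulrA -/B; apply: ler_wpM2l => //; apply: hy.
have -> : w * g - w' * g' = (w - w') * g + w' * (g - g') by ring.
apply: le_trans (ler_normD _ _) _.
have e1 : `|(w - w') * g| <= d * `|w0 - w0'|.
  by rewrite normrM mulrC; apply: ler_pM => //; rewrite ger0_norm//; case/andP: g0.
have w'1 : `|w'| <= 1 by rewrite ler_norml; lra.
have e2 : `|w' * (g - g')| <= `|g - g'| by rewrite normrM ler_piMl.
have abs M : M * `|w - w'| <= `|M| * `|w0 - w0'|.
  apply: (@le_trans _ _ (`|M| * `|w - w'|)); first by apply: ler_wpM2r => //; exact: ler_norm.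
  exact: ler_wpM2l.
have aR := abs LR; have aS := abs LS; have ay := abs Ly.
have aB : B * (Ly * `|w - w'|) <= B * L * `|w0 - w0'|.
  rewrite -mulrA; apply: ler_wpM2l => //; apply: (le_trans ay); apply: ler_wpM2r => //.
  by rewrite /L lerDr addr_ge0.
have aL : `|LR| * `|w0 - w0'| + `|LS| * `|w0 - w0'| <= L * `|w0 - w0'|.
  by rewrite -mulrDl; apply: ler_wpM2r => //; rewrite /L lerDl.
have xK : 2 * `|x - x'| <= K * `|x - x'| by apply: ler_wpM2r => //; rewrite /K; lra.
have -> : K * (`|w0 - w0'| + `|x - x'|) =
  (d * `|w0 - w0'| + 2 * `|w0 - w0'| + L * `|w0 - w0'| + B * L * `|w0 - w0'|) + K * `|x - x'|.
  by rewrite /K; ring.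
have n0 : 0 <= `|w0 - w0'| by [].
by move: e1 e2 gg aR aS aB aL xK n0; clear; lra.
Qed.

Lemma density_periodic {R : realType} (t lambda : R) (k r : nat) (m : int) (w x : R) :
  density t lambda k r w (x + m%:~R) = density t lambda k r w x.
Proof. by rewrite /density !addrA good_len_shift. Qed.

(** * The limit of the gap distribution *)

Lemma cvgn_le {R : realType} (u : nat -> R) (l : R) :
  (forall d, 0 < d -> exists n0 : nat, forall n : nat, (n0 <= n)%N -> `|u n - l| <= d) ->
  u n @[n --> \oo] --> l.
Proof.
move=> h; apply/cvgrPdist_le => d d0; have [n0 hn] := h d d0.
by near=> n; rewrite distrC; apply: hn; near: n; exact: nbhs_infty_ge.
Unshelve. all: by end_near. Qed.

(** The contribution of the pair (k, r) to the number of gaps divided by J^2. *)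
Definition density_sum {R : realType} (t lambda : R) (k r J : nat) : R :=
  let c := lambda * t / 2 in
  (\sum_(0 <= b < J.+1 | c * J%:R <= b%:R)
    density t lambda k r (clamp c (b%:R / J%:R)) (t * J%:R ^+ 2 / b%:R)) / J%:R.

Definition density_mean {R : realType} (t lambda : R) (k r : nat) : R -> R :=
  mean_Phi (fun w => density t lambda k r (clamp (lambda * t / 2) w)).

Lemma density_sum_cvg {R : realType} (t lambda : R) (k r : nat) : 0 < t -> 0 < lambda ->
  lambda * t / 2 <= 1 ->
  density_sum t lambda k r J @[J --> \oo] --> Rint (lambda * t / 2) 1 (density_mean t lambda k r).
Proof.
move=> t0 l0 c1; have c0 : 0 < lambda * t / 2 by rewrite divr_gt0// mulr_gt0.
have [K hK] := density_lip t lambda k r c0 c1.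
apply: cvgn_le => d d0.
by apply: equidistribution hK _ t0 c0 c1 d0 => m w x; exact: density_periodic.
Qed.

Lemma row_model_len_density {R : realType} (t lambda : R) (J b h : nat) : (0 < J)%N -> (b <= J)%N ->
  lambda * t / 2 * J%:R <= b%:R ->
  row_model_len t lambda J b h = J%:R * \sum_(k < h.+1) \sum_(r < h.+1)
    density t lambda k r (clamp (lambda * t / 2) (b%:R / J%:R)) (t * J%:R ^+ 2 / b%:R).
Proof.
move=> J0 bJ cb; have JR : 0 < J%:R :> R by rewrite ltr0n.
have ck : clamp (lambda * t / 2) (b%:R / J%:R) = b%:R / J%:R :> R.
  by apply: clamp_id; rewrite ler_pdivlMr// cb ler_pdivrMr// mul1r ler_nat.
rewrite /row_model_len -[iota 0 h.+1]/(index_iota 0 h.+1) big_mkord !mulr_sumr.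
apply: eq_bigr => k _; rewrite big_mkord !mulr_sumr.
apply: eq_bigr => r _; rewrite ck /density mulrA (mulrC J%:R) mulfVK ?gt_eqF//.
Qed.

Lemma gap_distribution_model {R : realType} (t lambda : R) : 0 < t -> 0 < lambda ->
  exists K : R, exists J1 : nat, (0 < J1)%N /\ forall J : nat, (J1 <= J)%N ->
  `|gap_distribution t lambda J - J%:R ^+ 2 / (npoints J)%:R *
      \sum_(k < (hmax t).+1) \sum_(r < (hmax t).+1) density_sum t lambda k r J| <= K / J%:R.
Proof.
move=> t0 l0; have [K [J1 hK]] := num_gaps_model t0 l0.
exists `|K|, J1.+1; split=> // J JJ1; have J0 : (0 < J)%N by exact: leq_trans JJ1.
have JR : 0 < J%:R :> R by rewrite ltr0n.
have := hK J (ltnW JJ1).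
have -> : \sum_(0 <= b < J.+1 | lambda * t / 2 * J%:R <= b%:R) row_model_len t lambda J b (hmax t) =
  J%:R ^+ 2 * \sum_(k < (hmax t).+1) \sum_(r < (hmax t).+1) density_sum t lambda k r J.
  transitivity (\sum_(0 <= b < J.+1 | lambda * t / 2 * J%:R <= b%:R)
     J%:R * \sum_(k < (hmax t).+1) \sum_(r < (hmax t).+1)
     density t lambda k r (clamp (lambda * t / 2) (b%:R / J%:R)) (t * J%:R ^+ 2 / b%:R)).
    rewrite big_nat_cond [RHS]big_nat_cond; apply: eq_bigr => b /andP[/andP[_ bJ] cb].
    exact: row_model_len_density.
  rewrite -mulr_sumr [X in _ = X * _]expr2 -[RHS]mulrA; congr (_ * _).
  rewrite exchange_big mulr_sumr; apply: eq_bigr => k _.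
  rewrite exchange_big mulr_sumr; apply: eq_bigr => r _.
  by rewrite /density_sum [RHS]mulrC mulfVK ?gt_eqF.
set S := (X in _ ^+ 2 * X) => h.
have N0 : 0 < (npoints J)%:R :> R by rewrite ltr0n /npoints muln_gt0 !addn1.
have -> : gap_distribution t lambda J = (num_gaps t lambda J)%:R / (npoints J)%:R by [].
rewrite -mulrA (mulrC _^-1) mulrA -mulrBl normrM (gtr0_norm (x := _^-1)) ?invr_gt0// ler_pdivrMr//.
apply: (le_trans h); apply: (@le_trans _ _ (`|K| * J%:R)).
  by apply: ler_wpM2r => //; exact: ler_norm.
rewrite -mulrA; apply: ler_wpM2l => //.
rewrite mulrC ler_pdivlMr// npointsE -subr_ge0.
rewrite (_ : _ - _ = J%:R ^+ 2 + 3 * J%:R + 1); last by ring.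
by rewrite !addr_ge0// mulr_ge0.
Qed.

Lemma sqr_div_npoints_cvg {R : realType} : (J%:R ^+ 2 / (npoints J)%:R : R) @[J --> \oo] --> (2^-1 : R).
Proof.
apply: cvgn_le => d d0; have [n0 [n00 hn]] := div_nat_small 1 d0.
exists n0 => n /[dup] n0n /hn; apply: le_trans.
have nR : 0 < n%:R :> R by rewrite ltr0n; exact: leq_trans n0n.
rewrite npointsE.
have -> : n%:R ^+ 2 / ((2 * n%:R + 1) * (n%:R + 1)) - 2^-1 =
  - ((3 * n%:R + 1) / (2 * ((2 * n%:R + 1) * (n%:R + 1)))) :> R.
  by field; rewrite !gt_eqF//; lra.
rewrite normrN ger0_norm; last by rewrite divr_ge0 ?mulr_ge0//; lra.
rewrite ler_pdivrMr; last by rewrite !mulr_gt0//; lra.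
rewrite -subr_ge0.
have -> : 1 / n%:R * (2 * ((2 * n%:R + 1) * (n%:R + 1))) - (3 * n%:R + 1) =
   n%:R + 5 + 2 / n%:R :> R by field; rewrite gt_eqF.
have : 0 <= 2 / n%:R :> R by rewrite divr_ge0.
by lra.
Qed.

Lemma gap_distribution_cvg {R : realType} (t lambda I : R) : 0 < t -> 0 < lambda ->
  (\sum_(k < (hmax t).+1) \sum_(r < (hmax t).+1) density_sum t lambda k r J) @[J --> \oo] --> I ->
  gap_distribution t lambda J @[J --> \oo] --> 2^-1 * I.
Proof.
move=> t0 l0 hI.
set S := fun J => \sum_(k < (hmax t).+1) \sum_(r < (hmax t).+1) density_sum t lambda k r J in hI *.
have [K [J1 [J10 hK]]] := gap_distribution_model t0 l0.
have e0 : (gap_distribution t lambda J - J%:R ^+ 2 / (npoints J)%:R * S J) @[J --> \oo] --> (0 : R).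
  apply: cvgn_le => d d0; have [n0 [n00 hn]] := div_nat_small K d0.
  exists (maxn J1 n0) => J; rewrite geq_max => /andP[/hK h1 /hn h2].
  by rewrite subr0; apply: le_trans h1 h2.
rewrite -[2^-1 * I]add0r (_ : gap_distribution t lambda = fun J =>
  (gap_distribution t lambda J - J%:R ^+ 2 / (npoints J)%:R * S J) +
     J%:R ^+ 2 / (npoints J)%:R * S J); last by apply/funext => J; rewrite subrK.
exact: cvgD e0 (cvgM sqr_div_npoints_cvg hI).
Qed.

(** At these heights S_{k,r,w} <= R_{k,r,w}. *)
Lemma density_eq0 {R : realType} (t lambda : R) (k r : nat) (w x : R) : 0 < w ->
  w <= (k + r)%:R * t / 2 \/ (k + r + 2)%:R * t / 2 <= w -> density t lambda k r w x = 0.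
Proof.
move=> w0 hw; rewrite /density; suff -> : good_len k r (Rkr t k r w + x) (Skr t k r w + x) (yw t lambda w) = 0.
  by rewrite mulr0.
apply/eqP; rewrite eq_le len_ge0 andbT.
apply: le_trans (good_len_le_itv _ _ _ _ _) _; rewrite ge_max lexx/=.
rewrite (_ : _ + x - _ = Skr t k r w - Rkr t k r w); last by ring.
rewrite subr_le0 /Skr /Rkr ge_min !le_max.
have w2 : 0 < w ^+ 2 by rewrite exprn_gt0.
case: hw => hw.
  have h : 1 / w - r%:R * t / w ^+ 2 <= k%:R * t / w ^+ 2 - 1 / w.
    rewrite -subr_ge0.
    have -> : k%:R * t / w ^+ 2 - 1 / w - (1 / w - r%:R * t / w ^+ 2) =
      ((k + r)%:R * t - 2 * w) / w ^+ 2 by rewrite natrD; field; rewrite gt_eqF.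
    by apply: divr_ge0; [lra|exact: ltW].
  by rewrite h orbT.
have h : k.+1%:R * t / w ^+ 2 - 1 / w <= 1 / w - r.+1%:R * t / w ^+ 2.
  rewrite -subr_ge0.
  have -> : 1 / w - r.+1%:R * t / w ^+ 2 - (k.+1%:R * t / w ^+ 2 - 1 / w) =
    (2 * w - (k + r + 2)%:R * t) / w ^+ 2 by rewrite !natrD -[k.+1%:R]natr1 -[r.+1%:R]natr1; field; rewrite gt_eqF.
  by apply: divr_ge0; [lra|exact: ltW].
by rewrite h orbT.
Qed.

Lemma EFin_Rint {R : realType} (f : R -> R) (u v : R) : continuous f ->
  (\int[lebesgue_measure]_(x in `[u, v]) (f x)%:E)%E = (Rint u v f)%:E.
Proof.
move=> cf; rewrite /Rintegral fineK//; apply: integrable_fin_num; first exact: measurable_itv.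
exact: continuous_integrable_itv.
Qed.

Lemma Rint_eq0 {R : realType} (f : R -> R) (u v : R) : continuous f -> u <= v ->
  (forall x, u <= x <= v -> f x = 0) -> Rint u v f = 0.
Proof.
move=> cf uv h; have := @Rint_near_cst _ f 0 0 u v cf uv.
rewrite !mul0r subr0 normr_le0 => H; apply/eqP/H => x /h ->; by rewrite subr0 normr0.
Qed.

Lemma Rint_point {R : realType} (f : R -> R) (u : R) : continuous f -> Rint u u f = 0.
Proof. by move=> cf; have := Rint_cat cf (lexx u) (lexx u); lra. Qed.

(** When max c a exceeds min d b, no point of [c, d] lies strictly between a and b. *)
Lemma Rint_support {R : realType} (f : R -> R) (c d a b : R) : continuous f -> c <= d ->
  (forall w, c <= w <= d -> w <= a \/ b <= w -> f w = 0) ->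
  let m := Num.max c a in let M := Num.min d b in
  Rint c d f = if m <= M then Rint m M f else 0.
Proof.
move=> cf cd f0 m M; have [mM|Mm] := leP m M; last first.
  apply: Rint_eq0 => // w hw; apply: f0 => //.
  have [wa|aw] := leP w a; [by left|right]; have [//|wb] := leP b w.
  move: Mm; rewrite ltNge => /negP[]; rewrite /m /M.
  by apply: (@le_trans _ _ w); rewrite ?ge_max ?le_min ?(ltW aw) ?(ltW wb) ?andbT; case/andP: hw.
have cm : c <= m by rewrite /m le_max lexx.
have Md : M <= d by rewrite /M ge_min lexx.
rewrite (Rint_cat cf cm (le_trans mM Md)) (Rint_cat cf mM Md).
have -> : Rint c m f = 0.
  rewrite /m; have [ac|ca] := leP a c; first exact: Rint_point.
  apply: Rint_eq0 => //; first exact: ltW.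
  move=> w /andP[cw wa]; apply: f0; last by left.
  by rewrite cw (le_trans wa)// (le_trans _ Md)// (le_trans _ mM)// /m le_max lexx orbT.
have -> : Rint M d f = 0.
  rewrite /M; have [bd|db] := leP b d; last exact: Rint_point.
  apply: Rint_eq0 => // w /andP[bw wd]; apply: f0; last by right.
  by rewrite wd (le_trans _ bw)// (le_trans cm)// (le_trans mM)// /M ge_min lexx orbT.
by rewrite addr0 add0r.
Qed.

(** The range from c to 1 shrinks to that from M^- to M^+, outside which the density vanishes. *)
Lemma density_mean_integral {R : realType} (t lambda : R) (k r : nat) : 0 < t -> 0 < lambda ->
  lambda * t / 2 <= 1 ->
  (Rint (lambda * t / 2) 1 (density_mean t lambda k r))%:E =
  (if (Mminus t lambda k r <= Mplus t k r)%R then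
    \int[lebesgue_measure]_(w in `[Mminus t lambda k r, Mplus t k r])
      \int[lebesgue_measure]_(x in `[0%R, 1%R]) (w%:E * lebesgue_measure (Akr t lambda k r w x))
   else 0)%E.
Proof.
move=> t0 l0 c1; have c0 : 0 < lambda * t / 2 by rewrite divr_gt0// mulr_gt0.
have [K hK] := density_lip t lambda k r c0 c1.
have cD w : continuous (density t lambda k r (clamp (lambda * t / 2) w)).
  exact: lip_continuous (Phi_lip hK w).
have cM : continuous (density_mean t lambda k r) := lip_continuous (Psi_lip hK).
rewrite (@Rint_support _ _ _ _ ((k + r)%:R * t / 2) ((k + r + 2)%:R * t / 2) cM c1); last first.
  move=> w /[dup] hw /clamp_id cw h; rewrite /density_mean /mean_Phi.
  apply: Rint_eq0 => // x _; rewrite cw density_eq0//.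
  by apply: lt_le_trans c0 _; case/andP: hw.
rewrite -/(Mminus t lambda k r) -/(Mplus t k r); case: ifP => // MM.
rewrite -EFin_Rint//; apply: eq_integral => w; rewrite inE /= in_itv /= => /andP[mw wM].
have hw : lambda * t / 2 <= w <= 1.
  rewrite (le_trans _ mw) ?(le_trans wM)//; first by rewrite /Mplus ge_min lexx.
  by rewrite /Mminus le_max lexx.
rewrite /density_mean /mean_Phi -EFin_Rint//; apply: eq_integral => x _.
rewrite clamp_id// /density EFinM Akr_good_set; congr (_ * _)%E.
by rewrite (len_fin (measurable_good_set _ _ _ _ _) (@good_set_sub _ _ _ _ _ _)).
Qed.

(** If lambda t / 2 > 1, no row reaches the height lambda t J / 2, so that the distribution tends to
    0; and all the index sets on the right are empty, since M^- > 1 >= M^+. *)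
Lemma gap_distribution_limit {R : realType} (t lambda : R) : 0 < t -> 0 < lambda ->
  exists2 l : R, gap_distribution t lambda J @[J --> \oo] --> l &
  l%:E = ((2^-1)%:E * \sum_(k < (hmax t).+1)
    \sum_(r < (hmax t).+1 | (Mminus t lambda k r <= Mplus t k r)%R)
      \int[lebesgue_measure]_(w in `[Mminus t lambda k r, Mplus t k r])
        \int[lebesgue_measure]_(x in `[0%R, 1%R])
          (w%:E * lebesgue_measure (Akr t lambda k r w x)))%E.
Proof.
move=> t0 l0; have [c1|c1] := leP (lambda * t / 2) 1.
  exists (2^-1 * \sum_(k < (hmax t).+1) \sum_(r < (hmax t).+1)
     Rint (lambda * t / 2) 1 (density_mean t lambda k r)).
    apply: gap_distribution_cvg => //.
    apply: cvg_big => [|k _]; first exact: add_continuous.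
    apply: cvg_big => [|r _]; first exact: add_continuous.
    exact: density_sum_cvg.
  rewrite EFinM -sumEFin; congr (_ * _)%E; apply: eq_bigr => k _.
  rewrite -sumEFin [RHS]big_mkcond; apply: eq_bigr => r _.
  exact: density_mean_integral.
exists (2^-1 * 0).
  apply: gap_distribution_cvg => //.
  apply: cvgn_le => d d0; exists 1%N => J J0.
  rewrite subr0 big1 ?normr0 ?ltW// => k _; rewrite big1// => r _.
  rewrite /density_sum big_nat_cond big_pred0 ?mul0r// => b.
  apply/negbTE/negP => /andP[/andP[_ bJ]]; apply/negP; rewrite -ltNge.
  have JR : 0 < J%:R :> R by rewrite ltr0n.
  apply: (@le_lt_trans _ _ (1 * J%:R)); first by rewrite mul1r ler_nat.
  by rewrite ltr_pM2r.
rewrite mulr0 big1 ?mule0// => k _; rewrite big_pred0// => r.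
apply/negbTE; rewrite -ltNge; apply: (@le_lt_trans _ _ 1).
  by rewrite /Mplus ge_min lexx.
by rewrite /Mminus lt_max c1.
Qed.

Theorem theorem2p2 (R : realType) (t lambda : R) (ht : 0 < t) (hlambda : 0 < lambda) :
  cvgn (gap_distribution t lambda) /\
  ((limit_gap_distribution t lambda)%:E =
   (2^-1)%:E *
   \sum_(k < (hmax t).+1)
    \sum_(r < (hmax t).+1 | (Mminus t lambda k r <= Mplus t k r)%R)
      \int[lebesgue_measure]_(w in `[Mminus t lambda k r, Mplus t k r])
        \int[lebesgue_measure]_(x in `[0%R, 1%R])
          (w%:E * lebesgue_measure (Akr t lambda k r w x)))%E.
Proof.
have [l hl <-] := gap_distribution_limit ht hlambda.
split; first by apply/cvg_ex; exists l.
by rewrite /limit_gap_distribution; congr (_%:E); apply: cvg_lim.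
Qed.
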